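(* For any differentiable map $F:X\to Y$ of differentiable manifolds the pull-back operation $\delta\mapsto F^*\delta$, $(F^*\delta)_x=(dF_x)^*\delta_{F(x)}$, defines a ring homomorphism $\mathfrak n(Y)\to\mathfrak n(X)$ between the rings of normal densities. The assignment $X\mapsto\mathfrak n(X)$ is a contravariant functor from the category of differentiable manifolds to the category of commutative graded rings. For any $\delta\in\mathfrak n(Y)$ and $f\in C(Y)$ one has $F^*(f\delta)=(f\circ F)\cdot F^*\delta$.
   Context: Densities: a $k$-density on a vector space is a continuous function $\delta$ on the cone of decomposable $k$-vectors with $\delta(t\xi)=|t|\delta(\xi)$; a $k$-density on a manifold is a $k$-density $\delta_x$ on each tangent space $T_x$ such that $x\mapsto\delta_x$ is continuous. For a linear map $L:U\to V$ and a $k$-density $\delta$ on $V$, the pull-back is $(L^*\delta)(\xi_1\wedge\ldots\wedge\xi_k)=\delta(L\xi_1\wedge\ldots\wedge L\xi_k)$. Normal densities on a real vector space $V$, $\dim V=n<\infty$: $\mathrm{Gr}_a(k,V)$ is the Grassmannian of affine subspaces of codimension $k$. A normal measure on $\mathrm{Gr}_a(k,V)$ is a translation invariant Borel measure, finite on compact sets. For $D\subset V$ let $\mathcal J_{k,D}=\{H\in\mathrm{Gr}_a(k,V): H\cap D\ne\emptyset\}$. For a normal measure $\mu_k$ let $\chi_k(\mu_k)(\xi_1\wedge\ldots\wedge\xi_k)=\mu_k(\mathcal J_{k,\Pi_\xi})$, $\Pi_\xi$ being the parallelotope generated by $\xi_1,\ldots,\xi_k$; this is a translation invariant $k$-density,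 and $\chi_k$ extends linearly to the space $\mathfrak m_k$ of differences of normal measures. Linear combinations of densities $\chi_k(\mu_k)$ are called normal $k$-densities; they form the space $\mathfrak n_k$. The product of normal measures is the normal measure with $(\mu_p\mu_q)(D)=(\mu_p\times\mu_q)(\{(G,H):\operatorname{codim}(G\cap H)=p+q,\ G\cap H\in D\})$ for bounded $D\subset\mathrm{Gr}_a(p+q,V)$ if $p+q\le n$, and $0$ if $p+q>n$; it is extended bilinearly to the $\mathfrak m_k$. The product of normal densities is the (well-defined) one for which $\chi_p(\mu_p)\cdot\chi_q(\mu_q)=\chi_{p+q}(\mu_p\mu_q)$; it makes $\mathfrak n=\mathfrak n_0\oplus\cdots\oplus\mathfrak n_n$ a commutative graded ring. Normal densities on a manifold $X$: for each $x\in X$ let $\mathfrak n_x$ be the graded ring of normal densities on $T_xX$. A density $\delta$ on $X$ is normal if $\delta_x\in\mathfrak n_x$ for every $x\in X$. $\mathfrak n(X)$ is the set of normal densities on $X$; with pointwise multiplication it is a commutative graded algebra over $C(X)$, the ring of continuous real functions on $X$.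
   Formalization: Products of continuous normal densities can be discontinuous, so n(X) is not asserted closed under products: it is shown to satisfy all other graded-ring laws, the normal densities without continuity in x form the ring, and F^* is a homomorphism on both. Differentiable means C^1. *)

(* Defs.v *)
From HB Require Import structures.
From mathcomp Require Import all_boot all_order all_algebra.
From mathcomp Require Import all_classical all_reals all_analysis.

Set Implicit Arguments.
Unset Strict Implicit.
Unset Printing Implicit Defensive.

Import Order.TTheory GRing.Theory Num.Theory.
Import numFieldNormedType.Exports.

Local Open Scope classical_set_scope.
Local Open Scope ring_scope.

Record graded_ops (T : Type) := GradedOps {
  g0 : T;
  g1 : T;
  gadd : T -> T -> T;
  gopp : T -> T;
  gmul : T -> T -> T;
  gpart : nat -> T -> T   (* homogeneous component of a given degree *)
}.

(* All the axioms of a commutative graded ring except stability of S under the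
   product, which is added in comm_graded_ring. *)
Record comm_graded_laws (T : Type) (o : graded_ops T) (S : set T) : Prop := {
  cgr_0 : S (g0 o);
  cgr_1 : S (g1 o);
  cgr_add : forall a b, S a -> S b -> S (gadd o a b);
  cgr_opp : forall a, S a -> S (gopp o a);
  cgr_part : forall k a, S a -> S (gpart o k a);
  cgr_addA : forall a b c, S a -> S b -> S c ->
    gadd o a (gadd o b c) = gadd o (gadd o a b) c;
  cgr_addC : forall a b, S a -> S b -> gadd o a b = gadd o b a;
  cgr_add0 : forall a, S a -> gadd o (g0 o) a = a;
  cgr_addN : forall a, S a -> gadd o (gopp o a) a = g0 o;
  cgr_mulA : forall a b c, S a -> S b -> S c ->
    gmul o a (gmul o b c) = gmul o (gmul o a b) c;
  cgr_mulC : forall a b, S a -> S b -> gmul o a b = gmul o b a;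
  cgr_mul1 : forall a, S a -> gmul o (g1 o) a = a;
  cgr_mulD : forall a b c, S a -> S b -> S c ->
    gmul o (gadd o a b) c = gadd o (gmul o a c) (gmul o b c);
  cgr_partD : forall k a b, S a -> S b ->
    gpart o k (gadd o a b) = gadd o (gpart o k a) (gpart o k b);
  cgr_partK : forall j k a, S a ->
    gpart o j (gpart o k a) = if j == k then gpart o k a else g0 o;
  cgr_sum : exists n : nat, forall a, S a ->
    a = \big[gadd o/g0 o]_(k < n) gpart o k a;
  cgr_part1 : gpart o 0 (g1 o) = g1 o;
  cgr_partM : forall p q a b, S a -> S b ->
    gpart o (p + q) (gmul o (gpart o p a) (gpart o q b))
    = gmul o (gpart o p a) (gpart o q b)
}.

Definition comm_graded_ring (T : Type) (o : graded_ops T) (S : set T) : Prop :=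
  comm_graded_laws o S /\ forall a b, S a -> S b -> S (gmul o a b).

Record graded_ring_hom (T T' : Type) (o : graded_ops T) (S : set T)
    (o' : graded_ops T') (S' : set T') (h : T -> T') : Prop := {
  grh_maps : forall a, S a -> S' (h a);
  grh_1 : h (g1 o) = g1 o';
  grh_add : forall a b, S a -> S b -> h (gadd o a b) = gadd o' (h a) (h b);
  grh_mul : forall a b, S a -> S b -> h (gmul o a b) = gmul o' (h a) (h b);
  grh_part : forall k a, S a -> h (gpart o k a) = gpart o' k (h a)
}.

Section Densities.
Context (R : realType).

Definition dual (V : vectType R) := 'Hom(V, R^o).

(* The exterior power of V lives in the space of functions of k linear forms
   (as the alternating k-linear ones); on that finite-dimensional subspace the
   topology of pointwise convergence is the vector space topology. *)
Definition kform_fun (k : nat) (V : vectType R) : topologicalType :=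
  {ptws ('I_k -> dual V) -> R}.

Definition wedge_fun (k : nat) (V : vectType R) (xi : 'I_k -> V) :
    kform_fun k V :=
  fun f => \det (\matrix_(i < k, j < k) (f j (xi i) : R)).

(* The scalar t is redundant for 0 < k; for k = 0 it makes the cone the whole
   line of 0-vectors. *)
Definition cone (k : nat) (V : vectType R) : set (kform_fun k V) :=
  [set w | exists t (xi : 'I_k -> V), forall f, w f = t * wedge_fun xi f].

Arguments cone : clear implicits.

Definition kdens (k : nat) (V : vectType R) := cone k V -> R.

Lemma wedge_subproof k (V : vectType R) (xi : 'I_k -> V) :
  wedge_fun xi \in cone k V.
Proof. by apply/mem_set; exists 1, xi => f; rewrite mul1r. Qed.

Definition wedge k (V : vectType R) (xi : 'I_k -> V) : cone k V :=
  exist _ (wedge_fun xi) (wedge_subproof xi).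

Definition is_kdensity k (V : vectType R) (delta : kdens k V) : Prop :=
  continuous delta /\
  forall (t : R) (w w' : cone k V),
    (forall f, val w' f = t * val w f) -> delta w' = `|t| * delta w.

Lemma cone_map_subproof k (U V : vectType R) (L : 'Hom(U, V)) (w : cone k U) :
  (fun f : 'I_k -> dual V => val w (fun j => (f j \o L)%VF)) \in cone k V.
Proof.
apply/mem_set; case: w => /= w /set_mem [t [xi wE]].
exists t, (fun i => L (xi i)) => f; rewrite wE; congr (_ * \det _).
by apply/matrixP => i j; rewrite !mxE comp_lfunE.
Qed.

Definition cone_map k (U V : vectType R) (L : 'Hom(U, V)) (w : cone k U) :
    cone k V :=
  exist _ (fun f : 'I_k -> dual V => val w (fun j => (f j \o L)%VF))
    (cone_map_subproof L w).

Lemma cone_map_wedge k (U V : vectType R) (L : 'Hom(U, V)) (xi : 'I_k -> U) :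
  cone_map L (wedge xi) = wedge (fun i => L (xi i)).
Proof.
apply/val_inj/funext => f /=; congr (\det _).
by apply/matrixP => i j; rewrite !mxE comp_lfunE.
Qed.

Definition pull k (U V : vectType R) (L : 'Hom(U, V)) (delta : kdens k V) :
    kdens k U :=
  fun w => delta (cone_map L w).

End Densities.

Arguments cone {R} k V.
Arguments kdens {R} k V.

Section Grassmannian.
Context (R : realType) (V : vectType R).

Definition coset_of_dir (v : V) (W : {vspace V}) : set V :=
  [set x | x - v \in W].

Record flat := Flat {
  points :> set V;
  flatP : exists v W, points = coset_of_dir v W }.

HB.instance Definition _ := gen_eqMixin flat.
HB.instance Definition _ := gen_choiceMixin flat.

Lemma whole_subproof : exists v W, [set: V] = coset_of_dir v W.
Proof.
by exists 0, fullv; apply/seteqP; split=> x //= _; rewrite /coset_of_dir/= memvf.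
Qed.

HB.instance Definition _ := isPointed.Build flat (Flat whole_subproof).

Definition Gr (k : nat) : set flat :=
  [set H | exists v (W : {vspace V}),
     (points H = coset_of_dir v W) /\ (\dim W + k = \dim {:V})%N].

(* Solution set of k affine equations, in coordinates. *)
Definition solutions (k : nat) (p : 'M[R]_(\dim {:V}, k) * 'rV[R]_k) : set V :=
  [set v | passmx.rVof (vbasis {:V}) v *m p.1 = p.2].

(* The space of all flats is the disjoint sum of the Gr k, each of which has
   the quotient topology for the map sending a system (A, c) of k independent
   equations to its solution set.  (Working in the sum rather than in the single
   Gr k keeps the type pointed, as needed for measures, even when Gr k is
   empty.) *)
Definition flat_open (O : set flat) : Prop :=
  forall k, exists2 B : set ('M[R]_(\dim {:V}, k) * 'rV[R]_k), open B &
    forall p (H : flat), \rank p.1 = k -> points H = solutions p ->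
      (O H <-> B p).

Lemma flat_openT : flat_open setT.
Proof. by move=> k; exists setT => //; exact: openT. Qed.

Lemma flat_openI : setI_closed flat_open.
Proof.
move=> A B oA oB k; have [A' oA' hA] := oA k; have [B' oB' hB] := oB k.
exists (A' `&` B'); first exact: openI.
by move=> p H rp Hp; split=> -[/(hA p H rp Hp) ? /(hB p H rp Hp)].
Qed.

Lemma flat_open_bigcup (I : Type) (f : I -> set flat) :
  (forall i, flat_open (f i)) -> flat_open (\bigcup_i f i).
Proof.
move=> of_ k; have /choice[B hB] : forall i, exists B, open B /\
  forall p (H : flat), \rank p.1 = k -> points H = @solutions k p ->
  (f i H <-> B p) by move=> i; have [B ? ?] := of_ i k; exists B.
exists (\bigcup_i B i); first by apply: bigcup_open => i _; exact: (hB i).1.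
by move=> p H rp Hp; split=> -[i _ /((hB i).2 p H rp Hp) ?]; exists i.
Qed.

HB.instance Definition _ :=
  isOpenTopological.Build flat flat_openT flat_openI flat_open_bigcup.

Definition borel_flat := g_sigma_algebraType (@open flat).

Definition flat_measure := {measure set borel_flat -> \bar R}.

Definition shift_flats (v : V) (A : set flat) : set flat :=
  [set H | exists2 G, A G & points H = [set v + x | x in points G]].

(* A Borel measure on Gr k is one on the space of all flats that vanishes
   outside Gr k. *)
Definition normal_measure (k : nat) (mu : flat_measure) : Prop :=
  [/\ mu (~` Gr k) = 0%E,
      forall v (A : set borel_flat), measurable A ->
        mu (shift_flats v A) = mu A
    & forall A : set flat, compact A -> (mu A < +oo)%E].

Definition hit (D : set V) : set flat := [set H | points H `&` D !=set0].

Definition parallelotope (k : nat) (xi : 'I_k -> V) : set V :=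
  [set \sum_i t i *: xi i | t in [set t : 'I_k -> R | forall i, 0 <= t i <= 1]].

Definition chi (k : nat) (mu : flat_measure) (xi : 'I_k -> V) : R :=
  fine (mu (Gr k `&` hit (parallelotope xi))).

Definition bounded_flats (D : set flat) : Prop :=
  exists2 K : set flat, compact K & D `<=` K.

Definition measure_product (p q : nat) (mu nu rho : flat_measure) : Prop :=
  forall D : set borel_flat, measurable D -> D `<=` Gr (p + q) ->
    bounded_flats D ->
    rho D = (mu \x nu)%E
      [set GH : borel_flat * borel_flat | exists2 K : flat,
         D K & [/\ Gr p GH.1, Gr q GH.2 & points K = points GH.1 `&` points GH.2]].

End Grassmannian.

Section NormalDensities.
Context (R : realType) (V : vectType R).

Definition normal_comb k N (c : 'I_N -> R) (mu : 'I_N -> flat_measure V)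
    (delta : kdens k V) : Prop :=
  [/\ is_kdensity delta, forall i, normal_measure k (mu i)
    & forall xi, delta (wedge xi) = \sum_i c i * chi (mu i) xi].

Definition normal_kdens k : set (kdens k V) :=
  [set delta | exists N (c : 'I_N -> R) (mu : 'I_N -> flat_measure V),
     normal_comb c mu delta].

(* The degree m of the product is a separate argument, used with m = p + q,
   so that no transport along equalities of degrees is needed. *)
Definition is_product p q m (a : kdens p V) (b : kdens q V) (ab : kdens m V) :
    Prop :=
  exists N M (c : 'I_N -> R) (mu : 'I_N -> flat_measure V)
    (d : 'I_M -> R) (nu : 'I_M -> flat_measure V)
    (rho : 'I_N -> 'I_M -> flat_measure V),
  [/\ normal_comb c mu a, normal_comb d nu b, is_kdensity ab,
      forall i j, normal_measure m (rho i j) /\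
                  measure_product p q (mu i) (nu j) (rho i j)
    & forall xi, ab (wedge xi) =
        \sum_i \sum_j c i * d j * chi (rho i j) xi].

Definition nprod p q m (a : kdens p V) (b : kdens q V) : kdens m V :=
  xget (fun=> 0) [set ab | is_product a b ab].
Arguments nprod {p q} m.

(* Families of densities of all degrees.  In degree k > dim V the cone of
   decomposable k-vectors is {0} and every k-density vanishes, so that indexing
   by all of nat yields the direct sum over 0 <= k <= dim V. *)
Definition gdens := forall k, kdens k V.

Definition normal_gdens : set gdens := [set delta | forall k, normal_kdens (delta k)].

Definition gdens1 : gdens := fun k w =>
  if k == 0%N then `|val w (fun=> 0)| else 0.

Definition gdens_mul (a b : gdens) : gdens := fun m w =>
  \sum_(p < m.+1) nprod m (a p) (b (m - p)%N) w.

End NormalDensities.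

Definition C1_on (R : realType) m n (D : set 'rV[R]_m)
    (f : 'rV[R]_m -> 'rV[R]_n) : Prop :=
  forall y, D y -> differentiable f y /\
    forall v, {for y, continuous (fun z => 'd f z v)}.

Record chart (R : realType) (X : topologicalType) (n : nat) := Chart {
  cdom : set X;
  cmap :> X -> 'rV[R]_n;
  cinv : 'rV[R]_n -> X;
  cdom_open : open cdom;
  cimg_open : open (cmap @` cdom);
  cmapK : forall x, cdom x -> cinv (cmap x) = x;
  cmap_cont : forall x, cdom x -> {for x, continuous cmap};
  cinv_cont : forall x, cdom x -> {for cmap x, continuous cinv} }.

(* Manifolds and maps are of class C^1, the least regularity for which
   pull-backs of (continuous) densities make sense. *)
Record manifold (R : realType) := Manifold {
  mspace :> topologicalType;
  mdim : nat;
  atlas : set (chart R mspace mdim);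
  mhausdorff : hausdorff_space mspace;
  msecond_countable : @second_countable mspace;
  matlas_cover : forall x, exists2 phi, atlas phi & cdom phi x;
  matlas_C1 : forall phi psi, atlas phi -> atlas psi ->
    C1_on (phi @` (cdom phi `&` cdom psi)) (psi \o cinv phi) }.

Definition chart_at (R : realType) (X : manifold R) (x : X) :
    set (chart R X (mdim X)) :=
  [set phi | atlas phi /\ cdom phi x].

Definition C1_map (R : realType) (X Y : manifold R) (F : X -> Y) : Prop :=
  continuous F /\
  forall phi psi, atlas phi -> atlas psi ->
    C1_on (phi @` (cdom phi `&` F @^-1` cdom psi)) (psi \o F \o cinv phi).

Section Tangent.
Context (R : realType) (X : manifold R) (x : X).
Local Notation n := (mdim X).
Local Notation chartX := (chart R X n).

Definition transition (phi psi : chartX) : 'rV[R]_n -> 'rV[R]_n :=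
  'd (psi \o cinv phi) (phi x).

(* A tangent vector is the family of its coordinate vectors in the charts
   around x (the value at other charts being set to 0). *)
Definition tangent_family : {pred (chartX -> 'rV[R]_n)} :=
  [pred v | `[< (forall phi, ~ chart_at x phi -> v phi = 0) /\
     forall phi psi, chart_at x phi -> chart_at x psi ->
       v psi = transition phi psi (v phi) >]].

Lemma tangent_family_submod : submod_closed tangent_family.
Proof.
split=> [|a u v /asboolP[u0 uE] /asboolP[v0 vE]]; apply/asboolP; split.
- by [].
- by move=> phi psi _ _; rewrite /transition/= linear0.
- by move=> phi phix; rewrite !fctE u0// v0// scaler0 addr0.
- move=> phi psi phix psix.
  by rewrite !fctE (uE _ _ phix psix) (vE _ _ phix psix) /transition linearP.
Qed.

HB.instance Definition _ :=
  GRing.isSubmodClosed.Build R _ tangent_family tangent_family_submod.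

Record tangent := Tangent {
  tcoord : chartX -> 'rV[R]_n;
  tcoordP : tcoord \in tangent_family }.

HB.instance Definition _ := [isSub for tcoord].
HB.instance Definition _ := [Choice of tangent by <:].
HB.instance Definition _ := [SubChoice_isSubLmodule of tangent by <:].

Lemma near_eq_diff m p (f g : 'rV[R]_m -> 'rV[R]_p) (y : 'rV[R]_m) :
  (\forall z \near y, f z = g z) -> differentiable f y ->
  'd g y = 'd f y :> (_ -> _).
Proof.
move=> fg df; apply: diff_unique; first exact: diff_continuous.
have gy : g y = f y by have /nbhs_singleton := fg.
apply/eqaddoP => e e0; have /diff_locallyP[_ /eqaddoP/(_ e e0)] := df.
have : \forall z \near (0 : 'rV[R]_m), f (shift y z) = g (shift y z).
  by move: fg; rewrite (near_shift 0) subr0; apply: filterS => z.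
by apply: filterS2 => z fgz; rewrite !fctE/= gy fgz.
Qed.

Lemma near_eq_diff_comp m p q (f : 'rV[R]_m -> 'rV[R]_p)
    (g : 'rV[R]_p -> 'rV[R]_q) (h : 'rV[R]_m -> 'rV[R]_q) y z u :
  f y = z -> differentiable f y -> differentiable g z ->
  (\forall t \near y, (g \o f) t = h t) -> 'd g z ('d f y u) = 'd h y u.
Proof.
move=> <- df dg gfh.
have E1 := congr1 (fun k => k u) (near_eq_diff gfh (differentiable_comp df dg)).
have E2 := congr1 (fun k => k u) (diff_comp df dg).
exact: (etrans (esym E2) (esym E1)).
Qed.

Lemma near_chart (phi : chartX) (A : set X) : cdom phi x -> nbhs x A ->
  \forall y \near phi x, A (cinv phi y) /\ phi (cinv phi y) = y.
Proof.
move=> phix xA; near=> y; split.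
  near: y; have : cinv phi z @[z --> phi x] --> cinv phi (phi x).
    exact: cinv_cont.
  by rewrite cmapK//; exact.
have [z phiz <-] : (phi @` cdom phi) y.
  by near: y; apply: open_nbhs_nbhs; split; [exact: cimg_open|exists x].
by rewrite cmapK.
Unshelve. all: by end_near. Qed.

Lemma transition_comp (phi psi rho : chartX) (v : 'rV[R]_n) :
  chart_at x phi -> chart_at x psi -> chart_at x rho ->
  transition psi rho (transition phi psi v) = transition phi rho v.
Proof.
move=> [aphi dphi] [apsi dpsi] [arho drho].
have C1 (f g : chartX) : atlas f -> cdom f x -> atlas g -> cdom g x ->
    differentiable (g \o cinv f) (f x).
  by move=> af df ag dg; apply: (matlas_C1 af ag _).1; exists x.
have psiE : (psi \o cinv phi) (phi x) = psi x by rewrite /= cmapK.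
apply: (near_eq_diff_comp _ psiE (C1 _ _ aphi dphi apsi dpsi)
  (C1 _ _ apsi dpsi arho drho)).
have domx : nbhs x (cdom psi).
  by apply: open_nbhs_nbhs; split=> //; exact: cdom_open.
by apply: filterS (near_chart dphi domx) => y [psiy _]; rewrite /= cmapK.
Qed.

Lemma transition_id (phi : chartX) (v : 'rV[R]_n) :
  chart_at x phi -> transition phi phi v = v.
Proof.
move=> [_ phix].
have nE : \forall y \near phi x, idfun y = (phi \o cinv phi) y.
  by apply: filterS (near_chart phix filterT) => y [_ /= ->].
have did : is_diff (phi x) (@idfun 'rV[R]_n) (@idfun 'rV[R]_n) := is_diff_id _.
have [dd dv] := did.
have E := congr1 (fun k => k v) (near_eq_diff nE dd).
have E' := congr1 (fun k => k v) dv.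
exact: (etrans E E').
Qed.

Definition eval_chart (phi : chartX) (v : tangent) : 'rV[R]_n := tcoord v phi.

Lemma eval_chart_linear phi : linear (eval_chart phi).
Proof. by []. Qed.

HB.instance Definition _ phi := GRing.isLinear.Build R tangent 'rV[R]_n _
  (eval_chart phi) (@eval_chart_linear phi).

Lemma eval_chart_bij phi : chart_at x phi -> bijective (eval_chart phi).
Proof.
move=> phix.
pose fam (w : 'rV[R]_n) (psi : chartX) :=
  if pselect (chart_at x psi) then transition phi psi w else 0.
have famP w : fam w \in tangent_family.
  apply/asboolP; split=> [psi npsix|psi rho psix rhox].
    by rewrite /fam; case: pselect.
  by rewrite /fam; do 2![case: pselect => // ?]; rewrite transition_comp.
exists (fun w => Tangent (famP w)) => [v|w].
  apply/val_inj/funext => psi /=.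
  have /asboolP[v0 vE] := tcoordP v.
  rewrite /fam; case: pselect => [psix|npsix]; last by rewrite v0.
  by rewrite /eval_chart -vE.
by rewrite /eval_chart/= /fam; case: pselect => // ?; rewrite transition_id.
Qed.

Lemma some_chart_subproof : exists phi, chart_at x phi.
Proof. by have [phi ? ?] := @matlas_cover _ X x; exists phi. Qed.

Definition some_chart : chartX := projT1 (cid some_chart_subproof).

Lemma some_chartP : chart_at x some_chart.
Proof. exact: (projT2 (cid some_chart_subproof)). Qed.

Lemma tangent_vector_axiom : Vector.axiom n tangent.
Proof.
by exists (eval_chart some_chart);
  [exact: eval_chart_linear | exact: eval_chart_bij some_chartP].
Qed.

HB.instance Definition _ :=
  Lmodule_hasFinDim.Build R tangent tangent_vector_axiom.

Definition coord_map (phi : chartX) : 'Hom(tangent, 'rV[R]_n) :=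
  linfun (eval_chart phi).

End Tangent.

Definition tangent_map (R : realType) (X Y : manifold R) (F : X -> Y) (x : X) :
    'Hom(tangent x, tangent (F x)) :=
  let phi := some_chart x in
  let psi := some_chart (F x) in
  ((coord_map (F x) psi)^-1 \o
     (linfun ('d (psi \o F \o cinv phi) (phi x)) \o coord_map x phi))%VF.

Section ManifoldDensities.
Context (R : realType) (X : manifold R).

Definition mdens := forall x : X, gdens (tangent x).

(* Continuity of x |-> delta_x, read in charts: a chart around x identifies the
   tangent space at x with the space of row vectors. *)
Definition continuous_mdens (delta : mdens) : Prop :=
  forall k (phi : chart R X (mdim X)), atlas phi ->
    {within cdom phi `*` setT, continuous
      (fun p : X * cone k 'rV[R]_(mdim X) =>
         pull (coord_map p.1 phi)^-1%VF (@delta p.1 k) p.2)}.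

(* The ring of all sections of x |-> n_x.  Unlike it, its subset of sections
   that are continuous in x is not stable under the pointwise product when
   mdim X >= 2: in the plane, the square of the 1-density which on T_x is
   sum_j j^(-1/2) b_j(x) |xi| cos(2 j arg xi), for bumps b_j with disjoint supports
   converging to a point is unbounded near that point. *)
Definition normal_sections : set mdens :=
  [set delta | forall x, normal_gdens (delta x)].

Definition normal_densities : set mdens :=
  [set delta | normal_sections delta /\ continuous_mdens delta].

Definition mdens_scale (f : X -> R) (delta : mdens) : mdens :=
  fun x k w => f x * delta x k w.

Definition mdens_ops : graded_ops mdens := {|
  g0 := fun x k w => 0;
  g1 := fun x => @gdens1 R (tangent x);
  gadd := fun a b x k w => a x k w + b x k w;
  gopp := fun a x k w => - a x k w;
  gmul := fun a b x => gdens_mul (a x) (b x);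
  gpart := fun j a x k w => if k == j then a x k w else 0 |}.

End ManifoldDensities.

Definition pullback (R : realType) (X Y : manifold R) (F : X -> Y)
    (delta : mdens Y) : mdens X :=
  fun x k => pull (tangent_map F x) (@delta (F x) k).

Arguments normal_sections {R} X.
Arguments normal_densities {R} X.
Arguments mdens_ops {R} X.

(* Main.v *)
From HB Require Import structures.
Require Import Defs.
From mathcomp Require Import all_boot all_order all_algebra.
From mathcomp Require Import all_classical all_reals all_analysis.
From mathcomp Require Import perm measurable_realfun.
From mathcomp Require Import ring zify.

(** Pull-back of normal densities is multiplicative because it comes from an
operation on measures that respects intersections of flats. For a linear map
[L : U -> V], the preimage of a flat of codimension [k] is again a flat of
codimension [k] as soon as [L] is transversal to it. Pushing a normal measure
forward along this partially defined map gives a normal measure [mpull L k mu]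
on the flats of [U], and its density is the pull-back of the density of [mu]:
the preimage of a flat meets a parallelotope iff the flat meets the image of
the parallelotope ([chi_mpull]; the exceptional flats are negligible). Since
preimages commute with intersections, [mpull] commutes with products of
measures ([mpull_mprod]).

To draw conclusions for densities one has to know that their product exists, is
determined by the densities alone, and obeys the laws of a ring. The tool is
Crofton's formula ([crofton]): the measure of the flats [H] of codimension [k]
that meet a [k]-dimensional plate is the volume of the plate, measured in its
parameter space, times the integral, over a set of flats having transversal
measure 1 in every direction, of the absolute value of a determinant formed
with normalised equations of [H]. It shows that
- the function [chi mu] extends to a continuous homogeneous function on the
  cone ([density_of], [chi_density_of]), so normal measures have densities;
- flats that are not transversal to a plate are negligible
  ([nontransversal_null]);
- plates of any shape, not only parallelotopes, are hit with a measure that is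
  proportional to their volume ([hits_plate]).
The product of two normal measures is the image of the product measure under
the intersection of transversal pairs. For a fixed flat [G], the flats [H] for
which the intersection of [G] and [H] meets a parallelotope are those that meet
a plate of complementary dimension cut out by [G], so that their measure is a
multiple, depending on [G] only, of a value of the density of the second factor
([section_value]). Integrating over [G], the density of a product depends on
the second factor only through its density ([mprod_uniq_right]), and by
symmetry the same is true of the first factor. Commutativity, associativity
([mprodA]) and the unit ([mprod1]) follow from Tonelli's theorem and from
counting codimensions in a triple intersection.

All integrals are finite because every flat has equations with coefficients
between -1 and 1, normalised on the coordinates of a maximal minor
([bounded_frame_exists]). This choice can be made measurably ([rep]), and it
also shows that the flats meeting a compact set form a relatively compact set
([hits_bounded]).

On manifolds everything is pointwise except continuity. The chain rule gives
functoriality of the tangent map ([tangent_map_id], [tangent_map_comp]), and in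
charts the pull-back of a continuous density is its composition with a map of
points and cones that is continuous because the differential is
([pullback_continuous]). *)

Set Implicit Arguments.
Unset Strict Implicit.
Unset Printing Implicit Defensive.
Import Order.TTheory GRing.Theory Num.Theory.
Import numFieldNormedType.Exports.
Local Open Scope classical_set_scope.
Local Open Scope ring_scope.

(** * Convergence and measurability of matrix-valued functions *)

Section MatrixContinuity.
Context {R : realType}.

(** The topology of a matrix space is that of entrywise convergence, there being
finitely many entries. *)
Lemma mx_cvg (T : Type) (F : set_system T) (FF : Filter F) m n
    (f : T -> 'M[R]_(m, n)) (M : 'M[R]_(m, n)) :
  (forall i j, (fun t => f t i j) @ F --> M i j) -> f @ F --> M.
Proof.
move=> fM A [P MP PA].
have : \forall t \near F, forall i j, P i j (f t i j).
  apply: filter_forall => i; apply: filter_forall => j.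
  exact: (fM i j _ (MP i j)).
by apply: filterS => t; exact: PA.
Qed.

Lemma mx_cvg_entry (T : Type) (F : set_system T) (FF : Filter F) m n
    (f : T -> 'M[R]_(m, n)) (M : 'M[R]_(m, n)) i j :
  f @ F --> M -> (fun t => f t i j) @ F --> M i j.
Proof. by move=> fM; exact: (cvg_comp _ _ fM (@coord_continuous _ _ _ i j M)). Qed.

Lemma cvg_sumr (T I : Type) (F : set_system T) (FF : Filter F) (r : seq I)
    (f : I -> T -> R) (l : I -> R) :
  (forall i, f i @ F --> l i) ->
  (fun t => \sum_(i <- r) f i t) @ F --> \sum_(i <- r) l i.
Proof.
move=> fl; elim: r => [|i r IH].
  rewrite big_nil; under eq_fun do rewrite big_nil.
  exact: cvg_cst.
rewrite big_cons; under eq_fun do rewrite big_cons.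
exact: cvgD.
Qed.

Lemma cvg_prodr (T I : Type) (F : set_system T) (FF : Filter F) (r : seq I)
    (f : I -> T -> R) (l : I -> R) :
  (forall i, f i @ F --> l i) ->
  (fun t => \prod_(i <- r) f i t) @ F --> \prod_(i <- r) l i.
Proof.
move=> fl; elim: r => [|i r IH].
  rewrite big_nil; under eq_fun do rewrite big_nil.
  exact: cvg_cst.
rewrite big_cons; under eq_fun do rewrite big_cons.
exact: cvgM.
Qed.

Lemma cvg_mulmx (T : Type) (F : set_system T) (FF : Filter F) m n p
    (f : T -> 'M[R]_(m, n)) (g : T -> 'M[R]_(n, p)) (M : 'M[R]_(m, n)) (N : 'M[R]_(n, p)) :
  f @ F --> M -> g @ F --> N -> (fun t => f t *m g t) @ F --> M *m N.
Proof.
move=> fM gN; apply: mx_cvg => i j; rewrite mxE.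
under eq_fun do rewrite mxE.
by apply: cvg_sumr => l; apply: cvgM; exact: mx_cvg_entry.
Qed.

Lemma mulmxr_continuous m n p (N : 'M[R]_(n, p)) :
  continuous (fun M : 'M[R]_(m, n) => M *m N).
Proof. by move=> M; apply: (cvg_mulmx (F := nbhs M)); [exact: cvg_id|exact: cvg_cst]. Qed.

Lemma cvg_det (T : Type) (F : set_system T) (FF : Filter F) n
    (f : T -> 'M[R]_n) (M : 'M[R]_n) : f @ F --> M -> (fun t => \det (f t)) @ F --> \det M.
Proof.
move=> fM; rewrite /determinant; apply: cvg_sumr => s.
apply: cvgM; first exact: cvg_cst.
by apply: cvg_prodr => i; exact: mx_cvg_entry.
Qed.

Lemma cvg_rowsub (T : Type) (F : set_system T) (FF : Filter F) m n p
    (h : 'I_p -> 'I_m) (f : T -> 'M[R]_(m, n)) (M : 'M[R]_(m, n)) :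
  f @ F --> M -> (fun t => rowsub h (f t)) @ F --> rowsub h M.
Proof.
move=> fM; apply: mx_cvg => i j; rewrite mxE.
by under eq_fun do rewrite mxE; exact: mx_cvg_entry.
Qed.

Lemma near_unitmx (T : Type) (F : set_system T) (FF : Filter F) n
    (f : T -> 'M[R]_n) (M : 'M[R]_n) : M \in unitmx ->
  f @ F --> M -> \forall t \near F, f t \in unitmx.
Proof.
rewrite unitmxE unitfE => dM /(cvg_det FF) cd.
have : \forall t \near F, \det (f t) != 0.
  apply: (cd [set x | x != 0]).
  by apply: open_nbhs_nbhs; split => //; exact: open_neq.
by apply: filterS => t; rewrite unitmxE unitfE.
Qed.

(** The adjugate is polynomial in the entries, and the determinant stays away
from 0 near an invertible limit. *)
Lemma cvg_invmx (T : Type) (F : set_system T) (FF : Filter F) n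
    (f : T -> 'M[R]_n) (M : 'M[R]_n) : M \in unitmx ->
  f @ F --> M -> (fun t => invmx (f t)) @ F --> invmx M.
Proof.
move=> uM fM.
have dM : \det M != 0 by rewrite -unitfE -unitmxE.
have cd := cvg_det FF fM.
have near_unit := near_unitmx FF uM fM.
apply: (@cvg_trans _ ((fun t => (\det (f t))^-1 *: \adj (f t)) @ F)).
  apply: near_eq_cvg; apply: filterS near_unit => t ut.
  by rewrite /invmx ut.
rewrite /invmx uM; apply: mx_cvg => i j; rewrite !mxE.
under eq_fun do rewrite !mxE.
apply: cvgM; first exact: cvgV.
rewrite /cofactor; apply: cvgM; first exact: cvg_cst.
apply: cvg_det; apply: mx_cvg => a b; rewrite !mxE.
by under eq_fun do rewrite !mxE; exact: mx_cvg_entry.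
Qed.

End MatrixContinuity.

Section MatrixMeasurability.
Context {R : realType}.

(** Measurability is required entry by entry, which is stable under all matrix
operations; [mx_measurable_open] recovers the preimages of open sets. *)
Definition mx_measurable d (T : measurableType d) (D : set T) m n
    (f : T -> 'M[R]_(m, n)) :=
  forall i j, measurable_fun D (fun t => f t i j : R).

Definition rat_box m n (q : 'M[rat]_(m, n)) (k : nat) : set 'M[R]_(m, n) :=
  ball (map_mx ratr q : 'M[R]_(m, n)) k.+1%:R^-1.

(** Balls with rational centre and radius [1 / (k + 1)] form a countable base,
hence a Borel set of matrices can be tested on entries. *)
Lemma rat_box_cover m n (U : set 'M[R]_(m, n)) : open U ->
  U = \bigcup_(i in [set i : 'M[rat]_(m, n) * nat | rat_box i.1 i.2 `<=` U])
        rat_box i.1 i.2.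
Proof.
move=> oU; apply/seteqP; split=> [M UM|M [i iU]]; last exact: iU.
have /nbhs_ballP[e /= e0 eU] : nbhs M U by apply: open_nbhs_nbhs.
pose k := (Num.truncn (2 / e)).
have ke : k.+1%:R^-1 < e / 2.
  rewrite invf_plt ?posrE ?divr_gt0 ?ltr0Sn// invf_div.
  exact: truncnS_gt.
have k0 : 0 < (k.+1%:R^-1 : R) by rewrite invr_gt0.
have /choice[q qP] : forall ij : 'I_m * 'I_n, exists q : rat,
    ball (M ij.1 ij.2) (k.+1%:R^-1 : R) (ratr q : R).
  move=> ij; have := @rat_in_itvoo R (M ij.1 ij.2) (M ij.1 ij.2 + k.+1%:R^-1).
  rewrite ltrDl => /(_ k0)[q]; rewrite in_itv/= => /andP[q1 q2]; exists q.
  by rewrite /ball/= ltr_distl ltrBlDr q2/= (lt_trans q1)// ltrDl.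
pose Q := \matrix_(i, j) q (i, j).
have QM : ball M (k.+1%:R^-1 : R) (map_mx ratr Q : 'M[R]_(m, n)).
  by split => // i j; rewrite !mxE; exact: (qP (i, j)).
exists (Q, k) => /=; last exact: ball_sym.
move=> N QN; apply: eU; apply: (@le_ball _ _ M (k.+1%:R^-1 + k.+1%:R^-1)).
  by rewrite [leRHS](splitr e) lerD// ltW.
exact: ball_triangle QM QN.
Qed.

Lemma mx_measurable_open d (T : measurableType d) (D : set T) m n
    (f : T -> 'M[R]_(m, n)) (U : set 'M[R]_(m, n)) :
  measurable D -> mx_measurable D f -> open U -> measurable (D `&` f @^-1` U).
Proof.
move=> mD mf oU; rewrite (rat_box_cover oU) preimage_bigcup setI_bigcupr.
rewrite bigcup_mkcond; apply: countable_bigcupT_measurable => // -[q k].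
case: ifP => //= _.
rewrite (_ : _ `&` _ = \bigcap_(ij in [set: 'I_m * 'I_n])
   (D `&` (fun t => f t ij.1 ij.2) @^-1` (ball (ratr (q ij.1 ij.2) : R) k.+1%:R^-1)) `&` D).
  apply: measurableI => //; apply: fin_bigcap_measurable => // -[i j] _.
  by apply: mf => //; apply: open_measurable; exact: ball_open.
apply/seteqP; split=> t.
  move=> [Dt [_ ft]]; split=> // -[i j] _ /=.
  by split=> //; have := ft i j; rewrite mxE.
move=> [ft Dt]; split=> //; split=> [|i j]; first by rewrite invr_gt0.
by rewrite mxE; exact: (ft (i, j) I).2.
Qed.

Lemma mx_measurableM d (T : measurableType d) (D : set T) m n p
    (f : T -> 'M[R]_(m, n)) (g : T -> 'M[R]_(n, p)) :
  mx_measurable D f -> mx_measurable D g -> mx_measurable D (fun t => f t *m g t).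
Proof.
move=> mf mg i j; under eq_fun do rewrite mxE.
by apply: measurable_sum => k; apply: measurable_funM.
Qed.

Lemma mx_measurableD d (T : measurableType d) (D : set T) m n
    (f g : T -> 'M[R]_(m, n)) :
  mx_measurable D f -> mx_measurable D g -> mx_measurable D (fun t => f t + g t).
Proof. by move=> mf mg i j; under eq_fun do rewrite mxE; apply: measurable_funD. Qed.

Lemma mx_measurableB d (T : measurableType d) (D : set T) m n
    (f g : T -> 'M[R]_(m, n)) :
  mx_measurable D f -> mx_measurable D g -> mx_measurable D (fun t => f t - g t).
Proof. by move=> mf mg i j; under eq_fun do rewrite !mxE; apply: measurable_funB. Qed.

Lemma mx_measurable_cst d (T : measurableType d) (D : set T) m n (M : 'M[R]_(m, n)) :
  mx_measurable D (fun=> M).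
Proof. by move=> i j; exact: measurable_cst. Qed.

Lemma mx_measurable_row d (T : measurableType d) (D : set T) m n p
    (f : T -> 'M[R]_(m, n)) (g : T -> 'M[R]_(m, p)) :
  mx_measurable D f -> mx_measurable D g ->
  mx_measurable D (fun t => row_mx (f t) (g t)).
Proof.
move=> mf mg i j; under eq_fun do rewrite mxE.
by case: splitP => k _; [exact: mf|exact: mg].
Qed.

Lemma mx_measurable_col d (T : measurableType d) (D : set T) m n p
    (f : T -> 'M[R]_(m, n)) (g : T -> 'M[R]_(p, n)) :
  mx_measurable D f -> mx_measurable D g ->
  mx_measurable D (fun t => col_mx (f t) (g t)).
Proof.
move=> mf mg i j; under eq_fun do rewrite mxE.
by case: splitP => k _; [exact: mf|exact: mg].
Qed.

Lemma measurable_det d (T : measurableType d) (D : set T) n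
    (f : T -> 'M[R]_n) : mx_measurable D f ->
  measurable_fun D (fun t => \det (f t) : R).
Proof.
move=> mf; apply: measurable_sum => s.
apply: measurable_funM; first exact: measurable_cst.
by apply: measurable_prod => i _; exact: mf.
Qed.

Lemma mx_measurable_fun_comp d d' (T : measurableType d) (T' : measurableType d')
   m n (h : T' -> T) (f : T -> 'M[R]_(m, n)) :
  measurable_fun setT h -> mx_measurable setT f -> mx_measurable setT (f \o h).
Proof. by move=> mh mf i j; exact: (measurableT_comp (mf i j)). Qed.

(** A pair of matrices is read off one stacked matrix. *)
Lemma mx_measurable_pair_open d (T : measurableType d) (D : set T) m n k
    (f : T -> 'M[R]_(m, n)) (g : T -> 'M[R]_(k, n))
    (B : set ('M[R]_(m, n) * 'M[R]_(k, n))) :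
  measurable D -> mx_measurable D f -> mx_measurable D g -> open B ->
  measurable (D `&` [set t | B (f t, g t)]).
Proof.
move=> mD mf mg oB.
have /(mx_measurable_open mD (mx_measurable_col mf mg)) :
    open [set M : 'M[R]_(m + k, n) | B (usubmx M, dsubmx M)].
  rewrite (_ : [set _ | _] = (fun M : 'M[R]_(m + k, n) => (usubmx M, dsubmx M)) @^-1` B)//.
  apply: open_comp => // M _.
  apply: (cvg_pair (F := nbhs M) (G := nbhs (usubmx M)) (H := nbhs (dsubmx M))) => /=;
    apply: mx_cvg => i j.
    by rewrite mxE; under eq_fun do rewrite mxE; exact: (@coord_continuous _ _ _ _ _ M).
  by rewrite mxE; under eq_fun do rewrite mxE; exact: (@coord_continuous _ _ _ _ _ M).
by rewrite /preimage; under eq_set do rewrite /= col_mxKu col_mxKd.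
Qed.

End MatrixMeasurability.

(** * Borel measures and Tonelli's theorem *)

Section MeasureTools.
Context d1 d2 (T1 : measurableType d1) (T2 : measurableType d2) (R : realType).

Definition push_measure (m : {measure set T1 -> \bar R}) (f : T1 -> T2)
    (mf : measurable_fun setT f) : {measure set T2 -> \bar R}.
Proof. by refine (pushforward m f : {measure set T2 -> \bar R}); exact: mf. Defined.

End MeasureTools.

Section MeasurableBorel.

Lemma open_borel (S : ptopologicalType) (U : set S) :
  open U -> measurable (U : set (g_sigma_algebraType (@open S))).
Proof. by move=> oU; exact: sub_sigma_algebra. Qed.

Lemma closed_borel (S : ptopologicalType) (U : set S) :
  closed U -> measurable (U : set (g_sigma_algebraType (@open S))).
Proof.
by move=> cU; rewrite -[U]setCK; apply: measurableC; apply: open_borel; exact: closed_openC.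
Qed.

Lemma measurable_fun_borel d (T : measurableType d) (S : ptopologicalType)
    (D : set T) (f : T -> S) :
  (forall U, open U -> measurable (D `&` f @^-1` U)) ->
  measurable_fun D (f : T -> g_sigma_algebraType (@open S)).
Proof.
move=> h mD; have E : @measurable _ (g_sigma_algebraType (@open S)) = <<s @open S >> by [].
apply: (measurability _ E) => // _ [U oU <-].
exact: h.
Qed.

End MeasurableBorel.

Section SigmaFiniteAlias.
Context d (T : measurableType d) (R : realType) (m : {measure set T -> \bar R}).

(** An alias carrying a proof of sigma-finiteness, so that instances about
sigma-finite measures apply to a measure for which this is only a hypothesis. *)
Definition sfin_measure of sigma_finite setT m : set T -> \bar R := m.

Hypothesis h : sigma_finite setT m.
HB.instance Definition _ := Measure.on (sfin_measure h).
HB.instance Definition _ := @Measure_isSigmaFinite.Build _ T R (sfin_measure h) h.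

End SigmaFiniteAlias.

Section Tonelli.
Context d1 d2 (T1 : measurableType d1) (T2 : measurableType d2) (R : realType).
Local Open Scope ereal_scope.

Lemma product_measureE (m1 : set T1 -> \bar R) (m2 : set T2 -> \bar R)
    (X : set (T1 * T2)) : (m1 \x m2) X = \int[m1]_x m2 [set y | X (x, y)].
Proof.
rewrite /product_measure1; congr (integral m1 setT _); apply/funext => x /=.
by congr (m2 _); apply/seteqP; split=> y; rewrite /xsection/= inE.
Qed.

(** Both sides are measures on the product that agree on rectangles, where
uniqueness of the product measure applies. *)
Lemma product_measure_swap (m1 : {measure set T1 -> \bar R})
    (m2 : {measure set T2 -> \bar R}) (X : set (T1 * T2)) :
  sigma_finite setT m1 -> sigma_finite setT m2 -> measurable X ->
  (m1 \x m2) X = (m2 \x m1) [set yx | X (yx.2, yx.1)].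
Proof.
move=> s1 s2 mX.
have := @product_measure_unique _ _ _ _ _ (sfin_measure s1) (sfin_measure s2)
  ((sfin_measure s1) \x^ (sfin_measure s2)) (@product_measure2E _ _ _ _ _ _ _) X mX.
move=> ->; rewrite /product_measure2 /product_measure1/=.
by apply: eq_integral => y _ /=; congr (m1 _).
Qed.

End Tonelli.

(** * Lebesgue measure on row vectors *)

Section Lebesgue.
Context {R : realType}.
Notation mu := (@lebesgue_measure R).

(** The preimage of a half-open interval is a half-open interval whose length is
divided by the absolute value of the slope, a negative slope exchanging the
ends; Lebesgue measure is determined by these lengths. *)
Lemma lebesgue_affine (a b : R) (D : set R) : a != 0 -> measurable D ->
  (`|a|%:E * mu [set x | D (a * x + b)%R])%E = mu D.
Proof.
move=> a0 mD.
pose f x := a * x + b.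
have mf : measurable_fun [set: measurableTypeR R] (f : _ -> measurableTypeR R).
  by apply: measurable_funD => //; apply: measurable_funM.
pose m := mscale (NngNum (normr_ge0 a)) (push_measure mu mf).
apply/esym; rewrite [RHS](_ : _ = m D)//.
apply: lebesgue_measure_unique mD => {D} _ [[u v] _ <-] /=.
rewrite /m /mscale/= /pushforward lebesgue_measure_itv/=.
have [a_lt0|a_gt0|/eqP] := ltgtP a 0; last by rewrite (negbTE a0).
  rewrite (_ : f @^-1` _ = `[(v - b) / a, (u - b) / a[%classic); last first.
    by apply/seteqP; split=> x; rewrite /f /= !in_itv/=
      ler_ndivrMr// ltr_ndivlMr// lerBrDr ltrBlDr (mulrC x) => /andP[-> ->].
  rewrite lebesgue_measure_itv/= !lte_fin ltr_ndivrMr// divfK ?lt_eqF// ltrD2r.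
  case: ifPn => _; last by rewrite mule0.
  by rewrite -!EFinD -EFinM ltr0_norm//; congr (_%:E); field; rewrite lt_eqF.
rewrite (_ : f @^-1` _ = `](u - b) / a, (v - b) / a]%classic); last first.
  by apply/seteqP; split=> x; rewrite /f /= !in_itv/=
    ler_pdivlMr// ltr_pdivrMr// lerBrDr ltrBlDr (mulrC x) => /andP[-> ->].
rewrite lebesgue_measure_itv/= !lte_fin ltr_pdivrMr// divfK ?gt_eqF// ltrD2r.
case: ifPn => _; last by rewrite mule0.
by rewrite -!EFinD -EFinM gtr0_norm//; congr (_%:E); field; rewrite gt_eqF.
Qed.

Definition borel_rV k := g_sigma_algebraType (@open 'rV[R]_k).

Lemma mx_measurable_id k : mx_measurable setT (fun x : borel_rV k => (x : 'rV[R]_k)).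
Proof.
move=> i j; apply: (measurability _ (RGenOInfty.measurableE R)) => //.
move=> _ [_ [x ->] <-]; rewrite setTI; apply: open_borel.
apply: open_comp; last exact: interval_open.
by move=> M _; exact: coord_continuous.
Qed.

Lemma measurable_fun_rV d (T : measurableType d) (D : set T) k
    (f : T -> 'rV[R]_k) :
  measurable D -> mx_measurable D f -> measurable_fun D (f : T -> borel_rV k).
Proof.
by move=> mD mf; apply: measurable_fun_borel => U oU; exact: mx_measurable_open.
Qed.

Definition rV_join k (p : borel_rV k * measurableTypeR R) : borel_rV k.+1 :=
  row_mx (p.2%:M : 'rV_1) p.1.

Lemma measurable_rV_join k : measurable_fun setT (@rV_join k).
Proof.
apply: measurable_fun_rV => //.
apply: (@mx_measurable_row _ _ _ _ 1 1 k (fun p : borel_rV k * measurableTypeR R => p.2%:M) fst).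
  move=> i j; under eq_fun do rewrite mxE !ord1 eqxx mulr1n.
  exact: measurable_snd.
move=> i j.
exact: (mx_measurable_fun_comp (@measurable_fst _ _ (borel_rV k) (measurableTypeR R)) (@mx_measurable_id k)).
Qed.

(** Lebesgue measure on row vectors, one coordinate at a time: [rV_join] carries
over the product measure on pairs of a row vector and a number. *)
Fixpoint leb k : {measure set (borel_rV k) -> \bar R} :=
  match k with
  | 0 => @dirac _ (borel_rV 0) (0 : 'rV[R]_0) R
  | k'.+1 => push_measure (leb k' \x mu)%E (@measurable_rV_join k')
  end.

Local Open Scope ereal_scope.

Lemma lebSE k (D : set (borel_rV k.+1)) :
  leb k.+1 D = \int[leb k]_y mu [set x | D (rV_join (y, x))].
Proof.
rewrite /= /pushforward /product_measure1; apply: eq_integral => y _ /=.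
by congr (mu _); apply/seteqP; split=> x; rewrite /xsection/= inE.
Qed.

Definition cube k (a b : R) : set 'rV[R]_k :=
  [set x | forall i, (a <= x ord0 i <= b)%R].

Lemma measurable_cube k (a b : R) :
  measurable (cube a b : set (borel_rV k)).
Proof.
rewrite [X in measurable X](_ : _ = \bigcap_(i in [set: 'I_k])
  ((fun x : 'rV[R]_k => x ord0 i) @^-1` `[a, b]%classic)); last first.
  apply/seteqP; split=> x /= h i; first by move=> _; rewrite /= in_itv/=.
  by have := h i Logic.I; rewrite /= in_itv.
apply: fin_bigcap_measurable => // i _.
by rewrite -[X in measurable X]setTI; apply: mx_measurable_id.
Qed.

Lemma leb_cube k (a b : R) : (a <= b)%R ->
  leb k (cube a b) = ((b - a) ^+ k)%:E.
Proof.
move=> ab; elim: k => [|k IH].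
  by rewrite expr0 /= diracE mem_set// => -[].
transitivity ((leb k \x mu)
    ((cube a b : set (borel_rV k)) `*` `[a, b]%classic)); last first.
  rewrite product_measure1E//= ?IH ?lebesgue_measure_itv/=; last exact: measurable_cube.
  rewrite lte_fin; case: ltgtP ab => // [ab|->] _.
    by rewrite -EFinB -EFinM exprSr.
  by rewrite subrr mule0 expr0n.
congr ((leb k \x mu) _); apply/seteqP; split=> -[y x] /=; rewrite /rV_join/=.
  move=> h; split.
    by move=> i; have := h (rshift 1%N i); rewrite (row_mxEr (x%:M : 'rV_1) y).
  have := h (lshift k (ord0 : 'I_1)); rewrite (row_mxEl (x%:M : 'rV_1) y).
  by rewrite mxE eqxx in_itv.
rewrite in_itv/= => -[hy hx] i; rewrite mxE; case: splitP => j _ //.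
by rewrite mxE !ord1 eqxx.
Qed.

Lemma leb_sigma_finite k : sigma_finite setT (leb k).
Proof.
exists (fun n => cube (- n%:R) n%:R).
  apply/seteqP; split=> // x _; exists (Num.truncn `|x|).+1 => //= i.
  rewrite -ler_norml; apply: le_trans (ltW (truncnS_gt _)).
  rewrite [leRHS]/Num.Def.normr/= mx_normrE; exact: (le_bigmax _ _ (ord0, i)).
move=> n; split; first exact: measurable_cube.
by rewrite leb_cube ?ltry// (@le_trans _ _ 0%R)// oppr_le0.
Qed.

Lemma lebS_swapE k (D : set (borel_rV k.+1)) : measurable D ->
  leb k.+1 D = \int[mu]_x leb k [set y | D (rV_join (y, x))].
Proof.
move=> mD.
rewrite [LHS](product_measure_swap (leb_sigma_finite k) (sigma_finiteT mu)).
  rewrite /product_measure1; apply: eq_integral => y _ /=.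
  by congr (leb k _); apply/seteqP; split=> x; rewrite /xsection/= inE.
by rewrite -[X in measurable X]setTI; exact: measurable_rV_join.
Qed.

Lemma integral_map_scale d (T : measurableType d) (m : {measure set T -> \bar R})
    (phi : T -> T) (c : {nonneg R}) (f : T -> \bar R) :
  measurable_fun setT phi ->
  (forall A, measurable A -> m (phi @^-1` A) = c%:num%:E * m A) ->
  measurable_fun setT f -> (forall x, 0 <= f x) ->
  \int[m]_x f (phi x) = c%:num%:E * \int[m]_x f x.
Proof.
move=> mphi mE mf f0.
transitivity (\int[push_measure m mphi]_x f x).
  by rewrite (ge0_integral_pushforward mphi).
rewrite -(ge0_integral_mscale m measurableT c mf)//.
by apply: eq_measure_integral => A mA _; exact: mE.
Qed.

Lemma integral_map d (T : measurableType d) (m : {measure set T -> \bar R})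
    (phi : T -> T) (f : T -> \bar R) :
  measurable_fun setT phi ->
  (forall A, measurable A -> m (phi @^-1` A) = m A) ->
  measurable_fun setT f -> (forall x, 0 <= f x) ->
  \int[m]_x f (phi x) = \int[m]_x f x.
Proof.
move=> mphi mE mf f0.
rewrite (@integral_map_scale _ _ _ _ (NngNum (@ler01 R)))//= ?mul1e// => A mA.
by rewrite mE// mul1e.
Qed.

Lemma measurable_fiber k (D : set (borel_rV k.+1)) : measurable D ->
  measurable_fun setT (fun y => mu [set x | D (rV_join (y, x))]).
Proof.
move=> mD.
have := @measurable_fun_xsection _ _ _ _ _ mu (@rV_join k @^-1` D).
rewrite (_ : _ \o _ = (fun y => mu [set x | D (rV_join (y, x))])).
  apply; rewrite -[X in measurable X]setTI; exact: measurable_rV_join.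
apply/funext => y /=.
by congr (mu _); apply/seteqP; split=> x; rewrite /xsection/= inE.
Qed.

Lemma measurable_shift k (v : 'rV[R]_k) :
  measurable_fun setT ((fun x : 'rV[R]_k => x + v)%R : borel_rV k -> borel_rV k).
Proof.
apply: measurable_fun_rV => //.
by apply: mx_measurableD; [exact: mx_measurable_id|exact: mx_measurable_cst].
Qed.

Lemma measurable_linear k l (M : 'M[R]_(k, l)) :
  measurable_fun setT ((fun x : 'rV[R]_k => x *m M)%R : borel_rV k -> borel_rV l).
Proof.
apply: measurable_fun_rV => //.
by apply: mx_measurableM; [exact: mx_measurable_id|exact: mx_measurable_cst].
Qed.

Lemma measurable_preimage d d' (T : measurableType d) (T' : measurableType d')
    (f : T -> T') (D : set T') : measurable_fun setT f -> measurable D ->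
  measurable (f @^-1` D).
Proof. by move=> mf mD; rewrite -[X in measurable X]setTI; exact: mf. Qed.

Lemma lebesgue_shift (a : R) (D : set R) : measurable D ->
  mu [set x | D (x + a)%R] = mu D.
Proof.
move=> mD; rewrite -(lebesgue_affine a (oner_neq0 R) mD) normr1 mul1e.
by under [in RHS]eq_set do rewrite mul1r.
Qed.

Lemma measurable_join_fiber k (D : set (borel_rV k.+1)) (y : 'rV[R]_k) :
  measurable D -> measurable ([set x | D (rV_join (y, x))] : set R).
Proof.
move=> mD.
have := @measurable_xsection _ _ _ _ (@rV_join k @^-1` D) y
  (measurable_preimage (@measurable_rV_join k) mD).
by congr measurable; apply/seteqP; split=> x; rewrite /xsection/= inE.
Qed.

Lemma measurable_join_fiber2 k (D : set (borel_rV k.+1)) (x : R) :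
  measurable D -> measurable ([set y | D (rV_join (y, x))] : set (borel_rV k)).
Proof.
move=> mD.
have := @measurable_ysection _ _ _ _ (@rV_join k @^-1` D) x
  (measurable_preimage (@measurable_rV_join k) mD).
by congr measurable; apply/seteqP; split=> y; rewrite /ysection/= inE.
Qed.

(** By induction on the dimension, translating the first coordinate inside each
fiber and the others in the base. *)
Lemma leb_shift k (v : 'rV[R]_k) (D : set (borel_rV k)) : measurable D ->
  leb k [set x | D (x + v)%R] = leb k D.
Proof.
elim: k v D => [|k IH] v D mD.
  by congr (leb 0 _); apply/seteqP; split=> x /=; rewrite [v]thinmx0 addr0.
pose v0 := @lsubmx _ 1 1 k v; pose w := @rsubmx _ 1 1 k v.
have vE : v = row_mx v0 w by rewrite hsubmxK.
rewrite [LHS]lebSE [RHS]lebSE.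
rewrite -[RHS](@integral_map _ _ _ ((fun y : 'rV[R]_k => y + w)%R : borel_rV k -> borel_rV k))//.
- apply: eq_integral => y _.
  rewrite -[RHS](lebesgue_shift (v0 0 0)%R (measurable_join_fiber _ mD)).
  congr (mu _); apply/seteqP; split=> x /=; rewrite /rV_join/= vE (@add_row_mx _ 1 1 k) /=;
    by rewrite (_ : (x + v0 0 0)%:M = x%:M + v0)%R// -matrixP => i j; rewrite !mxE !ord1 eqxx.
- exact: measurable_shift.
- by move=> A mA; exact: IH.
- exact: measurable_fiber.
Qed.

(** The change of variables formula for [M], as a property to be propagated
along products of elementary matrices. *)
Definition scales_leb k (M : 'M[R]_k) :=
  forall D : set (borel_rV k), measurable D ->
    leb k [set x | D (x *m M)] = (`|\det M|^-1)%:E * leb k D.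

Lemma scales_lebM k (M N : 'M[R]_k) :
  scales_leb M -> scales_leb N -> scales_leb (M *m N).
Proof.
move=> sM sN D mD.
rewrite (_ : [set x | _] = [set x | [set y | D (y *m N)] (x *m M)]); last first.
  by apply/seteqP; split=> x /=; rewrite mulmxA.
rewrite sM; last exact: (measurable_preimage (measurable_linear N)).
by rewrite sN// muleA -EFinM -invfM -normrM det_mulmx.
Qed.

(** The shear translates each fiber over the last coordinates, and translations
of the line preserve length. *)
Lemma scales_leb_lshear k (c : 'M[R]_(k, 1)) :
  scales_leb (block_mx (1%:M : 'M[R]_1) 0 c (1%:M : 'M[R]_k) : 'M[R]_k.+1).
Proof.
move=> D mD.
rewrite (@det_lblock _ 1 k) !det1 mulr1 normr1 invr1 mul1e.
rewrite [LHS]lebSE [RHS]lebSE; apply: eq_integral => y _.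
rewrite -(lebesgue_shift ((y *m c) 0 0)%R (measurable_join_fiber y mD)).
congr (mu _); apply/seteqP; split=> x /=; rewrite /rV_join/= (@mul_row_block _ 1 1 k 1 k) /=
  !mulmx0 !mulmx1 add0r;
  by rewrite (_ : (x + (y *m c) 0 0)%:M = x%:M + y *m c :> 'M[R]_1)%R// -matrixP => i j;
     rewrite !mxE !ord1 eqxx ?mxE.
Qed.

(** Slicing by the first coordinate instead, the shear translates each slice. *)
Lemma scales_leb_rshear k (b : 'M[R]_(1, k)) :
  scales_leb (block_mx (1%:M : 'M[R]_1) b 0 (1%:M : 'M[R]_k) : 'M[R]_k.+1).
Proof.
move=> D mD.
rewrite (@det_ublock _ 1 k) !det1 mulr1 normr1 invr1 mul1e.
rewrite [LHS]lebS_swapE; last exact: (measurable_preimage (measurable_linear _)).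
rewrite [RHS]lebS_swapE//; apply: eq_integral => x _.
rewrite -(leb_shift (x *: b)%R (measurable_join_fiber2 x mD)).
congr (leb k _); apply/seteqP; split=> y /=; rewrite /rV_join/= (@mul_row_block _ 1 1 k 1 k) /=
  !mulmx0 !mulmx1 addr0 mul_scalar_mx addrC //.
Qed.

Lemma scales_leb_diag k (a : R) (N : 'M[R]_k) : (a != 0)%R ->
  scales_leb N -> scales_leb (block_mx (a%:M : 'M[R]_1) 0 0 N : 'M[R]_k.+1).
Proof.
move=> a0 sN D mD.
rewrite (@det_ublock _ 1 k) det_scalar1 normrM invfM EFinM.
rewrite [LHS]lebSE [in RHS]lebSE.
have dN0 : (0 <= `|\det N|^-1)%R by rewrite invr_ge0.
rewrite -muleA -[in RHS](@integral_map_scale _ _ (leb k) _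
    (NngNum dN0) _ (measurable_linear N))//=; last exact: measurable_fiber.
have an0 : `|a|%R != 0%R by rewrite normr_eq0.
rewrite -ge0_integralZl//; last first.
  exact: (measurableT_comp (measurable_fiber mD) (measurable_linear N)).
apply: eq_integral => y _.
rewrite -(lebesgue_affine 0 a0 (measurable_join_fiber _ mD)).
rewrite muleA -EFinM mulVf// mul1e; congr (mu _).
apply/seteqP; split=> x /=; rewrite /rV_join/= (@mul_row_block _ 1 1 k 1 k) /=
  !mulmx0 !addr0 add0r -scalar_mxM mulrC //.
Qed.

(** Gaussian elimination on the top-left entry writes an invertible matrix as a
product of shears and of a block-diagonal matrix, to which induction applies. *)
Lemma scales_leb_unit k (M : 'M[R]_k) : M \in unitmx -> scales_leb M.
Proof.
elim: k M => [|k IH] M uM.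
  move=> D mD; rewrite det_mx00 normr1 invr1 mul1e.
  by congr (leb 0 _); apply/seteqP; split=> x /=; rewrite [x *m M]thinmx0 [x]thinmx0.
(* elimination on the top-left entry, when it is nonzero *)
have pivot (a : R) b c (N : 'M[R]_k) : (a != 0)%R ->
    (block_mx (a%:M : 'M[R]_1) b c N : 'M[R]_k.+1) \in unitmx ->
    scales_leb (block_mx (a%:M : 'M[R]_1) b c N : 'M[R]_k.+1).
  move=> a0 uB.
  pose N' := (N - a^-1 *: (c *m b))%R.
  have BE : (block_mx (a%:M : 'M[R]_1) b c N =
    block_mx (1%:M : 'M[R]_1) 0 (a^-1 *: c) (1%:M : 'M[R]_k)
    *m block_mx (a%:M : 'M[R]_1) 0 0 N' *m block_mx (1%:M : 'M[R]_1) (a^-1 *: b) 0 (1%:M : 'M[R]_k))%R.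
    rewrite !mulmx_block !mulmx0 !mul0mx !mulmx1 !mul1mx !addr0 !add0r.
    rewrite !mul_scalar_mx !mul_mx_scalar !scalerA mulfV// !scale1r.
    congr block_mx; rewrite -?scalemxAl -?scalemxAr ?scalerA ?mulVf// ?scale1r//.
    by rewrite /N' addrC subrK.
  have uN' : N' \in unitmx.
    move: uB; rewrite BE !unitmxE !det_mulmx (@det_lblock _ 1 k) (@det_ublock _ 1 k).
    by rewrite (@det_ublock _ 1 k) !det1 !mulr1 !mul1r unitrM => /andP[_].
  rewrite BE; apply: scales_lebM; last exact: scales_leb_rshear.
  by apply: scales_lebM; [exact: scales_leb_lshear|apply: scales_leb_diag => //; exact: IH].
rewrite -[M](@submxK _ 1 k 1 k) in uM *.
move: (ulsubmx _) (ursubmx _) (dlsubmx _) (drsubmx _) uM => a b c N uM.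
rewrite (mx11_scalar a) in uM *.
have [a0|a0] := eqVneq (a 0 0)%R 0%R; last exact: pivot.
rewrite a0 in uM *.
have [i ci] : exists i, (c i 0 != 0)%R.
  apply: contrapT => nc.
  have c0 : c = 0%R.
    apply/matrixP => i j; rewrite !mxE !ord1; apply/eqP/negPn/negP => ci.
    by apply: nc; exists i.
  by move: uM; rewrite c0 unitmxE (@det_ublock _ 1 k) det_scalar1 mul0r unitr0.
pose b' := (delta_mx 0 i : 'rV[R]_k)%R.
(* adding a multiple of another row makes the corner nonzero *)
have ME : (block_mx (0%:M : 'M[R]_1) b c N = block_mx (1%:M : 'M[R]_1) (- b') 0 (1%:M : 'M[R]_k)
    *m block_mx ((c i 0)%:M : 'M[R]_1) (b + b' *m N) c N)%R.
  rewrite mulmx_block !mul0mx !mul1mx !add0r; congr block_mx.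
    rewrite mulNmx -rowE (_ : row i c = (c i 0)%:M)%R ?subrr ?raddf0//.
    by apply/matrixP => r s; rewrite !mxE !ord1 eqxx.
  by rewrite mulNmx addrK.
rewrite ME in uM *; apply: scales_lebM; first exact: scales_leb_rshear.
by apply: pivot => //; move: uM; rewrite unitmx_mul => /andP[].
Qed.

(** If the first coefficient is nonzero, each fiber over the other coordinates
is a point; otherwise the hyperplane is a product and induction applies. *)
Lemma leb_hyperplane k (u : 'cV[R]_k) : (u != 0)%R ->
  leb k [set x | (x *m u = 0)%R] = 0.
Proof.
elim: k u => [|k IH] u; first by rewrite [u]flatmx0 eqxx.
have mH l (w : 'cV[R]_l) : measurable ([set x | (x *m w = 0)%R] : set (borel_rV l)).
  have m1 : measurable ([set 0%R] : set (borel_rV 1)).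
    by apply: closed_borel; apply: accessible_closed_set1; apply: hausdorff_accessible; exact: norm_hausdorff.
  exact: (measurable_preimage (measurable_linear w) m1).
pose a := (@usubmx _ 1 k 1 u) 0%R 0%R; pose w := @dsubmx _ 1 k 1 u.
have uE : u = (col_mx (a%:M : 'M[R]_1) w)%R by rewrite -mx11_scalar vsubmxK.
have E x y : (rV_join (y, x) *m u = (x * a)%:M + y *m w)%R.
  by rewrite uE /rV_join/= (@mul_row_col _ 1 1 k 1) -scalar_mxM.
have [a0|a0 _] := eqVneq a 0%R.
  rewrite uE a0 => u0.
  have w0 : w != 0%R by apply: contraNneq u0 => ->; rewrite raddf0 col_mx0.
  rewrite [LHS](_ : _ = (leb k \x mu) ([set y | (y *m w = 0)%R] `*` setT)).
    by rewrite product_measure1E ?IH ?mul0e.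
  congr ((leb k \x mu) _).
  apply/seteqP; split=> -[y x] /=; rewrite -a0 -uE E a0 mulr0 raddf0 add0r; by [|case].
rewrite [LHS]lebSE; apply: integral0_eq => y _.
rewrite [X in mu X](_ : _ = [set (- (y *m w) 0 0 / a)%R])//.
  exact: lebesgue_measure_set1.
apply/seteqP; split=> x /=; rewrite E.
  move=> /matrixP/(_ 0 0)%R; rewrite !mxE eqxx mulr1n => /eqP.
  by rewrite addr_eq0 => /eqP xa; rewrite -xa mulfK.
move=> ->; rewrite divfK//; apply/matrixP => i j; rewrite !mxE !ord1 eqxx mulr1n.
by rewrite addNr.
Qed.

(** When [M] is singular the image lies in a hyperplane, which is null. *)
Lemma leb_image k (M : 'M[R]_k) (C : set 'rV[R]_k) : compact C ->
  leb k [set x *m M | x in C] = (`|\det M|)%:E * leb k C.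
Proof.
move=> cC.
have mC : measurable (C : set (borel_rV k)).
  by apply: closed_borel; apply: compact_closed => //; exact: norm_hausdorff.
have [uM|nuM] := boolP (M \in unitmx).
  rewrite [LHS](_ : _ = leb k [set y | C (y *m invmx M)]); last first.
    congr (leb k _); apply/seteqP; split=> [_ [x Cx <-]|y Cy] /=.
      by rewrite mulmxK.
    by exists (y *m invmx M) => //; rewrite mulmxKV.
  rewrite scales_leb_unit ?unitmx_inv//.
  by rewrite det_inv normfV invrK.
have d0 : (\det M = 0)%R.
  by apply/eqP; move: nuM; rewrite unitmxE unitfE negbK.
rewrite d0 normr0 mul0e; apply/eqP; rewrite eq_le measure_ge0 andbT.
have [u u0 Mu] : exists2 u : 'cV[R]_k, (u != 0)%R & (M *m u = 0)%R.
  have /eqP/det0P[v v0 vM] : (\det M^T = 0)%R by rewrite det_tr.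
  exists v^T; first by rewrite trmx_eq0.
  by apply: trmx_inj; rewrite trmx_mul trmxK trmx0.
rewrite -(leb_hyperplane u0); apply: le_measure; rewrite ?inE.
- apply: closed_borel; apply: compact_closed; first exact: norm_hausdorff.
  apply: continuous_compact => //; apply: continuous_subspaceT.
  exact: mulmxr_continuous.
- have m1 : measurable ([set 0%R] : set (borel_rV 1)).
    by apply: closed_borel; apply: accessible_closed_set1; apply: hausdorff_accessible; exact: norm_hausdorff.
  exact: (measurable_preimage (measurable_linear u) m1).
by move=> _ [x Cx <-] /=; rewrite -mulmxA Mu mulmx0.
Qed.

End Lebesgue.

(** * Flats and their equations *)

Section Minors.
Context {R : realType}.

Lemma unit_minor m k (A : 'M[R]_(m, k)) : \rank A = k ->
  exists I : {ffun 'I_k -> 'I_m}, rowsub I A \in unitmx.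
Proof.
move=> rA; have fA : row_full A by rewrite /row_full rA.
exists [ffun i => fullrankfun fA i].
rewrite (_ : rowsub _ A = rowsub (fullrankfun fA) A) ?fullrowsub_unit//.
by apply/matrixP => i j; rewrite !mxE ffunE.
Qed.

Lemma unit_minor_rank m k (A : 'M[R]_(m, k)) (I : 'I_k -> 'I_m) :
  rowsub I A \in unitmx -> \rank A = k.
Proof.
move=> uA; apply/eqP; rewrite eqn_leq rank_leq_col/=.
by rewrite -[leqLHS](mxrank_unit uA) rowsubE mxrankM_maxr.
Qed.

(** Cramer's rule: the entries of [A *m invmx (rowsub I A)] are quotients of
minors of [A], the denominator being the minor on the rows [I]. *)
Lemma minor_quotient m k (A : 'M[R]_(m, k)) (I : {ffun 'I_k -> 'I_m}) i j :
  rowsub I A \in unitmx ->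
  (A *m invmx (rowsub I A)) i j * \det (rowsub I A) =
    \det (rowsub [ffun l => if l == j then i else I l] A).
Proof.
move=> uI; set N := A *m _; set J := [ffun _ => _].
have NI : rowsub I N = 1%:M by rewrite /N rowsubE mulmxA -rowsubE mulmxV.
have -> : rowsub J A = rowsub J N *m rowsub I A.
  by rewrite [in RHS]rowsubE -mulmxA /N mulmxKV// -rowsubE.
rewrite det_mulmx; congr (_ * _).
have Jj : J j = i by rewrite ffunE eqxx.
have Jl l : l != j -> J l = I l by move=> lj; rewrite ffunE (negPf lj).
have NIE l c : N (I l) c = (l == c)%:R.
  by have := congr1 (fun M : 'M[R]_k => M l c) NI; rewrite !mxE.
rewrite (expand_det_col _ j) (bigD1 j)//= big1 => [|l lj].
  rewrite addr0 [rowsub J N j j]mxE Jj /cofactor -signr_odd oddD addbb mul1r.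
  rewrite (_ : row' j (col' j _) = 1%:M) ?det1 ?mulr1//.
  apply/matrixP => a b; rewrite [LHS]mxE [col' _ _ _ _]mxE [rowsub _ _ _ _]mxE [RHS]mxE.
  rewrite Jl; last by rewrite eq_sym neq_lift.
  by rewrite NIE (inj_eq lift_inj).
by rewrite [rowsub J N l j]mxE Jl// NIE (negPf lj) mul0r.
Qed.

End Minors.

Section Flats.
Context {R : realType} {V : vectType R}.
Local Notation n := (\dim {:V}).
Local Notation par k := ('M[R]_(n, k) * 'rV[R]_k)%type.
Implicit Types (H G : flat V).

(** All computations take place in the coordinates in which [solutions] is
defined. *)
Definition crd (v : V) : 'rV[R]_n := passmx.rVof (vbasis {:V}) v.
Definition uncrd (x : 'rV[R]_n) : V := passmx.vecof (vbasis {:V}) x.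

Lemma crdK : cancel crd uncrd.
Proof. exact: passmx.rVofK (vbasisP _). Qed.
Lemma uncrdK : cancel uncrd crd.
Proof. exact: passmx.vecofK (vbasisP _). Qed.
Lemma crd_linear : linear crd.
Proof. exact: passmx.rVof_linear. Qed.
HB.instance Definition _ := GRing.isLinear.Build R V 'rV[R]_n _ crd crd_linear.
Lemma uncrd_linear : linear uncrd.
Proof. exact: passmx.vecof_linear. Qed.
HB.instance Definition _ := GRing.isLinear.Build R 'rV[R]_n V _ uncrd uncrd_linear.

Lemma crdZ a v : crd (a *: v) = a *: crd v.
Proof. by rewrite -[a *: v]addr0 linearP raddf0 addr0. Qed.

Lemma crdB u v : crd (u - v) = crd u - crd v. Proof. exact: raddfB. Qed.
Lemma crd0 : crd 0 = 0. Proof. exact: raddf0. Qed.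
Lemma crd_sum I (r : seq I) (P : pred I) (F : I -> V) :
  crd (\sum_(i <- r | P i) F i) = \sum_(i <- r | P i) crd (F i).
Proof. exact: raddf_sum. Qed.

Lemma flat_eq H G : points H = points G -> H = G.
Proof.
case: H => p hp; case: G => q hq /= pq; subst q.
by congr Flat; exact: Prop_irrelevance.
Qed.

Lemma solutionsE k (p : par k) v : solutions p v <-> crd v *m p.1 = p.2.
Proof. by []. Qed.

Lemma coset_dirE (v w : V) (W W' : {vspace V}) :
  coset_of_dir v W = coset_of_dir w W' -> W = W'.
Proof.
move=> E; have vW' : v - w \in W'.
  have : coset_of_dir v W v by rewrite /coset_of_dir/= subrr mem0v.
  by rewrite E.
apply/vspaceP => x; apply/idP/idP => xW.
  have : coset_of_dir v W (v + x) by rewrite /coset_of_dir/= addrAC subrr add0r.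
  rewrite E /coset_of_dir/= => h.
  have -> : x = (v + x - w) - (v - w) by rewrite [v + x - w]addrAC [_ + x]addrC addrK.
  by rewrite memvB.
have : coset_of_dir w W' (v + x).
  by rewrite /coset_of_dir/= addrAC memvD.
by rewrite -E /coset_of_dir/= addrAC subrr add0r.
Qed.

(** The direction of a flat is determined by its points. *)
Lemma Gr_uniq k l H : Gr k H -> Gr l H -> k = l.
Proof.
move=> [v [W [HE d]]] [w [W' [HE' d']]].
move: HE' d'; rewrite HE => /coset_dirE <- d'.
by apply/eqP; rewrite -(eqn_add2l (\dim W)) d d'.
Qed.

Lemma full_rank_pinv k (A : 'M[R]_(n, k)) : \rank A = k -> pinvmx A *m A = 1%:M.
Proof. by move=> rA; apply: mulVpmx; rewrite /row_full rA. Qed.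

(** A system of independent equations has a solution, and by the rank theorem
its direction has codimension [k]. *)
Lemma solutions_coset k (p : par k) : \rank p.1 = k ->
  exists v W, solutions p = coset_of_dir v W /\ (\dim W + k)%N = n.
Proof.
move=> rA.
pose g (v : V) : 'rV[R]_k := crd v *m p.1.
have glin : linear g.
  by move=> a u v; rewrite /g linearP mulmxDl -scalemxAl.
pose gL : {linear V -> 'rV[R]_k} := HB.pack g (GRing.isLinear.Build R V 'rV[R]_k _ g glin).
pose f : 'Hom(V, 'rV[R]_k) := linfun gL.
have fE v : f v = crd v *m p.1 by rewrite lfunE.
exists (uncrd (p.2 *m pinvmx p.1)), (lker f); split.
  apply/seteqP; split=> v; rewrite /coset_of_dir/= memv_ker fE crdB uncrdK.
    by rewrite mulmxBl -mulmxA full_rank_pinv// mulmx1 => /solutionsE ->; rewrite subrr.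
  rewrite mulmxBl -mulmxA full_rank_pinv// mulmx1 subr_eq0 => /eqP.
  by move=> ?; apply/solutionsE.
have := limg_ker_dim f fullv; rewrite capfv => <-; congr (_ + _)%N.
suff -> : limg f = fullv by rewrite dimvf/= /dim/= mul1n.
apply/vspaceP => y; rewrite memvf; apply/memv_imgP.
exists (uncrd (y *m pinvmx p.1)); first exact: memvf.
by rewrite fE uncrdK -mulmxA full_rank_pinv// mulmx1.
Qed.

Lemma solutions_Gr k (p : par k) H : \rank p.1 = k -> points H = solutions p -> Gr k H.
Proof. by move=> /solutions_coset[v [W [E dW]]] HE; exists v, W; rewrite HE. Qed.

(** The equations are those of a cokernel of the direction, reduced to an
independent family. *)
Lemma Gr_solutions k H : Gr k H ->
  exists p : par k, \rank p.1 = k /\ points H = solutions p.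
Proof.
move=> [v [W [HE dW]]].
pose B : 'M[R]_(\dim W, n) := \matrix_(i, j) crd (vbasis W)`_i 0 j.
have memB u : (u \in W) = (crd u <= B)%MS.
  apply/idP/idP.
    move=> /coord_vbasis ->; rewrite crd_sum summx_sub// => i _.
    rewrite crdZ scalemx_sub// (_ : crd _ = row i B) ?row_sub//.
    by apply/rowP => j; rewrite !mxE.
  move=> /submxP[D uE].
  rewrite (_ : u = \sum_i D 0 i *: (vbasis W)`_i).
    by rewrite memv_suml// => i _; rewrite memvZ// vbasis_mem// mem_nth// size_tuple.
  apply: (can_inj crdK); rewrite uE crd_sum mulmx_sum_row; apply: eq_bigr => i _.
  by rewrite crdZ; congr (_ *: _); apply/rowP => j; rewrite !mxE.
have rB : \rank B = \dim W.
  apply/eqP; rewrite -[_ == _]/(row_free B) -kermx_eq0; apply/rowV0P => w /sub_kermxP wB.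
  have /freeP := basis_free (vbasisP W).
  move=> /(_ (fun i => w 0 i)) h; apply/rowP => i; rewrite mxE; apply: h.
  apply: (can_inj crdK); rewrite crd_sum crd0 -[RHS]wB mulmx_sum_row; apply: eq_bigr => j _.
  by rewrite crdZ; congr (_ *: _); apply/rowP => l; rewrite !mxE.
have rc : \rank (cokermx B) = k.
  by rewrite mxrank_coker rB -dW addKn.
clear dW; subst k.
exists (col_base (cokermx B), crd v *m col_base (cokermx B)); split.
  by apply/eqP; exact: col_base_full.
rewrite HE; apply/seteqP; split => u.
  rewrite /coset_of_dir/= memB submxE -[cokermx B in X in X -> _]mulmx_base mulmxA.
  rewrite -(mul0mx _ (row_base (cokermx B))).
  move=> /eqP/(row_free_inj (row_base_free _))/eqP.
  by rewrite crdB mulmxBl subr_eq0 => /eqP h; exact: h.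
move=> uE; rewrite /solutions/= in uE; rewrite /coset_of_dir/= memB submxE -[cokermx B]mulmx_base mulmxA.
by rewrite crdB mulmxBl [crd u *m _]uE subrr mul0mx.
Qed.

End Flats.

(** * The topology of the space of flats *)

Section FlatTopology.
Context {R : realType} {V : vectType R}.
Local Notation n := (\dim {:V}).
Local Notation par k := ('M[R]_(n, k) * 'rV[R]_k)%type.
Implicit Types (H G : flat V).

Lemma open_neq0_rV m k : open [set y : 'M[R]_(m, k) | y != 0].
Proof.
rewrite (_ : [set _ | _] = ~` [set 0]).
  by apply/closed_openC/accessible_closed_set1/hausdorff_accessible/norm_hausdorff.
by apply/seteqP; split=> y /= /eqP.
Qed.

(** The points of a flat as row vectors: systems of equations, Lebesgue measure
and compactness all live there. *)
Definition pset H : set 'rV[R]_n := [set x | points H (uncrd x)].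

Lemma psetE k (p : par k) H x : points H = solutions p ->
  pset H x <-> x *m p.1 = p.2.
Proof.
rewrite /pset/= => ->.
by rewrite /solutions/= -[passmx.rVof _ _]/(crd _) uncrdK.
Qed.

Lemma pset_crd H v : pset H (crd v) = points H v.
Proof. by rewrite /pset/= crdK. Qed.

(** Openness in the quotient topology is a statement about small perturbations
of the equations of a flat. *)
Lemma flat_openP (O : set (flat V)) :
  (forall k (p : par k) H, \rank p.1 = k -> points H = solutions p -> O H ->
     \forall q \near p, forall H', \rank q.1 = k -> points H' = solutions q -> O H') ->
  open O.
Proof.
move=> h; rewrite /open/= => k.
exists (interior [set q : par k | forall H', \rank q.1 = k -> points H' = solutions q -> O H']).
  exact: open_interior.
move=> p H rp Hp; split; first exact: (h k p H rp Hp).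
by move=> /nbhs_singleton; apply.
Qed.

Lemma near_unit_minor k (I : 'I_k -> 'I_n) (p : par k) : rowsub I p.1 \in unitmx ->
  \forall q \near p, rowsub I q.1 \in unitmx.
Proof.
move=> up.
have c : (fun q : par k => rowsub I q.1) @ p --> rowsub I p.1.
  by apply: cvg_rowsub; exact: cvg_fst.
exact: (near_unitmx _ up c).
Qed.

Definition hits (D : set 'rV[R]_n) : set (flat V) :=
  [set H | exists2 x, D x & pset H x].

Lemma hitE (D : set V) : hit D = hits (crd @` D).
Proof.
apply/seteqP; split=> H.
  by move=> [v [Hv Dv]]; exists (crd v); [exists v|rewrite pset_crd].
by move=> [_ [v Dv <-]]; rewrite pset_crd => Hv; exists v.
Qed.

(** A point of the flat can be moved continuously so as to remain on the flat
when the equations are perturbed. *)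
Lemma hits_open (D : set 'rV[R]_n) : open D -> open (hits D).
Proof.
move=> oD; apply: flat_openP => k p H rp Hp [x Dx /(psetE _ Hp) xp].
pose B := pinvmx p.1.
have BA : B *m p.1 = 1%:M by exact: full_rank_pinv.
(* the solution of the perturbed system that moves continuously with it *)
pose f (q : par k) := x + (q.2 - x *m q.1) *m invmx (B *m q.1) *m B.
have fst_p : (fun q : par k => q.1) @ p --> p.1 by exact: cvg_fst.
have snd_p : (fun q : par k => q.2) @ p --> p.2 by exact: cvg_snd.
have cB : (fun q : par k => B *m q.1) @ p --> (1%:M : 'M[R]_k).
  by rewrite -BA; apply: cvg_mulmx => //; exact: cvg_cst.
have near_unit : \forall q \near p, (B *m (q : par k).1) \in unitmx.
  exact: (near_unitmx _ (unitmx1 _ _) cB).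
have cf : f @ p --> x.
  rewrite -[X in _ --> X]addr0; apply: cvgD; first exact: cvg_cst.
  rewrite (_ : 0 = (p.2 - x *m p.1) *m invmx (1%:M : 'M[R]_k) *m B); last first.
    by rewrite xp subrr !mul0mx.
  apply: cvg_mulmx; last exact: cvg_cst.
  apply: cvg_mulmx; last by apply: cvg_invmx => //; exact: unitmx1.
  by apply: cvgB => //; apply: cvg_mulmx => //; exact: cvg_cst.
have nearD : \forall q \near p, D (f q) by apply: cf; exact: open_nbhs_nbhs.
near=> q => H' rq H'q; exists (f q); first by near: q.
have uq : B *m q.1 \in unitmx by near: q.
apply/(psetE _ H'q); rewrite /f mulmxDl -2!mulmxA mulVmx//.
by rewrite mulmx1 addrC subrK.
Unshelve. all: by end_near. Qed.

(** On a compact set, the property of not solving a system is stable under small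
perturbations of that system. *)
Lemma avoid_open k (K : set 'rV[R]_n) : compact K ->
  open [set q : par k | forall x, K x -> x *m q.1 != q.2].
Proof.
move=> /compact_near_coveringP cK; rewrite openE => p nH.
have h : forall x, K x -> \forall x' \near x & q \near p, x' *m (q : par k).1 != q.2.
  move=> x Kx.
  have xp : x *m p.1 - p.2 != 0 by rewrite subr_eq0; exact: nH.
  have cf : (fun z : 'rV[R]_n * par k => z.1 *m z.2.1 - z.2.2) @ (x, p) --> x *m p.1 - p.2.
    have c2 : (fun z : 'rV[R]_n * par k => z.2) @ (x, p) --> p by exact: cvg_snd.
    apply: cvgB; last exact: (cvg_comp _ _ c2 (@cvg_snd _ _ _ _ _)).
    apply: cvg_mulmx; first exact: cvg_fst.
    exact: (cvg_comp _ _ c2 (@cvg_fst _ _ _ _ _)).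
  have h1 : nbhs (x *m p.1 - p.2) [set y | y != 0].
    by apply: open_nbhs_nbhs; split => //; exact: open_neq0_rV.
  have hz : \forall z \near (x, p), (z : 'rV[R]_n * par k).1 *m z.2.1 - z.2.2 != 0 := cf _ h1.
  by move: hz; apply: filterS => z; rewrite /= subr_eq0.
exact: (cK _ (nbhs p) (fun q x => x *m q.1 != q.2) _ h).
Qed.

(** Complement of [avoid_open]. *)
Lemma hits_closed (K : set 'rV[R]_n) : compact K -> closed (hits K).
Proof.
move=> cK; rewrite -openC; apply: flat_openP => k p H rp Hp nH.
have : \forall q \near p, forall x, K x -> x *m (q : par k).1 != q.2.
  apply: open_nbhs_nbhs; split; first exact: avoid_open.
  by move=> x Kx; apply: contra_notN nH => /eqP xp; exists x => //; exact/(psetE _ Hp).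
apply: filterS => q hq H' rq H'q [x Kx /(psetE _ H'q) E].
by have := hq x Kx; rewrite E eqxx.
Qed.

End FlatTopology.

Section FlatCompactness.
Context {R : realType} {V : vectType R}.
Local Notation n := (\dim {:V}).
Local Notation par k := ('M[R]_(n, k) * 'rV[R]_k)%type.
Implicit Types (H G : flat V).

Lemma flat_codim H : exists k, Gr k H.
Proof.
have [v [W HE]] := flatP H; exists (n - \dim W)%N, v, W; split => //.
by rewrite subnKC// dimvS// subvf.
Qed.

Lemma flat_solutions H : exists k (p : par k), \rank p.1 = k /\ points H = solutions p.
Proof. by have [k /Gr_solutions[p hp]] := flat_codim H; exists k, p. Qed.

Lemma cube_compact m (r s : R) : compact (@cube R m r s).
Proof.
rewrite (_ : cube r s = [set v : 'rV[R]_m | forall i, `[r, s]%classic (v ord0 i)]).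
  by apply: (rV_compact (A := fun=> `[r, s]%classic)) => i; exact: segment_compact.
by apply/seteqP; split=> x /= h i; have := h i; rewrite /= in_itv.
Qed.

Lemma open_cubeE m (x : 'rV[R]_m) (e : R) : 0 < e -> ball x e `<=` [set x + y | y in cube (- e) e].
Proof.
move=> e0 y [_ xy]; exists (y - x); last by rewrite addrC subrK.
move=> i; rewrite !mxE -ler_norml distrC ltW//; exact: (xy 0 i).
Qed.

Lemma shift_cube_compact m (x : 'rV[R]_m) (r s : R) : compact [set x + y | y in cube r s].
Proof.
apply: continuous_compact; last exact: cube_compact.
apply: continuous_subspaceT => y.
by apply: (@cvgD _ _ _ (nbhs y) _ (fun=> x) id); [exact: cvg_cst|exact: cvg_id].
Qed.

Lemma pset_closed H : closed (pset H).
Proof.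
have [k [p [_ Hp]]] := flat_solutions H.
rewrite (_ : pset H = [set x | x *m p.1 \in [set p.2]]).
  rewrite (_ : [set _ | _] = (fun x => x *m p.1) @^-1` [set p.2]).
    apply: preimage_closed => [x _|]; first exact: mulmxr_continuous.
    exact/accessible_closed_set1/hausdorff_accessible/norm_hausdorff.
  by apply/seteqP; split=> x /=; rewrite inE.
by apply/seteqP; split=> x /=; rewrite inE => /(psetE _ Hp).
Qed.

(** A ball around [x] misses [G]. The flats meeting the ball of half the radius
form an open set, and so do the flats avoiding the closed cube circumscribed to
it; these two sets are disjoint. *)
Lemma flat_separated H G x : pset H x -> ~ pset G x ->
  exists AB : set (flat V) * set (flat V),
    [/\ open AB.1, open AB.2, AB.1 H, AB.2 G & AB.1 `&` AB.2 = set0].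
Proof.
move=> Hx Gx.
have : nbhs x (~` pset G).
  by apply: open_nbhs_nbhs; split => //; apply: closed_openC; exact: pset_closed.
move=> /nbhs_ballP[e /= e0 eG].
pose K := [set x + y | y in cube (- (e / 2)) (e / 2)].
exists (hits (ball x (e / 2)), ~` hits K); split => /=.
- by apply: hits_open; exact: ball_open.
- by apply/closed_openC/hits_closed/shift_cube_compact.
- by exists x => //; apply: ballxx; rewrite divr_gt0.
- move=> [y [z /= zc <-] Gxz]; apply: (eG (x + z)) => //.
  split=> // i j; rewrite !mxE /ball/= opprD addNKr ord1 normrN.
  have := zc j; rewrite -ler_norml => /le_lt_trans; apply.
  by rewrite ltr_pdivrMr// ltr_pMr// ltr1n.
- rewrite -subset0 => F [[y xy Fy]] /=; apply; exists y => //.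
  by apply: open_cubeE => //; rewrite divr_gt0.
Qed.

(** Needed because it makes compact sets of flats closed, hence Borel. *)
Lemma flat_hausdorff : hausdorff_space (flat V).
Proof.
rewrite open_hausdorff => H G HG.
suff [AB [oA oB AH BG AB0]] : exists AB : set (flat V) * set (flat V),
    [/\ open AB.1, open AB.2, AB.1 H, AB.2 G & AB.1 `&` AB.2 = set0].
  by exists AB; rewrite ?inE ?AB0.
have [sHG|/existsNP[x /not_implyP[Hx Gx]]] := pselect (pset H `<=` pset G); last first.
  exact: flat_separated Hx Gx.
have [sGH|/existsNP[x /not_implyP[Gx Hx]]] := pselect (pset G `<=` pset H); last first.
  have [[A B] /= [oA oB AG BH AB0]] := flat_separated Gx Hx.
  by exists (B, A); split => //=; rewrite setIC.
case/eqP: HG; apply: flat_eq; apply/seteqP; split=> v; rewrite -!pset_crd.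
  exact: sHG.
exact: sGH.
Qed.

Lemma flat_compact_measurable (K : set (flat V)) : compact K ->
  measurable (K : set (borel_flat V)).
Proof. by move=> cK; apply: closed_borel; exact: (compact_closed flat_hausdorff). Qed.

Lemma Gr_open k : open (Gr k : set (flat V)).
Proof.
apply: flat_openP => l p H rp Hp HG.
have lk := Gr_uniq (solutions_Gr rp Hp) HG; subst l.
by apply: (@filterE _ (nbhs p)) => q H' rq H'q; exact: solutions_Gr rq H'q.
Qed.

Lemma measurable_Gr k : measurable (Gr k : set (borel_flat V)).
Proof. by apply: open_borel; exact: Gr_open. Qed.

Lemma measurable_hits (K : set 'rV[R]_n) : compact K ->
  measurable (hits K : set (borel_flat V)).
Proof. by move=> cK; apply: closed_borel; exact: hits_closed. Qed.

(** Flats meeting an open ball form an open set, and the balls around the origin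
of growing radius give an increasing open cover. *)
Lemma compact_flats_hit (A : set (flat V)) : compact A ->
  exists N : nat, A `<=` hits (cube (- N%:R) N%:R).
Proof.
move=> /compact_near_coveringP cA.
have h H : A H -> \forall H' \near H & N \near \oo, hits (ball (0 : 'rV[R]_n) N%:R) H'.
  move=> _.
  have [k [p [rp Hp]]] := flat_solutions H.
  pose x := p.2 *m pinvmx p.1.
  have Hx : pset H x.
    by apply/(psetE _ Hp); rewrite -mulmxA full_rank_pinv// mulmx1.
  pose N0 := (Num.truncn `|x|).+1.
  have xN0 : ball (0 : 'rV[R]_n) N0%:R x.
    by rewrite -ball_normE /= sub0r normrN; exact: truncnS_gt.
  exists (hits (ball (0 : 'rV[R]_n) N0%:R), [set N | (N0 <= N)%N]) => /=.
    split; last by exists N0.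
    apply: open_nbhs_nbhs; split; last by exists x.
    by apply: hits_open; exact: ball_open.
  move=> [H' N] /= [[y y0 H'y] N0N]; exists y => //.
  by apply: le_ball y0; rewrite ler_nat.
have [N _ hN] := cA _ \oo (fun N H' => hits (ball (0 : 'rV[R]_n) N%:R) H') _ h.
exists N.+1 => H AH; have [y y0 Hy] := hN N.+1 (leqnSn N) H AH; exists y => //.
have [z zc <-] := open_cubeE (ltr0Sn _ _) y0; by rewrite add0r.
Qed.

(** The default value is returned for inconsistent systems only. *)
Definition mkflat k (p : par k) : flat V := xget point [set H | points H = solutions p].

Lemma mkflatE k (p : par k) : \rank p.1 = k -> points (mkflat p) = solutions p.
Proof.
move=> rp; apply: (@xgetPex _ point [set H | points H = solutions p]).
have [v [W [sE _]]] := solutions_coset rp.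
have h : exists v W, solutions p = coset_of_dir v W by exists v, W.
by exists (Flat h).
Qed.

Lemma box_mx_compact k l : compact [set A : 'M[R]_(k, l) | forall i j, -1 <= A i j <= 1].
Proof.
rewrite (_ : [set _ | _] = vec_mx @` (@cube R (k * l) (- 1) 1)).
  apply: continuous_compact; last exact: cube_compact.
  apply: continuous_subspaceT => v; apply: (mx_cvg (nbhs_filter v)) => i j.
  rewrite mxE; under eq_fun do rewrite mxE; exact: (@coord_continuous _ _ _ _ _ v).
apply/seteqP; split=> [A h|_ [v h <-] i j]; last by rewrite mxE; exact: h.
exists (mxvec A); last by rewrite mxvecK.
by move=> i; case/mxvec_indexP: i => i j; rewrite mxvecE.
Qed.

(** The same equations, combined linearly so that their coefficients on the
coordinates [I] form the identity. *)
Definition normalised k (I : 'I_k -> 'I_n) (p : par k) : par k :=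
  (p.1 *m invmx (rowsub I p.1), p.2 *m invmx (rowsub I p.1)).

Definition bounded_frame k l (A : 'M[R]_(k, l)) := forall i j, -1 <= A i j <= 1.

(** Choose the rows [I] of the largest minor: by Cramer's rule the entries of
the normalised matrix are quotients of a minor by the largest one. *)
Lemma bounded_frame_exists k (p : par k) : \rank p.1 = k ->
  exists I : {ffun 'I_k -> 'I_n},
    rowsub I p.1 \in unitmx /\ bounded_frame (normalised I p).1.
Proof.
move=> rp; have [I0 uI0] := unit_minor rp.
pose I := [arg max_(J > I0) `|\det (rowsub J p.1)| ]%O.
have mI (J : {ffun 'I_k -> 'I_n}) : `|\det (rowsub J p.1)| <= `|\det (rowsub I p.1)|.
  by rewrite /I; case: arg_maxP => // K _ /(_ J isT).
have d0 : 0 < `|\det (rowsub I p.1)|.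
  by apply: lt_le_trans (mI I0); rewrite normr_gt0 -unitfE -unitmxE.
have uI : rowsub I p.1 \in unitmx by rewrite unitmxE unitfE -normr_gt0.
exists I; split=> // i j; rewrite -ler_norml -(ler_pM2r d0) mul1r -normrM.
by rewrite minor_quotient.
Qed.

Lemma normalised_rowsub k (I : 'I_k -> 'I_n) (p : par k) :
  rowsub I p.1 \in unitmx -> rowsub I (normalised I p).1 = 1%:M.
Proof. by move=> u; rewrite /normalised/= rowsubE mulmxA -rowsubE mulmxV. Qed.

Lemma normalised_solutions k (I : 'I_k -> 'I_n) (p : par k) :
  rowsub I p.1 \in unitmx -> solutions (normalised I p) = solutions p.
Proof.
move=> u; apply/seteqP; split=> v; rewrite /solutions/= mulmxA.
  by move=> /(congr1 (mulmxr (rowsub I p.1))); rewrite /= !mulmxKV.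
by move=> ->.
Qed.

Lemma normalised_rank k (I : 'I_k -> 'I_n) (p : par k) :
  rowsub I p.1 \in unitmx -> \rank (normalised I p).1 = k.
Proof.
by move=> u; apply: (@unit_minor_rank _ _ _ _ I); rewrite normalised_rowsub// unitmx1.
Qed.

Lemma frames_compact k : compact [set A : 'M[R]_(n, k) | bounded_frame A /\
  exists I : {ffun 'I_k -> 'I_n}, rowsub I A = 1%:M].
Proof.
rewrite (_ : [set _ | _] = [set A | bounded_frame A] `&`
  \bigcup_(I in [set: {ffun 'I_k -> 'I_n}]) [set A | rowsub I A = 1%:M]); last first.
  by apply/seteqP; split=> A /= [hA [I hI]]; split=> //; exists I.
apply: (@subclosed_compact _ _ [set A | bounded_frame A]); [|exact: box_mx_compact|by move=> A []].
apply: closedI; first exact: compact_closed (@norm_hausdorff _ _) (@box_mx_compact _ _).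
apply: closed_bigcup; first exact: finite_finset.
move=> I _.
rewrite (_ : [set _ | _] = (rowsub I) @^-1` [set 1%:M]) //.
apply: preimage_closed; last exact/accessible_closed_set1/hausdorff_accessible/norm_hausdorff.
by move=> A _; apply: (cvg_rowsub (nbhs_filter A)); exact: cvg_id.
Qed.

(** The flats of a given codimension that meet a compact set are the solution
sets of a compact family of systems: the coefficients are bounded, contain an
identity block, and the right-hand sides are determined by the coefficients and
by a point of the compact set. *)
Lemma hits_bounded k (K : set 'rV[R]_n) : compact K ->
  exists2 C : set (flat V), compact C & Gr k `&` hits K `<=` C.
Proof.
move=> cK.
pose A0 := [set A : 'M[R]_(n, k) | bounded_frame A /\
  exists I : {ffun 'I_k -> 'I_n}, rowsub I A = 1%:M].
pose f (z : 'rV[R]_n * 'M[R]_(n, k)) : par k := (z.2, z.1 *m z.2).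
have cP : compact (f @` (K `*` A0)).
  apply: continuous_compact; last by apply: compact_setX => //; exact: frames_compact.
  apply: continuous_subspaceT => z.
  apply: (cvg_pair (F := nbhs z) (G := nbhs z.2) (H := nbhs (z.1 *m z.2))); first exact: cvg_snd.
  by apply: (cvg_mulmx (nbhs_filter z)); [exact: cvg_fst|exact: cvg_snd].
have rP p : (f @` (K `*` A0)) p -> \rank p.1 = k.
  move=> [[x A] [_ [/= _ [I hI]]] <-] /=.
  by apply: (@unit_minor_rank _ _ _ _ I); rewrite hI unitmx1.
exists (@mkflat k @` (f @` (K `*` A0))).
  apply: continuous_compact cP; apply/subspace_continuousP => p pP O.
  rewrite nbhsE => -[W [oW Wp] sWO].
  have [B oB hB] := oW k.
  have : nbhs p B.
    by apply: open_nbhs_nbhs; split=> //; apply/(hB p (mkflat p)) => //; [exact: rP|rewrite mkflatE// rP].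
  apply: filterS => q Bq qP; apply: sWO.
  by apply/(hB q (mkflat q)) => //; [exact: rP|rewrite mkflatE// rP].
move=> H [/Gr_solutions[p [rp Hp]] [x Kx Hx]].
have [I [uI bI]] := bounded_frame_exists rp.
exists (normalised I p).
  exists (x, (normalised I p).1); last first.
    rewrite /f/= mulmxA; congr (_, _ *m _).
    by move/(psetE x Hp): Hx.
  split=> //; split => //; exists I; exact: normalised_rowsub.
apply: flat_eq; rewrite mkflatE ?normalised_solutions//.
exact: normalised_rank.
Qed.

End FlatCompactness.

(** * Equations depending measurably on the flat *)

Section FlatFrames.
Context {R : realType} {V : vectType R}.
Local Notation n := (\dim {:V}).
Local Notation par k := ('M[R]_(n, k) * 'rV[R]_k)%type.
Local Notation idx k := {ffun 'I_k -> 'I_n}.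
Implicit Types (H G : flat V).

(** Every equation satisfied on the solution set is a linear combination of the
given independent ones. *)
Lemma solutions_uniq k (p q : par k) : \rank p.1 = k -> solutions p = solutions q ->
  q = (p.1 *m (pinvmx p.1 *m q.1), p.2 *m (pinvmx p.1 *m q.1)).
Proof.
move=> rp pq.
have E x : x *m p.1 = p.2 -> x *m q.1 = q.2.
  move=> xp; have : solutions p (uncrd x).
    by rewrite /solutions/= -[passmx.rVof _ _]/(crd _) uncrdK.
  by rewrite pq /solutions/= -[passmx.rVof _ _]/(crd _) uncrdK.
pose x0 := p.2 *m pinvmx p.1.
have x0p : x0 *m p.1 = p.2 by rewrite -mulmxA full_rank_pinv// mulmx1.
have x0q := E _ x0p.
rewrite [LHS]surjective_pairing; congr (_, _); last by rewrite -x0q mulmxA.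
apply/row_matrixP => i; rewrite !rowE; set y := delta_mx 0 i.
have : (x0 + y - y *m p.1 *m pinvmx p.1) *m p.1 = p.2.
  rewrite mulmxBl mulmxDl -[y *m p.1 *m pinvmx _ *m _]mulmxA full_rank_pinv// mulmx1.
  by rewrite x0p addrK.
move=> /E; rewrite mulmxBl mulmxDl x0q -addrA -[RHS]addr0 => /addrI/eqP.
by rewrite subr_eq0 !mulmxA => /eqP.
Qed.

Lemma normalised_uniq k (I : 'I_k -> 'I_n) (p q : par k) :
  rowsub I p.1 = 1%:M -> solutions p = solutions q ->
  \rank q.1 = k -> rowsub I q.1 \in unitmx /\ normalised I q = p.
Proof.
move=> pI pq rq.
have rp : \rank p.1 = k by apply: (@unit_minor_rank _ _ _ _ I); rewrite pI unitmx1.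
have qE := solutions_uniq rp pq; set g := pinvmx p.1 *m q.1 in qE.
have qI : rowsub I q.1 = g by rewrite qE /= rowsubE mulmxA -rowsubE pI mul1mx.
have ug : g \in unitmx.
  rewrite -row_full_unit /row_full eqn_leq rank_leq_col/= -{1}rq qE/=.
  exact: mxrankM_maxr.
split; first by rewrite qI.
rewrite /normalised qI qE /= !mulmxK//; by case: (p).
Qed.

Definition chartdom k (I : 'I_k -> 'I_n) : set (flat V) :=
  [set H | exists p : par k, rowsub I p.1 = 1%:M /\ points H = solutions p].

(** The system of equations of a flat is unique once the coefficients on the
coordinates [I] are the identity. It gives an affine chart on the open set
[chartdom I] of flats that are graphs over the other coordinates. *)
Definition frame k (I : 'I_k -> 'I_n) H : par k :=
  xget (0, 0) [set p : par k | rowsub I p.1 = 1%:M /\ points H = solutions p].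

Lemma frameP k (I : 'I_k -> 'I_n) H : chartdom I H ->
  rowsub I (frame I H).1 = 1%:M /\ points H = solutions (frame I H).
Proof.
move=> hp; exact: (@xgetPex _ (0, 0)
  [set p : par k | rowsub I p.1 = 1%:M /\ points H = solutions p] hp).
Qed.

Lemma frame_rank k (I : 'I_k -> 'I_n) H : chartdom I H -> \rank (frame I H).1 = k.
Proof.
by move=> /frameP[fI _]; apply: (@unit_minor_rank _ _ _ _ I); rewrite fI unitmx1.
Qed.

Lemma frame_eq k (I : 'I_k -> 'I_n) H (p : par k) :
  rowsub I p.1 = 1%:M -> points H = solutions p -> chartdom I H /\ frame I H = p.
Proof.
move=> pI Hp; have cH : chartdom I H by exists p.
split=> //; have [fI Hf] := frameP cH.
have [_ <-] := normalised_uniq pI (esym (etrans (esym Hf) Hp)) (frame_rank cH).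
by rewrite /normalised fI invmx1 !mulmx1; case: (frame I H).
Qed.

Lemma chartdom_Gr k (I : 'I_k -> 'I_n) : chartdom I `<=` Gr k.
Proof. by move=> H cH; apply: solutions_Gr (frame_rank cH) (frameP cH).2. Qed.

Lemma normalised_cvg k (I : 'I_k -> 'I_n) (p : par k) : rowsub I p.1 \in unitmx ->
  normalised I @ p --> normalised I p.
Proof.
move=> u; have c1 : (fun q : par k => q.1) @ p --> p.1 by exact: cvg_fst.
have c2 : (fun q : par k => q.2) @ p --> p.2 by exact: cvg_snd.
have ci : (fun q : par k => invmx (rowsub I q.1)) @ p --> invmx (rowsub I p.1).
  by apply: cvg_invmx => //; exact: cvg_rowsub.
by apply: (cvg_pair (F := nbhs p) (G := nbhs (normalised I p).1) (H := nbhs (normalised I p).2));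
  apply: (cvg_mulmx (nbhs_filter p)).
Qed.

(** Normalisation is continuous in the equations, which makes [frame I]
continuous on its domain. *)
Lemma frame_open k (I : 'I_k -> 'I_n) (U : set (par k)) : open U ->
  open [set H | chartdom I H /\ U (frame I H)].
Proof.
move=> oU; apply: flat_openP => l p H rp Hp [cH UH].
have lk := Gr_uniq (solutions_Gr rp Hp) (chartdom_Gr cH); subst l.
have [fI Hf] := frameP cH.
have [up np] := normalised_uniq fI (esym (etrans (esym Hp) Hf)) rp.
have nU : \forall q \near p, U (normalised I q).
  by apply: (normalised_cvg up); rewrite np; apply: open_nbhs_nbhs.
apply: filterS2 nU (near_unit_minor up) => q Uq uq H' rq H'q.
have [] := @frame_eq _ I H' (normalised I q); first exact: normalised_rowsub.
  by rewrite normalised_solutions.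
by move=> cH' fE; split=> //; rewrite fE.
Qed.

Lemma measurable_chartdom k (I : 'I_k -> 'I_n) :
  measurable (chartdom I : set (borel_flat V)).
Proof.
apply: open_borel; have := @frame_open k I setT openT.
by congr open; apply/seteqP; split=> H //= -[].
Qed.

Lemma measurable_frame1 k (I : 'I_k -> 'I_n) :
  mx_measurable (chartdom I : set (borel_flat V)) (fun H => (frame I H).1).
Proof.
move=> i j mD; apply: (measurability _ (RGenOInfty.measurableE R)) => //.
move=> _ [_ [x ->] <-]; apply: open_borel.
have oU : open ((fun p : par k => p.1 i j) @^-1` `]x, +oo[%classic).
  apply: open_comp; last exact: interval_open.
  move=> p _; apply: (mx_cvg_entry (nbhs_filter p)); exact: cvg_fst.
exact: (frame_open I oU).
Qed.

Lemma measurable_frame2 k (I : 'I_k -> 'I_n) :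
  mx_measurable (chartdom I : set (borel_flat V)) (fun H => (frame I H).2).
Proof.
move=> i j mD; apply: (measurability _ (RGenOInfty.measurableE R)) => //.
move=> _ [_ [x ->] <-]; apply: open_borel.
have oU : open ((fun p : par k => p.2 i j) @^-1` `]x, +oo[%classic).
  apply: open_comp; last exact: interval_open.
  move=> p _; apply: (mx_cvg_entry (nbhs_filter p)); exact: cvg_snd.
exact: (frame_open I oU).
Qed.

(** Charts are cut down to bounded coefficients, so that integrals of
determinants over them converge. *)
Definition piece k (I : 'I_k -> 'I_n) : set (flat V) :=
  [set H | chartdom I H /\ bounded_frame (frame I H).1].

Lemma measurable_piece k (I : 'I_k -> 'I_n) : measurable (piece I : set (borel_flat V)).
Proof.
rewrite (_ : piece I = chartdom I `&` \bigcap_(ij in [set: 'I_n * 'I_k])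
  (chartdom I `&` (fun H => (frame I H).1 ij.1 ij.2) @^-1` `[-1, 1]%classic)).
  apply: measurableI; first exact: measurable_chartdom.
  apply: fin_bigcap_measurable => // -[i j] _.
  by apply: measurable_frame1 => //; exact: measurable_chartdom.
apply/seteqP; split=> H /= [cH bH]; split=> //.
  by move=> [i j] _; split=> //=; rewrite in_itv/=; exact: bH.
by move=> i j; have [_] := bH (i, j) Logic.I; rewrite /= in_itv.
Qed.

Lemma piece_cover k H : Gr k H -> exists I : idx k, piece I H.
Proof.
move=> /Gr_solutions[p [rp Hp]]; have [I [uI bI]] := bounded_frame_exists rp.
have [|cH fH] := @frame_eq _ I H (normalised I p) (normalised_rowsub uI).
  by rewrite normalised_solutions.
by exists I; split => //; rewrite fH.
Qed.

Definition select k H : option (idx k) := [pick I : idx k | `[< piece I H >]].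

(** [Gr k] is the disjoint union of these measurable sets; on each of them the
equations are normalised on the same coordinates. *)
Definition cell k (I : idx k) : set (flat V) := [set H | select k H = Some I].

Lemma cell_piece k (I : idx k) : cell I `<=` piece I.
Proof.
by move=> H; rewrite /cell/= /select; case: pickP => // J /asboolP h [<-].
Qed.

Lemma cell_cover k H : Gr k H -> exists I : idx k, cell I H.
Proof.
move=> /piece_cover[J hJ]; rewrite /cell/= /select; case: pickP => [I0 _|/(_ J)].
  by exists I0.
by rewrite asboolT.
Qed.

Lemma measurable_cell k (I : idx k) : measurable (cell I : set (borel_flat V)).
Proof.
rewrite (_ : cell I = \bigcup_(S in [set S : {set idx k} | [pick J in S] = Some I])
   \bigcap_(J in [set: idx k]) (if J \in S then piece J else ~` piece J)).
  apply: fin_bigcup_measurable; first exact: finite_finset.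
  move=> S _; apply: fin_bigcap_measurable; first exact: finite_finset.
  move=> J _; case: ifP => _; first exact: measurable_piece.
  by apply: measurableC; exact: measurable_piece.
apply/seteqP; split=> H.
  move=> sH; exists [set J : idx k | `[< piece J H >]]%SET => /=.
    by rewrite -sH; apply: eq_pick => J; rewrite !inE.
  by move=> J _; rewrite inE; case: asboolP.
move=> [S /= SI hS]; rewrite /cell/= -SI; apply: eq_pick => J.
have := hS J Logic.I; case: ifPn => JS h; first by rewrite asboolT// JS.
by rewrite asboolF// (negbTE JS).
Qed.

(** Equations chosen for every flat of codimension [k], measurably and with
coefficients between -1 and 1. *)
Definition rep k H : par k := if select k H is Some J then frame J H else (0, 0).

Lemma rep_cell k (I : idx k) H : cell I H -> rep k H = frame I H.
Proof. by rewrite /cell/= /rep => ->. Qed.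

Lemma repP k H : Gr k H -> \rank (rep k H).1 = k /\ points H = solutions (rep k H).
Proof.
move=> /cell_cover[I sH]; rewrite (rep_cell sH).
have [cH _] := cell_piece sH.
by split; [exact: frame_rank|exact: (frameP cH).2].
Qed.

Lemma rep_bounded k H : Gr k H -> bounded_frame (rep k H).1.
Proof.
by move=> /cell_cover[I sH]; rewrite (rep_cell sH); exact: (cell_piece sH).2.
Qed.

Lemma rep_psetE k H x : Gr k H -> pset H x <-> x *m (rep k H).1 = (rep k H).2.
Proof. by move=> /repP[_ h]; exact: psetE. Qed.

(** Measurability over [Gr k] is tested on the finitely many cells. *)
Lemma measurable_patchwork k (f : flat V -> R) (g : idx k -> flat V -> R) :
  (forall I H, cell I H -> f H = g I H) ->
  (forall I : idx k, measurable_fun (chartdom I : set (borel_flat V)) (g I)) ->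
  measurable_fun (Gr k : set (borel_flat V)) f.
Proof.
move=> fg mg _ Y mY.
rewrite (_ : _ `&` _ = \bigcup_(I in [set: idx k])
    (cell I `&` (chartdom I `&` g I @^-1` Y))).
  apply: fin_bigcup_measurable; first exact: finite_finset.
  move=> I _; apply: measurableI; first exact: measurable_cell.
  by apply: mg => //; exact: measurable_chartdom.
apply/seteqP; split=> H.
  move=> [/cell_cover[I sH] YH]; exists I => //; split=> //.
  by split; [exact: (cell_piece sH).1|rewrite /preimage/= -(fg I)].
move=> [I _ [sH [cH YH]]]; split; first exact: chartdom_Gr cH.
by rewrite /preimage/= (fg I).
Qed.

Lemma measurable_rep1 k :
  mx_measurable (Gr k : set (borel_flat V)) (fun H => (rep k H).1).
Proof.
move=> i j; apply: (measurable_patchwork (g := fun I H => (frame I H).1 i j)).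
  by move=> I H sH; rewrite (rep_cell sH).
by move=> I; exact: measurable_frame1.
Qed.

Lemma measurable_rep2 k :
  mx_measurable (Gr k : set (borel_flat V)) (fun H => (rep k H).2).
Proof.
move=> i j; apply: (measurable_patchwork (g := fun I H => (frame I H).2 i j)).
  by move=> I H sH; rewrite (rep_cell sH).
by move=> I; exact: measurable_frame2.
Qed.

(** A flat depends measurably on its equations, since an open set of flats is an
open condition on them. *)
Lemma measurable_flat d (T : measurableType d) (D : set T) k (f : T -> flat V)
    (A : T -> 'M[R]_(n, k)) (c : T -> 'rV[R]_k) :
  measurable D -> mx_measurable D A -> mx_measurable D c ->
  (forall t, D t -> \rank (A t) = k /\ points (f t) = solutions (A t, c t)) ->
  measurable_fun D (f : T -> borel_flat V).
Proof.
move=> mD mA mc h; apply: measurable_fun_borel => O oO.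
have [B oB hB] := oO k.
rewrite (_ : _ `&` _ = D `&` [set t | B (A t, c t)]).
  exact: mx_measurable_pair_open.
apply/seteqP; split=> t [Dt].
  by move=> Ot; split=> //; have [r e] := h t Dt; apply/(hB (A t, c t) (f t)).
by move=> Bt; split=> //; have [r e] := h t Dt; apply/(hB (A t, c t) (f t)).
Qed.

End FlatFrames.

(** * Translation invariant measures on flats *)

Section Shifts.
Context {R : realType} {V : vectType R}.
Local Notation n := (\dim {:V}).
Local Notation par k := ('M[R]_(n, k) * 'rV[R]_k)%type.
Local Notation idx k := {ffun 'I_k -> 'I_n}.
Implicit Types (H G : flat V).

Lemma shift_subproof (v : V) H : exists w W,
  [set v + x | x in points H] = coset_of_dir w W.
Proof.
have [w [W HE]] := flatP H; exists (v + w), W; rewrite HE.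
apply/seteqP; split=> x; rewrite /coset_of_dir/=.
  by move=> [y yW <-]; rewrite opprD addrACA subrr add0r.
by move=> h; exists (x - v); rewrite ?subrKC//= -addrA -opprD.
Qed.

Definition shiftf (v : V) H : flat V := Flat (shift_subproof v H).

Lemma shiftf_points v H x : points (shiftf v H) x <-> points H (x - v).
Proof.
split; first by move=> [y Hy <-]; rewrite addrC addKr.
by move=> Hx; exists (x - v) => //; rewrite subrKC.
Qed.

Lemma shiftf_pset v H x : pset (shiftf v H) x <-> pset H (x - crd v).
Proof. by rewrite /pset/= raddfB/= crdK; exact: (shiftf_points v H (uncrd x)). Qed.

Lemma shiftfK v : cancel (shiftf v) (shiftf (- v)).
Proof.
move=> H; apply: flat_eq; apply/seteqP; split=> x.
  by move=> /shiftf_points/shiftf_points; rewrite opprK addrK.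
by move=> Hx; apply/shiftf_points/shiftf_points; rewrite opprK addrK.
Qed.

Lemma shiftfNK v : cancel (shiftf (- v)) (shiftf v).
Proof. by move=> H; rewrite -{1}(opprK v) shiftfK. Qed.

(** Translations are bijections, so invariance of a measure under images can be
stated with preimages, which are measurable. *)
Lemma shift_flatsE (v : V) (A : set (flat V)) : shift_flats v A = shiftf (- v) @^-1` A.
Proof.
apply/seteqP; split=> H.
  move=> [G AG HE]; rewrite /preimage/= (_ : H = shiftf v G) ?shiftfK//.
  exact: flat_eq.
by move=> AH; exists (shiftf (- v) H) => //; rewrite -[in LHS](shiftfNK v H).
Qed.

Lemma shiftf_solutions v k (p : par k) H : points H = solutions p ->
  points (shiftf v H) = solutions (p.1, p.2 + crd v *m p.1).
Proof.
move=> HE; apply/seteqP; split=> x.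
  move=> /shiftf_points; rewrite HE /solutions/= -!/(crd _) crdB mulmxBl => /eqP.
  by rewrite subr_eq => /eqP.
rewrite /solutions/= -!/(crd _) => xE; apply/shiftf_points.
by rewrite HE /solutions/= -!/(crd _) crdB mulmxBl xE addrK.
Qed.

Lemma shiftf_open v (O : set (flat V)) : open O -> open (shiftf v @^-1` O).
Proof.
move=> oO; apply: flat_openP => k p H rp Hp OH.
have [B oB hB] := oO k.
pose g (q : par k) : par k := (q.1, q.2 + crd v *m q.1).
have cg : g @ p --> g p.
  have c1 : (fun q : par k => q.1) @ p --> p.1 by exact: cvg_fst.
  have c2 : (fun q : par k => q.2) @ p --> p.2 by exact: cvg_snd.
  apply: (cvg_pair (F := nbhs p) (G := nbhs (g p).1) (H := nbhs (g p).2)) => //.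
  apply: (@cvgD _ _ _ (nbhs p)) => //.
  by apply: (cvg_mulmx (nbhs_filter p)) => //; exact: cvg_cst.
have nB : \forall q \near p, B (g q).
  apply: cg; apply: open_nbhs_nbhs; split=> //.
  by apply/(hB (g p) (shiftf v H)) => //; exact: shiftf_solutions.
apply: filterS nB => q Bq H' rq H'q.
by apply/(hB (g q) (shiftf v H')) => //; exact: shiftf_solutions.
Qed.

Lemma measurable_shiftf v : measurable_fun setT (shiftf v : borel_flat V -> borel_flat V).
Proof.
by apply: measurable_fun_borel => U oU; rewrite setTI; apply: open_borel; exact: shiftf_open.
Qed.

Lemma shiftf_Gr v k H : Gr k (shiftf v H) <-> Gr k H.
Proof.
have h w G : Gr k G -> Gr k (shiftf w G).
  move=> /Gr_solutions[p [rp Hp]].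
  by apply: (@solutions_Gr _ _ _ (p.1, p.2 + crd w *m p.1)) => //; exact: shiftf_solutions.
by split; [move=> /(h (- v)); rewrite shiftfK|exact: h].
Qed.

Lemma shiftf_frame v k (I : 'I_k -> 'I_n) H : chartdom I H ->
  chartdom I (shiftf v H) /\
  frame I (shiftf v H) = ((frame I H).1, (frame I H).2 + crd v *m (frame I H).1).
Proof.
move=> cH; have [fI Hf] := frameP cH.
by apply: frame_eq => //=; exact: shiftf_solutions.
Qed.

Lemma shiftf_piece v k (I : 'I_k -> 'I_n) H : piece I (shiftf v H) <-> piece I H.
Proof.
have h w G : piece I G -> piece I (shiftf w G).
  by move=> [cG bG]; have [cG' fG'] := shiftf_frame w cG; split => //; rewrite fG'.
by split; [move=> /(h (- v)); rewrite shiftfK|exact: h].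
Qed.

Lemma shiftf_select v k H : select k (shiftf v H) = select k H.
Proof.
rewrite /select; apply: eq_pick => I.
by apply/asboolP/asboolP => /shiftf_piece.
Qed.

Lemma shiftf_cell v k (I : idx k) H : cell I (shiftf v H) <-> cell I H.
Proof. by rewrite /cell/= shiftf_select. Qed.

(** A translation changes the right-hand side of the equations only, hence
preserves the cells. *)
Lemma shiftf_rep v k H : Gr k H ->
  rep k (shiftf v H) = ((rep k H).1, (rep k H).2 + crd v *m (rep k H).1).
Proof.
move=> /cell_cover[I sH]; rewrite (rep_cell sH).
have sH' : cell I (shiftf v H) by apply/shiftf_cell.
by rewrite (rep_cell sH'); have [cH _] := cell_piece sH; have [] := shiftf_frame v cH.
Qed.

End Shifts.

Section NormalMeasures.
Context {R : realType} {V : vectType R}.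
Local Notation n := (\dim {:V}).
Implicit Types (mu : flat_measure V) (k : nat).
Local Open Scope ereal_scope.

Definition shift_invariant (D : set (flat V)) :=
  forall v, shiftf v @^-1` D = D.

Lemma shift_invariantP (D : set (flat V)) :
  (forall v H, D H -> D (shiftf v H)) -> shift_invariant D.
Proof.
move=> h v; apply/seteqP; split=> H; last exact: h.
by move=> /(h (- v)%R); rewrite shiftfK.
Qed.

Lemma normal_shift k mu v (A : set (borel_flat V)) :
  normal_measure k mu -> measurable A -> mu (shiftf v @^-1` A) = mu A.
Proof.
by move=> [_ h _] mA; rewrite -[in RHS](h (- v)%R A mA) shift_flatsE opprK.
Qed.

(** The flats of codimension [k] meeting a compact set lie in a compact set of
flats. *)
Lemma normal_hits_fin k mu (K : set 'rV[R]_n) :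
  normal_measure k mu -> compact K -> mu (Gr k `&` hits K) < +oo.
Proof.
move=> [_ _ h] cK; have [C cC KC] := hits_bounded k cK.
apply: le_lt_trans (h C cC); apply: le_measure => //; rewrite inE.
  by apply: measurableI; [exact: measurable_Gr|exact: measurable_hits].
exact: flat_compact_measurable.
Qed.

Lemma measurable_Gr_hits k (K : set 'rV[R]_n) : compact K ->
  measurable (Gr k `&` hits K : set (borel_flat V)).
Proof.
by move=> cK; apply: measurableI; [exact: measurable_Gr|exact: measurable_hits].
Qed.

(** A normal measure is carried by [Gr k]. *)
Lemma measure_Gr k mu (A : set (borel_flat V)) : mu (~` Gr k) = 0 -> measurable A ->
  mu (Gr k `&` A) = mu A.
Proof.
move=> h mA; have mG := @measurable_Gr _ V k.
rewrite -[in RHS](setUIDK A (Gr k)) measureU//.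
- rewrite [X in _ + X](_ : _ = 0) ?adde0 1?setIC//.
  apply/eqP; rewrite eq_le measure_ge0 andbT -h; apply: le_measure; rewrite ?inE.
  + exact: measurableD.
  + exact: measurableC.
  + by move=> x [].
- exact: measurableI.
- exact: measurableD.
- by rewrite -subset0 => x [[_ ?] [_ ?]].
Qed.

(** Compact sets of flats meet a common cube, so finiteness need only be tested
on cubes. *)
Lemma normal_intro k mu : mu (~` Gr k) = 0 ->
  (forall v (A : set (borel_flat V)), measurable A -> mu (shiftf v @^-1` A) = mu A) ->
  (forall N : nat, mu (Gr k `&` hits (cube (- N%:R)%R N%:R%R)) < +oo) ->
  normal_measure k mu.
Proof.
move=> h0 hs hN; split=> //.
  by move=> v A mA; rewrite shift_flatsE hs.
move=> A cA; have mA := flat_compact_measurable cA.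
have [N AN] := compact_flats_hit cA.
rewrite -(measure_Gr h0 mA); apply: le_lt_trans (hN N).
apply: le_measure; rewrite ?inE.
- by apply: measurableI => //; exact: measurable_Gr.
- by apply: measurable_Gr_hits; exact: cube_compact.
- by move=> H [? /AN].
Qed.

Lemma normal_sigma_finite k mu : normal_measure k mu -> sigma_finite setT mu.
Proof.
move=> nmu; have [h0 _ _] := nmu.
exists (fun N => ~` Gr k `|` (Gr k `&` hits (cube (- N%:R)%R N%:R%R))).
  apply/seteqP; split=> // H _.
  have [HG|] := pselect (Gr k H); last by exists 0%N => //; left.
  have [l [p [rp Hp]]] := flat_solutions H.
  have /compact_flats_hit[N hN] : compact [set H] by exact: compact_set1.
  by exists N => //; right; split=> //; exact: hN.
move=> N; have mh := measurable_Gr_hits k (@cube_compact R n (- N%:R) N%:R).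
have mC : measurable (~` Gr k : set (borel_flat V)).
  by apply: measurableC; exact: measurable_Gr.
split; first exact: measurableU.
apply: (@le_lt_trans _ _ (mu (~` Gr k) + mu (Gr k `&` hits (cube (- N%:R)%R N%:R%R)))).
  exact: measureU2.
by rewrite h0 add0e; apply: normal_hits_fin nmu _; exact: cube_compact.
Qed.

Lemma measure_sandwich mu (S T N : set (borel_flat V)) :
  measurable S -> measurable T -> measurable N ->
  S `<=` T -> T `<=` S `|` N -> mu N = 0 -> mu S = mu T.
Proof.
move=> mS mT mN ST TSN N0; apply/eqP; rewrite eq_le; apply/andP; split.
  by apply: le_measure; rewrite ?inE.
rewrite -[leRHS]adde0 -N0; apply: (le_trans _ (@measureU2 _ _ _ mu _ _ mS mN)).
by apply: le_measure; rewrite ?inE//; exact: measurableU.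
Qed.

End NormalMeasures.

(** * Crofton's formula *)

Section Crofton.
Context {R : realType} {V : vectType R}.
Local Notation n := (\dim {:V}).
Local Notation idx k := {ffun 'I_k -> 'I_n}.
Implicit Types (mu : flat_measure V) (k : nat) (H : flat V).
Local Open Scope ereal_scope.

(** In coordinates, a parallelotope with the rows of [E] as sides, but with an
arbitrary base point and an arbitrary shape [C] in place of the unit cube. *)
Definition plate k (x : 'rV[R]_n) (E : 'M[R]_(k, n)) (C : set 'rV[R]_k) : set 'rV[R]_n :=
  [set x + t *m E | t in C]%R.

Lemma plate_compact k (x : 'rV[R]_n) (E : 'M[R]_(k, n)) (C : set 'rV[R]_k) :
  compact C -> compact (plate x E C).
Proof.
move=> cC; apply: continuous_compact cC; apply: continuous_subspaceT => t.
by apply: (@cvgD _ _ _ (nbhs t)); [exact: cvg_cst|exact: mulmxr_continuous].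
Qed.

Lemma det_opp_norm k (M : 'M[R]_k) : (`|\det (- M)| = `|\det M|)%R.
Proof. by rewrite -scaleN1r detZ normrM normrX normrN normr1 expr1n mul1r. Qed.

(** The vector having [s] as its coordinates of indices [I] and 0 elsewhere;
translating a flat of [cell I] by it adds [s] to the right-hand side of its
equations. *)
Definition block_vec k (I : idx k) (s : 'rV[R]_k) : V := uncrd (s *m rowsub I 1%:M)%R.

Lemma block_vec_rep k (I : idx k) (s : 'rV[R]_k) H : cell I H ->
  (crd (block_vec I s) *m (rep k H).1 = s)%R.
Proof.
move=> sH; rewrite (rep_cell sH) uncrdK -mulmxA -rowsubE.
by have [-> _] := frameP (cell_piece sH).1; rewrite mulmx1.
Qed.

Lemma shift_plate_fiber k (I : idx k) H (x : 'rV[R]_n) (E : 'M[R]_(k, n))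
    (C : set 'rV[R]_k) (s : 'rV[R]_k) : cell I H ->
  hits (plate x E C) (shiftf (- block_vec I s)%R H) <->
  exists2 y, plate x E C y & (y *m (rep k H).1 = (rep k H).2 - s)%R.
Proof.
move=> sH; have HG : Gr k H by apply: chartdom_Gr (cell_piece sH).1.
split=> -[y Ky].
  move=> /shiftf_pset; rewrite raddfN opprK => /(rep_psetE _ HG).
  rewrite mulmxDl (block_vec_rep _ sH) => yE; exists y => //.
  by rewrite -yE addrK.
move=> yE; exists y => //; apply/shiftf_pset; rewrite raddfN opprK.
by apply/(rep_psetE _ HG); rewrite mulmxDl (block_vec_rep _ sH) yE subrK.
Qed.

(** The parameters [s] for which the translated flat meets the plate form a
translate of the image of [C] under the matrix [E *m (rep k H).1], up to sign.
*)
Lemma leb_plate_fiber k (I : idx k) H (x : 'rV[R]_n) (E : 'M[R]_(k, n))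
    (C : set 'rV[R]_k) : cell I H -> compact C ->
  leb k [set s | hits (plate x E C) (shiftf (- block_vec I s)%R H)] =
  leb k C * (`|\det (E *m (rep k H).1)|)%:E.
Proof.
move=> sH cC; set M := (E *m (rep k H).1)%R.
rewrite muleC -det_opp_norm -leb_image//.
set D := [set _ | _ in C].
have mD : measurable (D : set (borel_rV k)).
  apply: closed_borel; apply: compact_closed; first exact: norm_hausdorff.
  apply: continuous_compact cC; apply: continuous_subspaceT; exact: mulmxr_continuous.
rewrite -(leb_shift (x *m (rep k H).1 - (rep k H).2)%R mD); congr (leb k _).
apply/seteqP; split=> s.
  move=> /(shift_plate_fiber _ _ _ _ sH)[_ [t Ct <-] yE]; exists t => //.
  rewrite mulmxN /M mulmxA; apply/eqP; rewrite -subr_eq0.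
  move/eqP: yE; rewrite mulmxDl -subr_eq0 => /eqP h.
  rewrite -oppr_eq0 -{}h; apply/eqP.
  by rewrite !opprD !opprK; apply/rowP => i; rewrite !mxE; ring.
move=> [t Ct /eqP tE]; apply/(shift_plate_fiber _ _ _ _ sH).
exists (x + t *m E)%R; first by exists t.
apply/eqP; rewrite -subr_eq0 -oppr_eq0; move: tE; rewrite -subr_eq0.
congr (_ == _); apply/rowP => i; rewrite mulmxDl mulmxN /M mulmxA !mxE; ring.
Qed.

(** Each flat is translated by [block_vec I s] and the result is integrated over
[s]. In the set [X] of pairs [(H, s)] such that [H] meets the plate and [s]
moves the right-hand side of [H] into the unit cube, the section over [H] has
Lebesgue measure 1, so [X] computes the left side. Translating [H] by [block_vec
I s], which preserves the measure for every [s], turns [X] into the set [Y] of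
pairs such that [H] has its right-hand side in the unit cube and, moved back by
[s], meets the plate; there the section over [H] is measured by
[leb_plate_fiber]. *)
Lemma crofton_piece k mu (I : idx k) (D : set (borel_flat V)) (x : 'rV[R]_n)
    (E : 'M[R]_(k, n)) (C : set 'rV[R]_k) :
  normal_measure k mu -> measurable D -> D `<=` cell I -> shift_invariant D ->
  compact C ->
  mu (D `&` hits (plate x E C)) = leb k C *
    \int[mu]_(H in D `&` [set H | cube 0 1 (rep k H).2])
       (`|\det (E *m (rep k H).1)|)%:E.
Proof.
move=> nmu mD DI iD cC.
have DG : D `<=` Gr k by move=> H /DI/cell_piece[/chartdom_Gr].
set K := plate x E C; have cK : compact K by exact: plate_compact.
pose D' : set (borel_flat V * @borel_rV R k) := D `*` setT.
have mD' : measurable D' by apply: measurableX.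
have mrep1 : mx_measurable D' (fun z => (rep k z.1).1).
  move=> i j.
  apply: (@measurable_comp _ _ _ _ _ _ D (fun H => (rep k H).1 i j) D' fst) => //;
    last by apply: measurable_funTS; exact: measurable_fst.
    by move=> _ [z [Dz _] <-].
  by apply: measurable_funS (measurable_rep1 i j) => //; exact: measurable_Gr.
have mrep2 : mx_measurable D' (fun z => (rep k z.1).2).
  move=> i j.
  apply: (@measurable_comp _ _ _ _ _ _ D (fun H => (rep k H).2 i j) D' fst) => //;
    last by apply: measurable_funTS; exact: measurable_fst.
    by move=> _ [z [Dz _] <-].
  by apply: measurable_funS (measurable_rep2 i j) => //; exact: measurable_Gr.
have msnd : mx_measurable D' (fun z => (z.2 : 'rV[R]_k)).
  move=> i j; apply: measurable_funTS.
  exact: (mx_measurable_fun_comp (@measurable_snd _ _ (borel_flat V) (@borel_rV R k))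
    (@mx_measurable_id R k)).
pose X : set (borel_flat V * @borel_rV R k) :=
  [set z | [/\ D z.1, hits K z.1 & cube 0 1 (z.2 + (rep k z.1).2)%R]].
pose Y : set (borel_flat V * @borel_rV R k) :=
  [set z | [/\ D z.1, cube 0 1 (rep k z.1).2 & hits K (shiftf (- block_vec I z.2)%R z.1)]].
have mX : measurable X.
  rewrite (_ : X = (hits K `*` setT) `&`
     (D' `&` (fun z => (z.2 + (rep k z.1).2)%R) @^-1` cube 0 1)).
    apply: measurableI.
      by apply: measurableX => //; exact: measurable_hits.
    apply: (measurable_fun_rV mD' (mx_measurableD msnd mrep2)) => //.
    exact: measurable_cube.
  by apply/seteqP; split=> -[H s] /=; [move=> [? ? ?]|move=> [[? _] [[? _] ?]]].
have mY : measurable Y.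
  rewrite (_ : Y = (D' `&` (fun z => (rep k z.1).2) @^-1` cube 0 1) `\`
     (D' `&` [set z | forall y, K y -> (y *m (rep k z.1).1 != (rep k z.1).2 - z.2)%R])).
    apply: measurableD.
      by apply: (measurable_fun_rV mD' mrep2) => //; exact: measurable_cube.
    exact: (mx_measurable_pair_open mD' mrep1 (mx_measurableB mrep2 msnd) (avoid_open cK)).
  apply/seteqP; split=> -[H s] /=.
    move=> [DH cH /(shift_plate_fiber _ _ _ _ (DI _ DH))[y Ky yE]].
    split=> // -[_ h]; have := h y Ky.
    by rewrite yE eqxx.
  move=> [[[DH _] cH] nh]; split=> //.
  apply/(shift_plate_fiber _ _ _ _ (DI _ DH)); apply: contrapT => ny; apply: nh.
  by split=> // y Ky; apply/eqP => yE; apply: ny; exists y.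
have smu := normal_sigma_finite nmu; have sleb := @leb_sigma_finite R k.
transitivity ((mu \x leb k) X).
  have mDh : measurable (D `&` hits K : set (borel_flat V)).
    by apply: measurableI => //; exact: measurable_hits.
  rewrite product_measureE.
  transitivity (\int[mu]_H (\1_(D `&` hits K) H)%:E).
    by rewrite integral_indic// setIT.
  apply: eq_integral => H _; rewrite indicE.
  case: (boolP (H \in D `&` hits K)) => /=.
    rewrite inE => -[DH hH].
    rewrite [X in leb k X](_ : _ = [set s | cube 0 1 (s + (rep k H).2)%R]).
      by rewrite leb_shift ?leb_cube ?subr0 ?expr1n//; exact: measurable_cube.
    by apply/seteqP; split=> s //= -[].
  rewrite notin_setE => nDH.
  rewrite [X in leb k X](_ : _ = set0) ?measure0//.
  by rewrite -subset0 => s [/= DH hH _]; apply: nDH.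
transitivity ((mu \x leb k) Y).
  rewrite (product_measure_swap smu sleb mX) (product_measure_swap smu sleb mY).
  rewrite !product_measureE; apply: eq_integral => s _.
  have mYs : measurable ([set H | Y (H, s)] : set (borel_flat V)).
    have := measurable_ysection s mY.
    by congr measurable; apply/seteqP; split=> H; rewrite /ysection/= inE.
  rewrite /= -(normal_shift (block_vec I s) nmu mYs); congr (mu _).
  have DE H : D (shiftf (block_vec I s) H) = D H.
    by rewrite -[in RHS](iD (block_vec I s)).
  apply/seteqP; split=> H /= [].
    move=> DH hH cH; split; rewrite /= ?DE// ?shiftfK//.
    by rewrite (shiftf_rep _ (DG _ DH))/= (block_vec_rep _ (DI _ DH)) addrC.
  rewrite /= DE shiftfK => DH.
  rewrite (shiftf_rep _ (DG _ DH))/= (block_vec_rep _ (DI _ DH)) addrC => cH hH.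
  by split.
rewrite product_measureE.
have mDc : measurable (D `&` [set H | cube 0 1 (rep k H).2] : set (borel_flat V)).
  have mr : mx_measurable D (fun H => (rep k H).2).
    move=> i j; apply: measurable_funS (measurable_rep2 i j) => //; exact: measurable_Gr.
  by apply: (measurable_fun_rV mD mr) => //; exact: measurable_cube.
rewrite -ge0_integralZl//; last first.
- apply/measurable_EFinP; apply: measurableT_comp => //.
  apply: measurable_det; apply: mx_measurableM; first exact: mx_measurable_cst.
  move=> i j; apply: measurable_funS (measurable_rep1 i j); first exact: measurable_Gr.
  by move=> H [/DG].
rewrite [RHS]integral_mkcond; apply: eq_integral => H _; rewrite patchE.
case: ifPn => [|].
  rewrite inE => -[DH cH]; rewrite -(leb_plate_fiber x E (DI _ DH) cC).
  by congr (leb k _); apply/seteqP; split=> s /=; [case|split].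
rewrite notin_setE => nDH.
rewrite [X in leb k X](_ : _ = set0) ?measure0//.
by rewrite -subset0 => s [/= DH hH _]; apply: nDH.
Qed.

End Crofton.

Section CroftonFormula.
Context {R : realType} {V : vectType R}.
Local Notation n := (\dim {:V}).
Local Notation idx k := {ffun 'I_k -> 'I_n}.
Implicit Types (mu : flat_measure V) (k : nat) (H : flat V).
Local Open Scope ereal_scope.

Lemma Gr_partition k (S : set (flat V)) :
  Gr k `&` S = \big[setU/set0]_(I <- enum {: idx k}) (cell I `&` S).
Proof.
rewrite -bigcup_seq; apply/seteqP; split=> H.
  by move=> [/cell_cover[I sH] SH]; exists I => //=; rewrite mem_enum.
by move=> [I _ [sH SH]]; split=> //; apply: chartdom_Gr (cell_piece sH).1.
Qed.

Lemma cell_trivIset k (S : set (flat V)) (D : set (idx k)) :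
  trivIset D (fun I => cell I `&` S).
Proof. by move=> I J _ _ [H [[+ _] [+ _]]]; rewrite /cell/= => -> []. Qed.

Lemma integral_cell k mu (S : set (borel_flat V)) (f : flat V -> \bar R) :
  measurable S -> measurable_fun (Gr k : set (borel_flat V)) f -> (forall H, 0 <= f H) ->
  \int[mu]_(H in Gr k `&` S) f H =
  \sum_(I <- enum {: idx k}) \int[mu]_(H in cell I `&` S) f H.
Proof.
move=> mS mf f0; rewrite Gr_partition ge0_integral_bigsetU//=.
- by move=> I; apply: measurableI => //; exact: measurable_cell.
- exact: enum_uniq.
- exact: cell_trivIset.
- by rewrite -Gr_partition; apply: measurable_funS mf; [exact: measurable_Gr|move=> H []].
Qed.

Lemma measure_cell k mu (S : set (borel_flat V)) : measurable S ->
  mu (Gr k `&` S) = \sum_(I <- enum {: idx k}) mu (cell I `&` S).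
Proof.
move=> mS.
have E (D : set (borel_flat V)) : measurable D -> mu D = \int[mu]_(H in D) cst 1 H.
  by move=> mD; rewrite integral_cst// mul1e.
rewrite E; last by apply: measurableI => //; exact: measurable_Gr.
rewrite integral_cell//; apply: eq_bigr => I _.
by rewrite -E//; apply: measurableI => //; exact: measurable_cell.
Qed.

(** Translations move right-hand sides freely, so that among the flats of any
given direction this set has transversal Lebesgue measure 1: integrating over it
amounts to integrating over directions. *)
Definition window k : set (flat V) := Gr k `&` [set H | cube 0 1 (rep k H).2].

Lemma measurable_window k : measurable (window k : set (borel_flat V)).
Proof.
have mG := @measurable_Gr _ V k.
by apply: (measurable_fun_rV mG (@measurable_rep2 _ V k)) => //; exact: measurable_cube.
Qed.

Lemma measurable_det_rep k (E : 'M[R]_(k, n)) :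
  measurable_fun (Gr k : set (borel_flat V))
    (fun H => (`|\det (E *m (rep k H).1)|)%:E).
Proof.
apply/measurable_EFinP; apply: measurableT_comp => //.
apply: measurable_det; apply: mx_measurableM; first exact: mx_measurable_cst.
exact: measurable_rep1.
Qed.

(** The flats of [Theta] are split along the cells, where [crofton_piece]
applies. The set [C] and the base point [x] only enter through the factor [leb k
C]. *)
Lemma crofton k mu (Theta : set (borel_flat V)) (x : 'rV[R]_n)
    (E : 'M[R]_(k, n)) (C : set 'rV[R]_k) :
  normal_measure k mu -> measurable Theta -> shift_invariant Theta -> compact C ->
  mu (Gr k `&` (Theta `&` hits (plate x E C))) = leb k C *
    \int[mu]_(H in window k `&` Theta) (`|\det (E *m (rep k H).1)|)%:E.
Proof.
move=> nmu mT iT cC.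
have mh : measurable (hits (plate x E C) : set (borel_flat V)).
  by apply: measurable_hits; exact: plate_compact.
rewrite measure_cell; last exact: measurableI.
have mw := measurable_window k.
have -> : window k `&` Theta = Gr k `&` (window k `&` Theta).
  by apply/seteqP; split=> H; [move=> [[? ?] ?]|move=> [? ?]].
rewrite integral_cell//; [|exact: measurableI|exact: measurable_det_rep].
rewrite ge0_sume_distrr; last first.
  by move=> I _; apply: integral_ge0 => H _; rewrite lee_fin.
apply: eq_bigr => I _.
have mS : measurable (cell I `&` Theta : set (borel_flat V)).
  by apply: measurableI => //; exact: measurable_cell.
have iS : shift_invariant (cell I `&` Theta).
  apply: shift_invariantP => v H [sH TH]; split; first exact/shiftf_cell.
  by rewrite -(iT (- v)%R) /preimage/= shiftfK.
have := crofton_piece x E nmu mS (@subIsetl _ _ _) iS cC.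
rewrite -setIA => ->; congr (_ * _); congr (integral mu _ _).
apply/seteqP; split=> H /=.
  move=> [[sH TH] cH]; split=> //; split=> //; split=> //.
  exact: chartdom_Gr (cell_piece sH).1.
by move=> [sH [[_ cH] TH]].
Qed.

(** A flat of the window contains a point with all coordinates at most [k] in
absolute value, namely the one whose coordinates outside the block are 0. *)
Lemma window_fin k mu : normal_measure k mu -> mu (window k) < +oo.
Proof.
move=> nmu; apply: le_lt_trans (normal_hits_fin nmu (@cube_compact R n (- k%:R) k%:R)).
apply: le_measure; rewrite ?inE.
- exact: measurable_window.
- by apply: measurable_Gr_hits; exact: cube_compact.
move=> H [HG cH]; split=> //; have [I sH] := cell_cover HG.
exists (crd (block_vec I (rep k H).2)); last first.
  by apply/(rep_psetE _ HG); rewrite block_vec_rep.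
move=> a; rewrite uncrdK mxE -ler_norml; apply: le_trans (ler_norm_sum _ _ _) _.
rewrite -[leRHS](_ : \sum_(i < k) (1 : R) = k%:R)%R; last by rewrite sumr_const card_ord.
apply: ler_sum => i _; rewrite normrM mulr_ile1//.
  by have /andP[c0 c1] := cH i; rewrite ger0_norm.
by rewrite !mxE; case: eqP => _; rewrite ?normr1 ?normr0.
Qed.

(** The flats that are not transversal to the span of the rows of [E]. *)
Definition degenerate k (E : 'M[R]_(k, n)) : set (flat V) :=
  [set H | \det (E *m (rep k H).1)%R = 0%R].

Lemma measurable_degenerate k (E : 'M[R]_(k, n)) :
  measurable (Gr k `&` degenerate E : set (borel_flat V)).
Proof.
have md : measurable_fun (Gr k : set (borel_flat V)) (fun H => \det (E *m (rep k H).1))%R.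
  apply: measurable_det; apply: mx_measurableM; first exact: mx_measurable_cst.
  exact: measurable_rep1.
exact: (md (@measurable_Gr _ V k) [set 0%R] (measurable_set1 0%R)).
Qed.

(** The integrand of Crofton's formula vanishes on degenerate flats, which form
a translation invariant set. *)
Lemma nontransversal_null k mu (x : 'rV[R]_n) (E : 'M[R]_(k, n)) (C : set 'rV[R]_k) :
  normal_measure k mu -> compact C ->
  mu (Gr k `&` (degenerate E `&` hits (plate x E C))) = 0.
Proof.
move=> nmu cC.
have iT : shift_invariant (Gr k `&` degenerate E).
  apply: shift_invariantP => v H [HG dH]; split; first exact/shiftf_Gr.
  by rewrite /degenerate/= shiftf_rep.
have := crofton x E nmu (measurable_degenerate E) iT cC.
rewrite [X in mu X](_ : _ = Gr k `&` (degenerate E `&` hits (plate x E C))); last first.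
  by apply/seteqP; split=> H; [move=> [? [[? ?] ?]]|move=> [? [? ?]]].
move=> ->; rewrite integral0_eq ?mule0// => H [_ [_ dH]].
by rewrite dH normr0.
Qed.

End CroftonFormula.

(** * The density of a normal measure *)

Section ConeExpansion.
Context {R : realType} {V : vectType R}.
Local Notation n := (\dim {:V}).

Lemma det_mulmx_expand k (E : 'M[R]_(k, n)) (F : 'M[R]_(n, k)) :
  \det (E *m F) = \sum_(J : {ffun 'I_k -> 'I_n})
    (\prod_j F (J j) j) * \det (\matrix_(i, j) E i (J j)).
Proof.
rewrite -det_tr [LHS]/determinant.
transitivity (\sum_(s : {perm 'I_k}) \sum_(J : {ffun 'I_k -> 'I_n})
    (-1) ^+ s * \prod_j (E (s j) (J j) * F (J j) j)).
  apply: eq_bigr => s _; rewrite -big_distrr/=; congr (_ * _).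
  under eq_bigr do rewrite !mxE.
  by rewrite (bigA_distr_bigA (fun j a => E (s j) a * F a j)).
rewrite exchange_big/=; apply: eq_bigr => J _.
rewrite -det_tr /determinant big_distrr/=; apply: eq_bigr => s _.
rewrite big_split/= [RHS]mulrCA; congr (_ * _).
by rewrite mulrC; congr (_ * _); apply: eq_bigr => j _; rewrite !mxE.
Qed.

Definition coord_form (a : 'I_n) (v : V) : R^o := crd v 0 a.

Lemma coord_form_linear a : linear (coord_form a).
Proof. by move=> c u v; rewrite /coord_form linearP !mxE. Qed.

HB.instance Definition _ a :=
  GRing.isLinear.Build R V R^o _ (coord_form a) (coord_form_linear a).

Definition coordf (a : 'I_n) : dual V := linfun (coord_form a).

Lemma coordfE a v : coordf a v = crd v 0 a.
Proof. by rewrite lfunE. Qed.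

Definition basisv (a : 'I_n) : V := uncrd (delta_mx 0 a).

Lemma crd_basis v : v = \sum_a crd v 0 a *: basisv a.
Proof.
apply: (can_inj (@crdK _ V)); rewrite crd_sum.
under eq_bigr do rewrite crdZ uncrdK.
exact: row_sum_delta.
Qed.

Lemma dual_expand (f : dual V) v : f v = \sum_a crd v 0 a * f (basisv a).
Proof.
rewrite {1}[v]crd_basis linear_sum; apply: eq_bigr => a _; by rewrite linearZ.
Qed.

(** A decomposable vector is multilinear in the forms it is evaluated at, so
that finitely many of its values determine it; this turns pointwise convergence
into uniform estimates. *)
Lemma cone_expand k (w : cone k V) (f : 'I_k -> dual V) :
  val w f = \sum_(J : {ffun 'I_k -> 'I_n})
    (\prod_j f j (basisv (J j))) * val w (fun j => coordf (J j)).
Proof.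
case: w => /= w /set_mem[t [xi wE]]; rewrite wE.
under [RHS]eq_bigr do rewrite wE mulrCA.
rewrite -big_distrr/=; congr (_ * _); rewrite /wedge_fun.
pose E := \matrix_(i < k, a < n) crd (xi i) 0 a.
pose F := \matrix_(a < n, j < k) (f j (basisv a) : R).
rewrite (_ : \matrix_(i, j) _ = E *m F).
  rewrite det_mulmx_expand; apply: eq_bigr => J _.
  congr (_ * _); first by apply: eq_bigr => j _; rewrite mxE.
  congr (\det _).
  by apply/matrixP => i j; rewrite [RHS]mxE coordfE !mxE.
apply/matrixP => i j; rewrite !mxE dual_expand.
by apply: eq_bigr => a _; rewrite !mxE.
Qed.

Definition col_form k (A : 'M[R]_(n, k)) (j : 'I_k) (v : V) : R^o := (crd v *m A) 0 j.

Lemma col_form_linear k (A : 'M[R]_(n, k)) j : linear (col_form A j).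
Proof. by move=> c u v; rewrite /col_form linearP mulmxDl -scalemxAl !mxE. Qed.

HB.instance Definition _ k (A : 'M[R]_(n, k)) j :=
  GRing.isLinear.Build R V R^o _ (col_form A j) (col_form_linear A j).

Definition colf k (A : 'M[R]_(n, k)) (j : 'I_k) : dual V := linfun (col_form A j).

Lemma colfE k (A : 'M[R]_(n, k)) j v : colf A j v = (crd v *m A) 0 j.
Proof. by rewrite lfunE. Qed.

Lemma colf_basis k (A : 'M[R]_(n, k)) j a : colf A j (basisv a) = A a j.
Proof. by rewrite colfE uncrdK -rowE mxE. Qed.

Definition crd_mx k (xi : 'I_k -> V) : 'M[R]_(k, n) := \matrix_(i, a) crd (xi i) 0 a.

Lemma wedge_colf k (xi : 'I_k -> V) (A : 'M[R]_(n, k)) :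
  val (wedge xi) (colf A) = \det (crd_mx xi *m A).
Proof.
congr (\det _); apply/matrixP => i j; rewrite !mxE colfE !mxE.
by apply: eq_bigr => a _; rewrite !mxE.
Qed.

Lemma cone_eval_continuous k (f : 'I_k -> dual V) : continuous (fun w : cone k V => val w f).
Proof.
move=> w; apply: (@continuous_comp _ _ _ (fun w : cone k V => (val w : kform_fun k V))
  (fun h : kform_fun k V => h f)).
  exact: initial_continuous.
exact: (@proj_continuous _ (fun=> R) f).
Qed.

End ConeExpansion.

Lemma cvg_dist_bound (R : realType) (T : Type) (F : set_system T) (FF : Filter F)
    (f g : T -> R) (l : R) :
  (forall t, `|l - f t| <= g t) -> g @ F --> 0 -> f @ F --> l.
Proof.
move=> fg g0; apply/cvgrPdist_le => e e0.
have /cvgrPdist_le/(_ e e0) := g0; apply: filterS => t.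
rewrite sub0r normrN => ge; apply: le_trans (fg t) (le_trans (ler_norm _) ge).
Qed.

Section MeasureDensity.
Context {R : realType} {V : vectType R}.
Local Notation n := (\dim {:V}).
Implicit Types (mu : flat_measure V) (k : nat) (H : flat V).
Local Open Scope ereal_scope.

(** The right side of Crofton's formula for the unit cube, rewritten so that it
makes sense for an arbitrary element of the cone: [colf A] is the family of
linear forms whose coefficients are the columns of [A], and on [wedge xi] it
evaluates to a determinant. *)
Definition density_of k mu : kdens k V := fun w =>
  fine (\int[mu]_(H in window k) (`|val w (colf (rep k H).1)|)%:E).

Lemma measurable_colf k (w : cone k V) :
  measurable_fun (window k : set (borel_flat V)) (fun H => val w (colf (rep k H).1) : R).
Proof.
apply: (@measurable_funS _ _ _ _ (Gr k : set (borel_flat V))).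
- exact: measurable_Gr.
- by move=> H [].
under eq_fun do rewrite cone_expand; apply: measurable_sum => J.
apply: measurable_funM => //; apply: measurable_prod => j _.
under eq_fun do rewrite colf_basis; exact: measurable_rep1.
Qed.

(** A pseudometric controlling all values on linear forms with coefficients
between -1 and 1, and continuous because it involves only finitely many of them.
*)
Definition cone_dist k (w w' : cone k V) : R :=
  (\sum_(J : {ffun 'I_k -> 'I_n})
     `|val w (fun j => coordf (J j)) - val w' (fun j => coordf (J j))|)%R.

Lemma cone_dist_bound k (w w' : cone k V) H : Gr k H ->
  (`|val w (colf (rep k H).1)| <= `|val w' (colf (rep k H).1)| + cone_dist w w')%R.
Proof.
move=> HG; rewrite -lerBlDl; apply: le_trans (lerB_dist _ _) _.
rewrite (cone_expand w) (cone_expand w') -sumrB; apply: le_trans (ler_norm_sum _ _ _) _.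
apply: ler_sum => J _; rewrite -mulrBr normrM ler_piMl//.
rewrite normr_prod; apply: prodr_ile1 => j _; rewrite normr_ge0/=.
by rewrite colf_basis ler_norml; exact: rep_bounded.
Qed.

Lemma cone_dist_sym k (w w' : cone k V) : cone_dist w w' = cone_dist w' w.
Proof. by apply: eq_bigr => J _; rewrite distrC. Qed.

Lemma cone_dist_ge0 k (w w' : cone k V) : (0 <= cone_dist w w')%R.
Proof. by apply: sumr_ge0. Qed.

Lemma integral_density_bound k mu (w w' : cone k V) : normal_measure k mu ->
  \int[mu]_(H in window k) (`|val w (colf (rep k H).1)|)%:E <=
  \int[mu]_(H in window k) (`|val w' (colf (rep k H).1)|)%:E
  + (cone_dist w w')%:E * mu (window k).
Proof.
move=> nmu; have mw := @measurable_window _ V k.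
rewrite -integral_cst// -ge0_integralD//; last 2 first.
- by apply/measurable_EFinP; apply: measurableT_comp => //; exact: measurable_colf.
- by move=> H _; rewrite lee_fin cone_dist_ge0.
apply: ge0_le_integral => //.
- by apply/measurable_EFinP; apply: measurableT_comp => //; exact: measurable_colf.
- apply: emeasurable_funD => //.
  by apply/measurable_EFinP; apply: measurableT_comp => //; exact: measurable_colf.
- by move=> H [HG _]; rewrite -EFinD lee_fin; exact: cone_dist_bound.
Qed.

Lemma density_of_fin k mu (w : cone k V) : normal_measure k mu ->
  \int[mu]_(H in window k) (`|val w (colf (rep k H).1)|)%:E \is a fin_num.
Proof.
move=> nmu; rewrite ge0_fin_numE; last by apply: integral_ge0.
have [z zE] : exists z : cone k V, forall f, val z f = 0%R.
  have z0 : (fun=> 0%R : R) \in cone k V.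
    by apply/mem_set; exists 0%R, (fun=> 0%R) => f; rewrite mul0r.
  by exists (exist (fun w => is_true (w \in cone k V)) _ z0).
apply: (le_lt_trans (integral_density_bound w z nmu)).
rewrite integral0_eq ?add0e; last by move=> H _; rewrite zE normr0.
by apply: lte_mul_pinfty; rewrite ?lee_fin ?cone_dist_ge0//; exact: window_fin.
Qed.

(** The equations chosen in [rep] have bounded coefficients and the window has
finite measure, so the integral is Lipschitz for [cone_dist]. *)
Lemma density_of_lipschitz k mu (w w' : cone k V) : normal_measure k mu ->
  (`|density_of mu w - density_of mu w'| <= cone_dist w w' * fine (mu (window k)))%R.
Proof.
move=> nmu.
have h (v v' : cone k V) :
    (density_of mu v <= density_of mu v' + cone_dist v v' * fine (mu (window k)))%R.
  have wf : mu (window k) \is a fin_num by rewrite ge0_fin_numE// window_fin.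
  rewrite -lee_fin EFinD EFinM /density_of !fineK//; try exact: density_of_fin.
  exact: integral_density_bound.
rewrite ler_distl lerBlDr h/= andbC; have := h w' w; rewrite cone_dist_sym.
by [].
Qed.

Lemma density_of_kdensity k mu : normal_measure k mu ->
  is_kdensity (density_of mu : kdens k V).
Proof.
move=> nmu; split=> [w0|t w w' ww'].
  set M := fine (mu (window k)).
  apply: (cvg_dist_bound (nbhs_filter w0) (g := fun w => (cone_dist w0 w * M)%R)).
    by move=> w; exact: density_of_lipschitz.
  rewrite -[X in _ --> X](mul0r M).
  apply: (@cvgM _ _ (nbhs w0) (nbhs_filter w0)); last exact: cvg_cst.
  rewrite -[X in _ --> X](_ : cone_dist w0 w0 = 0)%R; last first.
    by rewrite /cone_dist big1// => J _; rewrite subrr normr0.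
  apply: (cvg_sumr (nbhs_filter w0)) => J.
  apply: (@cvg_norm _ _ _ (nbhs w0) (nbhs_filter w0)).
  apply: (@cvgB _ _ _ (nbhs w0) (nbhs_filter w0)); first exact: cvg_cst.
  exact: cone_eval_continuous.
rewrite /density_of.
under eq_integral do rewrite ww' normrM EFinM.
have mw := @measurable_window _ V k.
rewrite ge0_integralZl//; last first.
  by apply/measurable_EFinP; apply: measurableT_comp => //; exact: measurable_colf.
by rewrite fineM//; exact: density_of_fin.
Qed.

Lemma crd_parallelotope k (xi : 'I_k -> V) :
  crd @` parallelotope xi = plate 0 (crd_mx xi) (cube 0 1).
Proof.
apply/seteqP; split=> [_ [_ [t t01 <-] <-]|_ [t t01 <-]].
  exists (\row_i t i)%R; first by move=> i; rewrite mxE; exact: t01.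
  rewrite add0r mulmx_sum_row crd_sum; apply: eq_bigr => i _.
  by rewrite crdZ mxE; congr (_ *: _)%R; apply/rowP => a; rewrite [LHS]mxE [LHS]mxE.
exists (\sum_i t ord0 i *: xi i)%R; first by exists (t ord0).
rewrite add0r mulmx_sum_row crd_sum; apply: eq_bigr => i _.
by rewrite crdZ; congr (_ *: _)%R; apply/rowP => a; rewrite [RHS]mxE [RHS]mxE.
Qed.

(** Crofton's formula with the unit cube, the determinants being the values of
[wedge xi]. Hence [chi mu] comes from a density on the whole cone. *)
Lemma chi_density_of k mu (xi : 'I_k -> V) : normal_measure k mu ->
  chi mu xi = density_of mu (wedge xi).
Proof.
move=> nmu; rewrite /chi hitE crd_parallelotope /density_of; congr fine.
have := crofton 0%R (crd_mx xi) nmu measurableT (fun=> preimage_setT _)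
  (@cube_compact R k 0 1).
rewrite setTI setIT => ->; rewrite leb_cube// subr0 expr1n mul1e.
by apply: eq_integral => H _; rewrite wedge_colf.
Qed.

(** The integral in Crofton's formula depends neither on the base point nor on
the shape of the plate. *)
Lemma hits_plate k mu (x : 'rV[R]_n) (xi : 'I_k -> V) (C : set 'rV[R]_k) :
  normal_measure k mu -> compact C ->
  mu (Gr k `&` hits (plate x (crd_mx xi) C)) = leb k C * (chi mu xi)%:E.
Proof.
move=> nmu cC; rewrite chi_density_of// /density_of fineK ?density_of_fin//.
have := crofton x (crd_mx xi) nmu measurableT (fun=> preimage_setT _) cC.
rewrite setTI setIT => ->; congr (_ * _).
by apply: eq_integral => H _; rewrite wedge_colf.
Qed.

End MeasureDensity.

(** * Pull-back of normal measures *)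

Section KernelPush.
Context d1 d2 (T1 : measurableType d1) (T2 : measurableType d2) (R : realType).
Context (D : set T1) (mD : measurable D) (f : T1 -> T2) (mf : measurable_fun D f).

(** Measures are pushed forward along everywhere defined maps; [restricted_push]
first restricts the measure to [D], where this is [f]. *)
Definition total_ext (t : T1) : T2 := if t \in D then f t else point.

Lemma measurable_total_ext : measurable_fun setT total_ext.
Proof.
move=> _ Y mY; rewrite setTI.
rewrite (_ : _ @^-1` _ = (D `&` f @^-1` Y) `|` (~` D `&` [set t | Y point])).
  apply: measurableU; first exact: mf.
  apply: measurableI; first exact: measurableC.
  have [Yp|nYp] := pselect (Y point).
    by rewrite (_ : [set _ | _] = setT)//; apply/seteqP; split.
  by rewrite (_ : [set _ | _] = set0)//; apply/seteqP; split.
apply/seteqP; split=> t; rewrite /preimage/total_ext/=.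
  case: ifPn; [rewrite inE => Dt Yt; left|rewrite notin_setE => Dt Yt; right]; by split.
by move=> [[Dt]|[Dt]]; [rewrite mem_set|rewrite memNset].
Qed.

Definition restricted_push (m : {measure set T1 -> \bar R}) : {measure set T2 -> \bar R} :=
  push_measure (mrestr m mD) measurable_total_ext.

Lemma restricted_pushE (m : {measure set T1 -> \bar R}) (A : set T2) :
  restricted_push m A = m (D `&` f @^-1` A).
Proof.
rewrite /restricted_push/= /pushforward /mrestr; congr (m _).
apply/seteqP; split=> t; rewrite /preimage/total_ext/=.
  by move=> [+ Dt]; rewrite mem_set.
by move=> [Dt ft]; rewrite mem_set.
Qed.

End KernelPush.

Section FullRank.
Context {R : realType}.

Lemma measurable_full_rank d (T : measurableType d) (D : set T) m k
    (A : T -> 'M[R]_(m, k)) : measurable D -> mx_measurable D A ->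
  measurable (D `&` [set t | \rank (A t) = k]).
Proof.
move=> mD mA.
rewrite (_ : _ `&` _ = \bigcup_(I in [set: {ffun 'I_k -> 'I_m}])
   (D `\` (D `&` (fun t => \det (rowsub I (A t))) @^-1` [set 0]))).
  apply: fin_bigcup_measurable; first exact: finite_finset.
  move=> I _; apply: measurableD => //.
  have md : measurable_fun D (fun t => \det (rowsub I (A t)) : R).
    apply: measurable_det => i j; under eq_fun do rewrite mxE; exact: mA.
  exact: md (measurable_set1 0).
apply/seteqP; split=> t.
  move=> [Dt /= /unit_minor[I]]; rewrite unitmxE unitfE => uI.
  by exists I => //; split=> // -[_ /= d0]; rewrite d0 eqxx in uI.
move=> [I _ [Dt nd]]; split=> //=; apply: (@unit_minor_rank _ _ _ _ I).
by rewrite unitmxE unitfE; apply/eqP => d0; apply: nd.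
Qed.

End FullRank.

Section SolutionRank.
Context {R : realType} {V : vectType R}.
Local Notation n := (\dim {:V}).
Local Notation par k := ('M[R]_(n, k) * 'rV[R]_k)%type.

Lemma flat_nonempty (H : flat V) : exists v, points H v.
Proof.
have [v [W ->]] := flatP H; exists v.
by rewrite /coset_of_dir/= subrr mem0v.
Qed.

(** A consistent system is equivalent to an independent one made of a basis of
its columns, so the codimension of its solution set is its rank. *)
Lemma solutions_flat k (p : 'M[R]_(n, k) * 'rV[R]_k) : (exists v, solutions p v) ->
  exists2 K : flat V, points K = solutions p & Gr (\rank p.1) K.
Proof.
move=> [v vp].
pose p' := (col_base p.1, crd v *m col_base p.1).
have rp' : \rank p'.1 = \rank p.1 by apply/eqP; exact: col_base_full.
have E (x : 'rV[R]_n) : x *m p.1 = (x *m col_base p.1) *m row_base p.1.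
  by rewrite -mulmxA mulmx_base.
have pE : solutions p = solutions p'.
  have vp' : crd v *m p.1 = p.2 by exact: vp.
  apply/seteqP; split=> u; rewrite /solutions -vp'.
    move=> h; apply: (row_free_inj (row_base_free p.1)).
    by move: h; rewrite /= -!/(crd _) (E (crd u)) (E (crd v)).
  move=> uE; rewrite /= -!/(crd _) (E (crd u)) (E (crd v)); congr (_ *m _).
  exact: uE.
exists (mkflat p'); first by rewrite mkflatE.
by apply: (solutions_Gr rp'); exact: mkflatE.
Qed.

Lemma solutions_rank k l (p : par k) (H : flat V) :
  points H = solutions p -> Gr l H -> \rank p.1 = l.
Proof.
move=> HE HG; have [v Hv] := flat_nonempty H.
have [|K KE KG] := @solutions_flat _ p; first by exists v; rewrite -HE.
by apply: (Gr_uniq KG); rewrite (_ : K = H)//; apply: flat_eq; rewrite KE HE.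
Qed.

End SolutionRank.

Section PullMeasure.
Context {R : realType} {U V : vectType R} (L : 'Hom(U, V)).
Local Notation nU := (\dim {:U}).
Local Notation nV := (\dim {:V}).
Implicit Types (mu : flat_measure V) (H : flat V) (G : flat U).

Definition mxL : 'M[R]_(nU, nV) := passmx.mxof (vbasis {:U}) (vbasis {:V}) L.

Lemma crdL u : crd (L u) = crd u *m mxL.
Proof.
rewrite /mxL -[in LHS](crdK u) /crd.
by rewrite passmx.mul_mxof.
Qed.

Definition pulls H G : Prop := points G = L @^-1` points H.

Lemma pulls_solutions k (p : 'M[R]_(nV, k) * 'rV[R]_k) H : points H = solutions p ->
  L @^-1` points H = solutions (mxL *m p.1, p.2).
Proof.
move=> ->; apply/seteqP; split=> u; rewrite /solutions/preimage/= -!/(crd _).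
  by rewrite crdL mulmxA.
by rewrite crdL mulmxA.
Qed.

Definition pullf H : flat U := xget point [set G | pulls H G].

(** The preimage of a flat of codimension [k] has again codimension [k] exactly
when [L] is transversal to it, that is, when the pulled back equations are
independent; the map sending a flat to its preimage is only used there. *)
Definition pulldom k : set (flat V) :=
  [set H | Gr k H /\ \rank (mxL *m (rep k H).1) = k].

Lemma pullfP k H : pulldom k H ->
  Gr k (pullf H) /\ points (pullf H) = solutions (mxL *m (rep k H).1, (rep k H).2).
Proof.
move=> [HG r].
have E := pulls_solutions (repP HG).2.
have : pulls H (pullf H).
  apply: (@xgetPex _ point [set G | pulls H G]).
  exists (mkflat (mxL *m (rep k H).1, (rep k H).2)).
  by rewrite /= /pulls E mkflatE.
by rewrite /pulls E => h; split=> //; exact: (solutions_Gr _ h).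
Qed.

Lemma pulldomP k H G : Gr k H -> Gr k G -> pulls H G -> pulldom k H /\ pullf H = G.
Proof.
move=> HG GG HE; have E := pulls_solutions (repP HG).2.
have r : \rank (mxL *m (rep k H).1) = k.
  by apply: (@solutions_rank _ _ _ _ (mxL *m (rep k H).1, (rep k H).2) G) => //; rewrite -E.
split=> //; apply: flat_eq; have [_ ->] := pullfP (conj HG r).
by rewrite -E.
Qed.

Lemma measurable_pulldom k : measurable (pulldom k : set (borel_flat V)).
Proof.
apply: (measurable_full_rank (@measurable_Gr _ V k)).
by apply: mx_measurableM; [exact: mx_measurable_cst|exact: measurable_rep1].
Qed.

Lemma measurable_pullf k :
  measurable_fun (pulldom k : set (borel_flat V)) (pullf : borel_flat V -> borel_flat U).
Proof.
have sub : pulldom k `<=` Gr k by move=> H [].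
apply: (@measurable_flat R U _ (borel_flat V) (pulldom k) k pullf
  (fun H => mxL *m (rep k H).1) (fun H => (rep k H).2)).
- exact: measurable_pulldom.
- apply: mx_measurableM; first exact: mx_measurable_cst.
  move=> i j; apply: measurable_funS (measurable_rep1 i j) => //; exact: measurable_Gr.
- move=> i j; apply: measurable_funS (measurable_rep2 i j) => //; exact: measurable_Gr.
- by move=> H HD; have [_ ->] := pullfP HD; case: HD.
Qed.

Definition mpull k mu : flat_measure U :=
  restricted_push (measurable_pulldom k) (@measurable_pullf k) mu.

Lemma mpullE k mu (A : set (flat U)) :
  mpull k mu A = mu (pulldom k `&` pullf @^-1` A).
Proof. exact: restricted_pushE. Qed.

End PullMeasure.

Section PullNormal.
Context {R : realType} {U V : vectType R} (L : 'Hom(U, V)).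
Implicit Types (mu : flat_measure V) (H : flat V) (G : flat U).
Local Open Scope ereal_scope.

Lemma pullf_points k H u : pulldom L k H -> points (pullf L H) u <-> points H (L u).
Proof.
move=> HD; have [_ ->] := pullfP HD.
by rewrite -(pulls_solutions L (repP HD.1).2).
Qed.

Lemma pulldom_shift k H v : pulldom L k (shiftf v H) <-> pulldom L k H.
Proof.
split=> -[HG r].
  have HG0 : Gr k H by exact/(shiftf_Gr v).
  by split=> //; move: r; rewrite shiftf_rep.
by split; [exact/shiftf_Gr|rewrite shiftf_rep].
Qed.

Lemma pullf_shift k H u : pulldom L k H ->
  pullf L (shiftf (L u) H) = shiftf u (pullf L H).
Proof.
move=> HD; have HD' : pulldom L k (shiftf (L u) H) by apply/pulldom_shift.
apply: flat_eq; apply/seteqP; split=> x.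
  move=> /(pullf_points _ HD')/shiftf_points; rewrite -linearB => h.
  by apply/shiftf_points/(pullf_points _ HD).
move=> /shiftf_points/(pullf_points _ HD) h.
by apply/(pullf_points _ HD')/shiftf_points; rewrite -linearB.
Qed.

Lemma measurable_pull_preimage k (A : set (borel_flat U)) : measurable A ->
  measurable (pulldom L k `&` pullf L @^-1` A : set (borel_flat V)).
Proof. by move=> mA; apply: measurable_pullf => //; exact: measurable_pulldom. Qed.

(** Translating the preimage of [H] by [u] is the same as taking the preimage of
[H] translated by [L u]; and a preimage meeting a cube comes from a flat meeting
the image of the cube. *)
Lemma mpull_normal k mu : normal_measure k mu -> normal_measure k (mpull L k mu).
Proof.
move=> nmu; apply: normal_intro.
- rewrite mpullE [X in mu X](_ : _ = set0) ?measure0// -subset0 => H [HD].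
  by rewrite /preimage/=; apply; exact: (pullfP HD).1.
- move=> u A mA; rewrite !mpullE.
  rewrite -(normal_shift (L u) nmu (measurable_pull_preimage k mA)); congr (mu _).
  apply/seteqP; split=> H [HD]; rewrite /preimage/= => h.
    by split; [exact/pulldom_shift|rewrite (pullf_shift u HD)].
  by move/pulldom_shift : HD => HD; split=> //; rewrite -(pullf_shift u HD).
- move=> N; rewrite mpullE.
  pose K := [set x *m mxL L | x in @cube R (\dim {:U}) (- N%:R) N%:R]%R.
  have cK : compact K.
    apply: continuous_compact; last exact: cube_compact.
    by apply: continuous_subspaceT; exact: mulmxr_continuous.
  apply: le_lt_trans (normal_hits_fin nmu cK); apply: le_measure; rewrite ?inE.
  + by apply: measurable_pull_preimage; apply: measurable_Gr_hits; exact: cube_compact.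
  + exact: measurable_Gr_hits.
  + move=> H [HD [_ [x xN Hx]]]; split; first exact: HD.1.
    exists (x *m mxL L)%R; first by exists x.
    move: Hx => /(pullf_points _ HD).
    by rewrite -pset_crd crdL uncrdK.
Qed.

Lemma crd_mxL k (xi : 'I_k -> U) : crd_mx (fun i => L (xi i)) = (crd_mx xi *m mxL L)%R.
Proof.
apply/row_matrixP => i; rewrite row_mul.
rewrite [LHS](_ : _ = crd (L (xi i))).
  by rewrite crdL; congr (_ *m _)%R; apply/rowP => j; rewrite !mxE.
by apply/rowP => j; rewrite [LHS]mxE [LHS]mxE.
Qed.

(** The preimage of [H] meets a parallelotope iff [H] meets its image. The flats
excluded from [pulldom] that meet the image parallelotope are not transversal to
its span, and Crofton's formula makes them negligible. *)
Lemma chi_mpull k mu (xi : 'I_k -> U) : normal_measure k mu ->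
  chi (mpull L k mu) xi = chi mu (fun i => L (xi i)).
Proof.
move=> nmu; rewrite /chi; congr fine; rewrite mpullE !hitE !crd_parallelotope crd_mxL.
set E := crd_mx xi; set K := plate _ _ _; set K' := plate _ _ _.
have cK : compact K by apply: plate_compact; exact: cube_compact.
have cK' : compact K' by apply: plate_compact; exact: cube_compact.
have mS1 := measurable_pull_preimage k (measurable_Gr_hits k cK).
have mS2 := measurable_Gr_hits k cK'.
have sub : pulldom L k `&` pullf L @^-1` (Gr k `&` hits K) `<=` Gr k `&` hits K'.
  move=> H [HD [_ [_ [t t01 <-] Hx]]]; split; first exact: HD.1.
  exists (0 + t *m (E *m mxL L))%R; first by exists t.
  move: Hx => /(pullf_points _ HD); rewrite -pset_crd crdL uncrdK.
  by rewrite !add0r mulmxA.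
apply: (@measure_sandwich _ _ mu _ _
  (Gr k `&` (degenerate (E *m mxL L)%R `&` hits K'))) => //.
- rewrite setIA; apply: measurableI; last exact: measurable_hits.
  exact: measurable_degenerate.
- move=> H [HG hH].
  have [d0|d0] := eqVneq (\det (E *m mxL L *m (rep k H).1))%R 0%R; first by right.
  left.
  have HD : pulldom L k H.
    split=> //; apply/eqP; rewrite eqn_leq rank_leq_col/=.
    have u : (E *m (mxL L *m (rep k H).1))%R \in unitmx.
      by rewrite unitmxE unitfE mulmxA.
    by rewrite -[leqLHS](mxrank_unit u) mxrankM_maxr.
  split=> //; split; first exact: (pullfP HD).1.
  have [_ [t t01 <-] Hx] := hH.
  exists (0 + t *m E)%R; first by exists t.
  apply/(pullf_points _ HD); rewrite -pset_crd crdL uncrdK.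
  by move: Hx; rewrite !add0r mulmxA.
- exact: (nontransversal_null 0%R (E *m mxL L)%R nmu (@cube_compact R k 0 1)).
Qed.

End PullNormal.

(** * Products of normal measures *)

Section ProductMeasure.
Context {R : realType} {V : vectType R}.
Local Notation n := (\dim {:V}).
Implicit Types (mu nu rho : flat_measure V) (G H K : flat V).
Local Open Scope ereal_scope.

Lemma measurable_section1 (X : set (borel_flat V * borel_flat V)) (G : borel_flat V) :
  measurable X -> measurable ([set H | X (G, H)] : set (borel_flat V)).
Proof.
move=> mX; have := measurable_xsection G mX.
by congr measurable; apply/seteqP; split=> H; rewrite /xsection/= inE.
Qed.

Lemma measurable_fun_section1 nu (X : set (borel_flat V * borel_flat V)) :
  sigma_finite setT nu -> measurable X ->
  measurable_fun setT (fun G : borel_flat V => nu [set H | X (G, H)]).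
Proof.
move=> snu mX.
have := measurable_fun_xsection (sfin_measure snu) mX.
rewrite (_ : _ \o _ = (fun G : borel_flat V => nu [set H : borel_flat V | X (G, H)]))//.
apply/funext => G /=; rewrite /sfin_measure; congr (nu _).
by apply/seteqP; split=> H; rewrite /xsection/= inE.
Qed.

(** Pairs of flats meeting transversally: the codimension of the intersection is
required to be the sum of the codimensions. *)
Definition tint p q (A : set (flat V)) : set (borel_flat V * borel_flat V) :=
  [set GH | exists2 K, A K & [/\ Gr p GH.1, Gr q GH.2, Gr (p + q) K &
     points K = points GH.1 `&` points GH.2]].

Lemma inter_solutions p q G H : Gr p G -> Gr q H ->
  points G `&` points H =
  solutions (row_mx (rep p G).1 (rep q H).1, row_mx (rep p G).2 (rep q H).2)%R.
Proof.
move=> /repP[_ GE] /repP[_ HE]; rewrite GE HE; apply/seteqP; split=> v.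
  by rewrite /solutions/= -!/(crd _) mul_mx_row => -[-> ->].
by rewrite /solutions/= -!/(crd _) mul_mx_row => /eq_row_mx[-> ->].
Qed.

Definition GrX p q : set (borel_flat V * borel_flat V) := Gr p `*` Gr q.

(** In terms of equations, two flats are transversal when their systems are
jointly independent. *)
Definition tdom p q : set (borel_flat V * borel_flat V) :=
  GrX p q `&` [set GH |
    \rank (row_mx (rep p GH.1).1 (rep q GH.2).1)%R = (p + q)%N].

Definition interf p q (GH : borel_flat V * borel_flat V) : borel_flat V :=
  mkflat (row_mx (rep p GH.1).1 (rep q GH.2).1, row_mx (rep p GH.1).2 (rep q GH.2).2)%R.

Lemma tintE p q (A : set (flat V)) : tint p q A = tdom p q `&` interf p q @^-1` A.
Proof.
apply/seteqP; split=> -[G H].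
  move=> [K AK /= [pG qH KK KE]]; rewrite (inter_solutions pG qH) in KE.
  have r := solutions_rank KE KK; split; first by split.
  rewrite /preimage/= (_ : interf _ _ _ = K)//.
  by apply: flat_eq; rewrite mkflatE.
move=> [[/= [pG qH] r] Af]; exists (interf p q (G, H)) => //=; split=> //.
  by apply: (solutions_Gr _ (mkflatE _)).
by rewrite mkflatE//= (inter_solutions pG qH).
Qed.

Lemma mx_measurable_pair1 p q :
  mx_measurable (GrX p q) (fun z => (rep p z.1).1) /\
  mx_measurable (GrX p q) (fun z => (rep p z.1).2) /\
  mx_measurable (GrX p q) (fun z => (rep q z.2).1) /\
  mx_measurable (GrX p q) (fun z => (rep q z.2).2).
Proof.
have mf : measurable_fun (GrX p q) (@fst (borel_flat V) (borel_flat V)).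
  by apply: measurable_funTS; exact: measurable_fst.
have ms : measurable_fun (GrX p q) (@snd (borel_flat V) (borel_flat V)).
  by apply: measurable_funTS; exact: measurable_snd.
have mGp := @measurable_Gr _ V p; have mGq := @measurable_Gr _ V q.
split; [|split; [|split]] => i j.
- apply: (@measurable_comp _ _ _ (borel_flat V * borel_flat V)%type (borel_flat V) _ (Gr p)
    (fun H => (rep p H).1 i j) (GrX p q) fst) => //.
    by move=> _ [z [Dz _] <-].
  exact: measurable_rep1.
- apply: (@measurable_comp _ _ _ (borel_flat V * borel_flat V)%type (borel_flat V) _ (Gr p)
    (fun H => (rep p H).2 i j) (GrX p q) fst) => //.
    by move=> _ [z [Dz _] <-].
  exact: measurable_rep2.
- apply: (@measurable_comp _ _ _ (borel_flat V * borel_flat V)%type (borel_flat V) _ (Gr q)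
    (fun H => (rep q H).1 i j) (GrX p q) snd) => //.
    by move=> _ [z [_ Dz] <-].
  exact: measurable_rep1.
- apply: (@measurable_comp _ _ _ (borel_flat V * borel_flat V)%type (borel_flat V) _ (Gr q)
    (fun H => (rep q H).2 i j) (GrX p q) snd) => //.
    by move=> _ [z [_ Dz] <-].
  exact: measurable_rep2.
Qed.

Lemma measurable_GrX p q : measurable (GrX p q).
Proof. by apply: measurableX; exact: measurable_Gr. Qed.

Lemma measurable_tdom p q : measurable (tdom p q).
Proof.
have [m1 [_ [m2 _]]] := mx_measurable_pair1 p q.
by apply: measurable_full_rank; [exact: measurable_GrX|exact: mx_measurable_row].
Qed.

Lemma measurable_interf p q : measurable_fun (tdom p q) (interf p q).
Proof.
have [m1 [c1 [m2 c2]]] := mx_measurable_pair1 p q.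
have mG := @measurable_GrX p q.
have sub : tdom p q `<=` GrX p q by move=> z [].
apply: (@measurable_flat R V _ _ (tdom p q) (p + q) (interf p q)
  (fun z => row_mx (rep p z.1).1 (rep q z.2).1)%R (fun z => row_mx (rep p z.1).2 (rep q z.2).2)%R).
- exact: measurable_tdom.
- by move=> i j; apply: measurable_funS (mx_measurable_row m1 m2 i j).
- by move=> i j; apply: measurable_funS (mx_measurable_row c1 c2 i j).
- by move=> z [_ r]; rewrite mkflatE.
Qed.

Lemma measurable_tint p q (A : set (borel_flat V)) : measurable A -> measurable (tint p q A).
Proof. by move=> mA; rewrite tintE; apply: measurable_interf => //; exact: measurable_tdom. Qed.

Lemma tint_shift p q (A : set (flat V)) v G H :
  tint p q (shiftf v @^-1` A) (G, H) <-> tint p q A (shiftf v G, shiftf v H).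
Proof.
split=> -[K AK /= [pG qH KK KE]].
  exists (shiftf v K) => //; split; try exact/shiftf_Gr.
  apply/seteqP; split=> x.
    by move=> /shiftf_points; rewrite KE => -[Gx Hx]; split; apply/shiftf_points.
  by move=> [/shiftf_points Gx /shiftf_points Hx]; apply/shiftf_points; rewrite KE.
exists (shiftf (- v)%R K); first by rewrite /preimage/= shiftfNK.
split => /=; [exact/(shiftf_Gr v)|exact/(shiftf_Gr v)|exact/shiftf_Gr|].
apply/seteqP; split=> x.
  move=> /shiftf_points; rewrite KE opprK => -[/shiftf_points + /shiftf_points].
  by rewrite addrK.
move=> [Gx Hx]; apply/shiftf_points; rewrite opprK KE.
by split; apply/shiftf_points; rewrite addrK.
Qed.

(** The product is the image of the product measure under the intersection map,
restricted to transversal pairs. Invariance under translations holds because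
both flats can be translated simultaneously, and finiteness because both flats
meet every set that their intersection meets. *)
Lemma mprod_exists p q mu nu : normal_measure p mu -> normal_measure q nu ->
  exists rho, normal_measure (p + q) rho /\
    forall A : set (borel_flat V), measurable A -> rho A = (mu \x nu) (tint p q A).
Proof.
move=> nmu nnu; have snu := normal_sigma_finite nnu.
pose m : {measure set (borel_flat V * borel_flat V) -> \bar R} :=
  mu \x (sfin_measure snu).
pose rho := restricted_push (measurable_tdom p q) (@measurable_interf p q) m.
have rhoE A : rho A = (mu \x nu) (tint p q A).
  by rewrite /rho restricted_pushE tintE.
exists rho; split; last by move=> A _.
apply: normal_intro.
- rewrite rhoE (_ : tint _ _ _ = set0) ?(measure0 m)// -subset0 => GH.
  by move=> [K nK [_ _ KK _]].
- move=> v A mA; rewrite !rhoE !product_measureE.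
  have mf := measurable_fun_section1 snu (measurable_tint p q mA).
  rewrite -(integral_map (measurable_shiftf v) _ mf)//; last first.
    by move=> B mB; exact: normal_shift nmu mB.
  apply: eq_integral => G _.
  have mS := measurable_section1 (shiftf v G) (measurable_tint p q mA).
  rewrite -(normal_shift v nnu mS); congr (nu _).
  by apply/seteqP; split=> H h; exact/(tint_shift p q A v G H).
- move=> N; rewrite rhoE.
  set B := hits _; have cB := @cube_compact R n (- N%:R) N%:R.
  apply: (@le_lt_trans _ _ (m ((Gr p `&` B) `*` (Gr q `&` B)))).
    apply: (le_measure m); rewrite ?inE.
    + by apply: measurable_tint; exact: measurable_Gr_hits.
    + by apply: measurableX; exact: measurable_Gr_hits.
    + move=> -[G H] [K [_ [x xB Kx]] /= [pG qH _ KE]].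
      have [Gx Hx] : (points G `&` points H) (uncrd x) by rewrite -KE.
      by split; split=> //; exists x.
  rewrite [X in X < _](_ : _ = mu (Gr p `&` B) * nu (Gr q `&` B)); last first.
    by apply: (product_measure1E mu (sfin_measure snu)); exact: measurable_Gr_hits.
  by apply: lte_mul_pinfty; rewrite ?measure_ge0 ?ge0_fin_numE//; exact: normal_hits_fin.
Qed.

Definition is_mprod p q mu nu rho : Prop := normal_measure (p + q) rho /\
  forall A : set (borel_flat V), measurable A -> rho A = (mu \x nu) (tint p q A).

(** Totalised by an arbitrary value outside normal measures. *)
Definition mprod p q mu nu : flat_measure V :=
  if pselect (exists rho, is_mprod p q mu nu rho) is left h
  then projT1 (cid h) else mu.

Lemma mprodP p q mu nu : normal_measure p mu -> normal_measure q nu ->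
  is_mprod p q mu nu (mprod p q mu nu).
Proof.
move=> nmu nnu; rewrite /mprod; case: pselect => [h|nh].
  exact: projT2 (cid h).
by case: nh; exact: mprod_exists.
Qed.

Lemma bounded_Gr_hits k (K : set 'rV[R]_n) : compact K -> bounded_flats (Gr k `&` hits K).
Proof. by move=> cK; have [C cC KC] := hits_bounded k cK; exists C. Qed.

Lemma measure_product_tint p q (A : set (flat V)) : A `<=` Gr (p + q) ->
  [set GH : borel_flat V * borel_flat V | exists2 K : flat V,
         A K & [/\ Gr p GH.1, Gr q GH.2 & points K = points GH.1 `&` points GH.2]] =
  tint p q A.
Proof.
move=> AG; apply/seteqP; split=> GH [K AK].
  by move=> [? ? ?]; exists K => //; split=> //; exact: AG.
by move=> [? ? _ ?]; exists K.
Qed.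

Lemma mprod_measure_product p q mu nu : normal_measure p mu -> normal_measure q nu ->
  measure_product p q mu nu (mprod p q mu nu).
Proof.
move=> nmu nnu D mD DG _; rewrite (measure_product_tint DG).
exact: (mprodP nmu nnu).2.
Qed.

Lemma chi_measure_product p q mu nu rho (xi : 'I_(p + q) -> V) :
  normal_measure p mu -> normal_measure q nu ->
  measure_product p q mu nu rho -> chi rho xi = chi (mprod p q mu nu) xi.
Proof.
move=> nmu nnu hrho; rewrite /chi; congr fine; rewrite hitE crd_parallelotope.
have cK : compact (plate 0%R (crd_mx xi) (cube 0 1)).
  by apply: plate_compact; exact: cube_compact.
have mK := measurable_Gr_hits (p + q) cK.
have sG : Gr (p + q) `&` hits (plate 0%R (crd_mx xi) (cube 0 1)) `<=` Gr (p + q).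
  by move=> H [].
rewrite (hrho _ mK sG (bounded_Gr_hits _ cK)).
by rewrite (mprod_measure_product nmu nnu mK sG (bounded_Gr_hits _ cK)).
Qed.

End ProductMeasure.

(** * Ring laws for products of normal measures *)

Section IntegralRestrictedPush.
Context d1 d2 (T1 : measurableType d1) (T2 : measurableType d2) (R : realType).
Local Open Scope ereal_scope.

Lemma integral_mrestr (m : {measure set T1 -> \bar R}) (D : set T1)
    (mD : measurable D) (h : T1 -> \bar R) :
  measurable_fun setT h -> (forall t, 0 <= h t) ->
  \int[mrestr m mD]_t h t = \int[m]_(t in D) h t.
Proof.
move=> mh h0.
rewrite -(setUv D) ge0_integral_setU//; [|exact: measurableC| |]; last 2 first.
- by rewrite setUv.
- by rewrite disj_set2E setICr.
rewrite [X in X + _](_ : _ = \int[m]_(t in D) h t); last first.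
  by apply: eq_measure_integral => A mA AD; rewrite /= /mrestr setIidl.
rewrite [X in _ + X](_ : _ = \int[mzero]_(t in ~` D) h t); last first.
  apply: eq_measure_integral => A mA AD; rewrite /= /mrestr /mzero/=.
  by rewrite (_ : A `&` D = set0) ?measure0// -subset0 => x [/AD].
by rewrite integral_measure_zero adde0.
Qed.

Lemma integral_restricted_push (D : set T1) (mD : measurable D) (f : T1 -> T2)
    (mf : measurable_fun D f) (m : {measure set T1 -> \bar R}) (h : T2 -> \bar R) :
  measurable_fun setT h -> (forall t, 0 <= h t) ->
  \int[restricted_push mD mf m]_t h t = \int[m]_(t in D) h (f t).
Proof.
move=> mh h0; rewrite /restricted_push.
rewrite (ge0_integral_pushforward (measurable_total_ext mD mf))//= preimage_setT.
rewrite integral_mrestr//.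
  by apply: eq_integral => t tD; rewrite /= /total_ext tD.
exact: (measurableT_comp mh (measurable_total_ext mD mf)).
Qed.

End IntegralRestrictedPush.

Section IncidenceCodim.
Context {R : realType} {V : vectType R}.
Local Notation n := (\dim {:V}).
Implicit Types (G H K : flat V).

Lemma inter_flat p q G H v : Gr p G -> Gr q H -> points G v -> points H v ->
  exists K l, [/\ points K = points G `&` points H, Gr l K & (l <= p + q)%N].
Proof.
move=> pG qH Gv Hv; have GHE := inter_solutions pG qH.
have [|K KE KG] := @solutions_flat _ V _ (row_mx (rep p G).1 (rep q H).1, row_mx (rep p G).2 (rep q H).2).
  by exists v; rewrite -GHE.
by exists K; eexists; split; [rewrite GHE|exact: KG|exact: rank_leq_col].
Qed.

(** The equations of both flats put together are equations of the intersection,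
of rank at most the sum of the codimensions. This bound is what makes
transversality associative: a triple intersection of full codimension forces the
partial ones to have full codimension. *)
Lemma inter_codim p q l G H K : Gr p G -> Gr q H -> Gr l K ->
  points K = points G `&` points H -> (l <= p + q)%N.
Proof.
move=> pG qH lK KE; rewrite (inter_solutions pG qH) in KE.
by rewrite -(solutions_rank KE lK) rank_leq_col.
Qed.

End IncidenceCodim.

Section ProductLaws.
Context {R : realType} {V : vectType R}.
Local Notation n := (\dim {:V}).
Implicit Types (mu nu rho kappa : flat_measure V) (G H K : flat V).
Local Open Scope ereal_scope.

Definition eq_measures mu nu : Prop :=
  forall A : set (borel_flat V), measurable A -> mu A = nu A.

Lemma chi_eq mu nu m (xi : 'I_m -> V) : eq_measures mu nu -> chi mu xi = chi nu xi.
Proof.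
move=> h; rewrite /chi hitE crd_parallelotope h//.
by apply: measurable_Gr_hits; apply: plate_compact; exact: cube_compact.
Qed.

Lemma mprodC p q mu nu : normal_measure p mu -> normal_measure q nu ->
  eq_measures (mprod p q mu nu) (mprod q p nu mu).
Proof.
move=> nmu nnu A mA; rewrite (mprodP nmu nnu).2// (mprodP nnu nmu).2//.
rewrite (product_measure_swap (normal_sigma_finite nmu) (normal_sigma_finite nnu)); last first.
  exact: measurable_tint.
congr ((nu \x mu) _); apply/seteqP; split=> -[H G] [K AK /= [pG qH KK KE]];
  by exists K => //; split; rewrite //= 1?addnC 1?setIC.
Qed.

(** Tonelli's theorem for the image of the product measure under the
intersection map. *)
Lemma integral_mprod p q mu nu (h : flat V -> \bar R) :
  normal_measure p mu -> normal_measure q nu ->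
  measurable_fun setT (h : borel_flat V -> \bar R) -> (forall K, 0 <= h K) ->
  \int[mprod p q mu nu]_K h K =
  \int[mu]_G \int[nu]_H ((fun z => h (interf p q z)) \_ (tdom p q)) (G, H).
Proof.
move=> nmu nnu mh h0.
have smu := normal_sigma_finite nmu; have snu := normal_sigma_finite nnu.
pose m : {measure set (borel_flat V * borel_flat V) -> \bar R} :=
  (sfin_measure smu) \x (sfin_measure snu).
transitivity (\int[restricted_push (measurable_tdom p q) (@measurable_interf _ _ p q) m]_K h K).
  apply: eq_measure_integral => A mA _; rewrite (mprodP nmu nnu).2//.
  by rewrite [RHS]restricted_pushE tintE.
rewrite integral_restricted_push// integral_mkcond.
rewrite fubini_tonelli1//; last first.
  by move=> z; apply: erestrict_ge0.
apply/(measurable_restrictT _ _).1 => //; first exact: measurable_tdom.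
exact: (measurable_comp measurableT _ mh (@measurable_interf _ _ p q)).
Qed.

(** Both ways of bracketing a triple product are compared with this symmetric
condition. *)
Definition triple p q r (A : set (flat V)) G H K : Prop :=
  exists2 M, A M & [/\ Gr p G, Gr q H, Gr r K, Gr (p + q + r) M &
    points M = points G `&` points H `&` points K].

Lemma triple_tint p q r A G H K : triple p q r A G H K <->
  tdom p q (G, H) /\ tint (p + q) r A (interf p q (G, H), K).
Proof.
split.
  move=> [M AM [pG qH rK MM ME]].
  have [v Mv] := flat_nonempty M.
  have [[Gv Hv] Kv] : ((points G `&` points H) `&` points K) v by rewrite -ME.
  have [J [l [JE lJ lpq]]] := inter_flat pG qH Gv Hv.
  have lE : l = (p + q)%N.
    apply/eqP; rewrite eqn_leq lpq/= -(leq_add2r r).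
    by apply: (inter_codim lJ rK MM); rewrite JE.
  subst l.
  have [td ifJ] : tdom p q (G, H) /\ interf p q (G, H) = J.
    have : tint p q [set J] (G, H) by exists J.
    by rewrite tintE.
  by split=> //; rewrite ifJ; exists M => //; split => //=; rewrite JE.
move=> [td [M AM /= [GI rK MM ME]]].
have : tint p q [set interf p q (G, H)] (G, H) by rewrite tintE.
move=> [J JE0 /= [pG qH JJ JE]]; rewrite JE0 in JE.
by exists M => //; split=> //; rewrite ME JE.
Qed.

Lemma triple_tint_right p q r (A : set (flat V)) G H K :
  triple p q r A G H K <->
  tint q r [set J | tint p (q + r) A (G, J)] (H, K).
Proof.
split.
  move=> [M AM [pG qH rK MM ME]].
  have [v Mv] := flat_nonempty M.
  have [[Gv Hv] Kv] : ((points G `&` points H) `&` points K) v by rewrite -ME.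
  have [J [l [JE lJ lqr]]] := inter_flat qH rK Hv Kv.
  have lE : l = (q + r)%N.
    apply/eqP; rewrite eqn_leq lqr/= -(leq_add2l p) addnA.
    by apply: (inter_codim pG lJ MM); rewrite JE setIA.
  subst l; exists J => //; exists M => //.
  by split=> //=; [rewrite addnA|rewrite JE setIA].
move=> [J [M AM /= [pG JJ MM ME]] [qH rK _ JE]].
by exists M => //; split=> //; [rewrite -addnA|rewrite ME JE setIA].
Qed.

(** By Tonelli both sides are triple integrals of the indicator of [triple]. *)
Lemma mprodA p q r mu nu kappa :
  normal_measure p mu -> normal_measure q nu -> normal_measure r kappa ->
  eq_measures (mprod (p + q) r (mprod p q mu nu) kappa)
              (mprod p (q + r) mu (mprod q r nu kappa)).
Proof.
move=> nmu nnu nka A mA.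
have [npq pqE] := mprodP nmu nnu; have [nqr qrE] := mprodP nnu nka.
have ska := normal_sigma_finite nka.
rewrite (mprodP npq nka).2// (mprodP nmu nqr).2// !product_measureE.
rewrite (@integral_mprod p q mu nu (fun J => kappa [set K | tint (p + q) r A (J, K)]))//; last first.
  by apply: measurable_fun_section1 => //; exact: measurable_tint.
apply: eq_integral => G _.
have mS : measurable ([set J : borel_flat V | tint p (q + r) A (G, J)]).
  by apply: measurable_section1; exact: measurable_tint.
rewrite qrE// product_measureE; apply: eq_integral => H _.
rewrite patchE; case: ifPn => [|].
  rewrite inE => td; congr (kappa _); apply/seteqP; split=> K.
    by move=> h; apply/triple_tint_right/triple_tint.
  by move=> /triple_tint_right/triple_tint[].
rewrite notin_setE => ntd.
rewrite [X in kappa X](_ : _ = set0) ?measure0// -subset0 => K.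
by move=> /triple_tint_right/triple_tint[].
Qed.

(** The distinguished flat [point] is the whole space, which meets every flat in
that flat. *)
Definition unit_measure : flat_measure V :=
  @dirac _ (borel_flat V) (point : flat V) R.

Lemma whole_Gr : Gr 0 (point : flat V).
Proof.
exists 0%R, fullv; split; last by rewrite addn0.
by apply/seteqP; split=> v // _; rewrite /coset_of_dir/= memvf.
Qed.

Lemma shiftf_whole v : shiftf v (point : flat V) = point.
Proof. by apply: flat_eq; apply/seteqP; split=> x // _; apply/shiftf_points. Qed.

Lemma unit_measure_normal : normal_measure 0 unit_measure.
Proof.
apply: normal_intro.
- by rewrite /unit_measure/= diracE memNset//; apply; exact: whole_Gr.
- move=> v A mA; rewrite /unit_measure/= !diracE; congr (_%:R%:E); congr nat_of_bool.
  by apply/idP/idP; rewrite !inE /preimage/= shiftf_whole.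
- by move=> N; rewrite /unit_measure/= diracE; case: (_ \in _); rewrite ltry.
Qed.

Lemma mprod1 q nu : normal_measure q nu -> eq_measures (mprod 0 q unit_measure nu) nu.
Proof.
move=> nnu A mA; have [h0 _ _] := nnu.
rewrite (mprodP unit_measure_normal nnu).2// product_measureE.
rewrite integral_dirac//; last first.
  apply: measurable_fun_section1; first exact: normal_sigma_finite nnu.
  exact: measurable_tint.
rewrite diracE in_setT mul1e -(measure_Gr h0 mA); congr (nu _).
apply/seteqP; split=> H.
  move=> [K AK /= [_ qH _ KE]]; rewrite setTI in KE.
  have E : K = H by exact: flat_eq.
  by subst K; split.
move=> [HG AH]; exists H => //; split=> //=; [exact: whole_Gr|by rewrite setTI].
Qed.

End ProductLaws.

(** * Pull-back of a product of measures *)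

Section PullProduct.
Context {R : realType} {U V : vectType R} (L : 'Hom(U, V)).
Implicit Types (mu nu : flat_measure V).
Local Open Scope ereal_scope.

Lemma pull_flat k H u : Gr k H -> points H (L u) ->
  exists (G : flat U) l, [/\ pulls L H G, Gr l G & (l <= k)%N].
Proof.
move=> HG Hu; have E := pulls_solutions L (repP HG).2.
have [|G GE GG] := @solutions_flat _ U _ (mxL L *m (rep k H).1, (rep k H).2)%R.
  by exists u; rewrite -E.
by exists G; eexists; split; [rewrite /pulls E|exact: GG|exact: rank_leq_col].
Qed.

(** Taking preimages commutes with intersections. Neither operation yields more
than the expected codimension, so the expected codimension at the end forces it
at every stage. *)
Lemma tint_pull p q (A : set (flat U)) G H :
  tint p q (pulldom L (p + q) `&` pullf L @^-1` A) (G, H) <->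
  [/\ pulldom L p G, pulldom L q H & tint p q A (pullf L G, pullf L H)].
Proof.
split.
  move=> [K [KD AK] /= [pG qH KK KE]].
  have [KpG _] := pullfP KD.
  have [u Ku] := flat_nonempty (pullf L K).
  have /(pullf_points _ KD) := Ku; rewrite KE => -[Gu Hu].
  have [G' [l [GG' lG' lp]]] := pull_flat pG Gu.
  have [H' [l' [HH' lH' lq]]] := pull_flat qH Hu.
  have KE' : points (pullf L K) = points G' `&` points H'.
    rewrite GG' HH' -preimage_setI -KE; apply/seteqP.
    by split=> x h; [exact: (pullf_points x KD).1 h|exact: (pullf_points x KD).2 h].
  have lll := inter_codim lG' lH' KpG KE'.
  have lE : l = p by lia.
  have lE' : l' = q by lia.
  subst l l'.
  have [GD GE] := pulldomP pG lG' GG'.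
  have [HD HE] := pulldomP qH lH' HH'.
  by split=> //; exists (pullf L K) => //; split; rewrite ?GE ?HE.
move=> [GD HD [K' AK' /= [_ _ KK' KE']]].
have [u Ku] := flat_nonempty K'.
have [Gu Hu] : (points (pullf L G) `&` points (pullf L H)) u by rewrite -KE'.
have [K [l [KE lK lpq]]] := inter_flat GD.1 HD.1 ((pullf_points _ GD).1 Gu)
   ((pullf_points _ HD).1 Hu).
have Ku' : points K (L u).
  by rewrite KE; split; [exact/(pullf_points _ GD)|exact/(pullf_points _ HD)].
have KK'E : pulls L K K'.
  rewrite /pulls KE' KE preimage_setI; congr (_ `&` _); apply/seteqP; split=> x.
  - exact: (pullf_points x GD).1.
  - exact: (pullf_points x GD).2.
  - exact: (pullf_points x HD).1.
  - exact: (pullf_points x HD).2.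
have [K'' [l'' [KK'' lK'' ll]]] := pull_flat lK Ku'.
have K''E : K'' = K' by apply: flat_eq; rewrite KK'' KK'E.
subst K''; have lE := Gr_uniq lK'' KK'.
have l_eq : l = (p + q)%N by lia.
subst l; have [KD KfE] := pulldomP lK KK' KK'E.
exists K; first by split=> //; rewrite /preimage/= KfE.
by split=> //; [exact: GD.1|exact: HD.1].
Qed.

(** Both sides measure the pairs of flats whose intersection has a preimage in a
given set, by [tint_pull]. *)
Lemma mpull_mprod p q mu nu : normal_measure p mu -> normal_measure q nu ->
  eq_measures (mpull L (p + q) (mprod p q mu nu))
              (mprod p q (mpull L p mu) (mpull L q nu)).
Proof.
move=> nmu nnu A mA.
have nmu' := mpull_normal L nmu; have nnu' := mpull_normal L nnu.
rewrite mpullE (mprodP nmu nnu).2; last exact: measurable_pull_preimage.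
rewrite (mprodP nmu' nnu').2// !product_measureE.
rewrite [RHS]integral_restricted_push//; last first.
  by apply: measurable_fun_section1; [exact: normal_sigma_finite nnu'|exact: measurable_tint].
rewrite [RHS]integral_mkcond; apply: eq_integral => G _; rewrite patchE.
case: ifPn => [|].
  rewrite inE => GD; rewrite mpullE; congr (nu _).
  by apply/seteqP; split=> H; [move=> /tint_pull[]|move=> [? ?]; apply/tint_pull].
rewrite notin_setE => nGD.
rewrite [X in nu X](_ : _ = set0) ?measure0// -subset0 => H.
by move=> /tint_pull[].
Qed.

End PullProduct.

(** * Products of measures with equal densities *)

Lemma kernel_basis (F : fieldType) a b q (N : 'M[F]_(a, b)) : \rank (kermx N) = q ->
  exists B : 'M[F]_(q, a), [/\ row_free B, B *m N = 0 &
    forall t : 'rV[F]_a, t *m N = 0 -> exists s, t = s *m B].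
Proof.
move=> <-; exists (row_base (kermx N)); split; first exact: row_base_free.
  by apply/sub_kermxP; rewrite eq_row_base.
by move=> t /sub_kermxP; rewrite -(eq_row_base (kermx N)) => /submxP.
Qed.

Section Uniqueness.
Context {R : realType} {V : vectType R}.
Local Notation n := (\dim {:V}).
Implicit Types (mu nu : flat_measure V) (G H K : flat V).
Local Open Scope ereal_scope.

(** Removing the degenerate flats, which are null, makes the sections studied
below exactly describable. *)
Definition hits_transversally k (x : 'rV[R]_n) (E : 'M[R]_(k, n)) (C : set 'rV[R]_k) :
  set (flat V) := (Gr k `&` hits (plate x E C)) `\` (Gr k `&` degenerate E).

Lemma measurable_hits_transversally k (x : 'rV[R]_n) (E : 'M[R]_(k, n)) (C : set 'rV[R]_k) :
  compact C -> measurable (hits_transversally x E C : set (borel_flat V)).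
Proof.
move=> cC; apply: measurableD; last exact: measurable_degenerate.
by apply: measurable_Gr_hits; exact: plate_compact.
Qed.

Lemma hits_transversallyE k mu (x : 'rV[R]_n) (E : 'M[R]_(k, n)) (C : set 'rV[R]_k) :
  normal_measure k mu -> compact C ->
  mu (hits_transversally x E C) = mu (Gr k `&` hits (plate x E C)).
Proof.
move=> nmu cC.
have mG := measurable_Gr_hits k (plate_compact (x := x) (E := E) cC).
have mh := measurable_hits (plate_compact (x := x) (E := E) cC).
apply: (@measure_sandwich _ _ mu _ _
  (Gr k `&` (degenerate E `&` hits (plate x E C)))) => //.
- exact: measurable_hits_transversally.
- by rewrite setIA; apply: measurableI => //; exact: measurable_degenerate.
- by move=> H [].
- move=> H [HG Hh]; have [d|d] := pselect (degenerate E H); [by right|left].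
  by split=> // -[].
- exact: nontransversal_null.
Qed.

(** Two systems of independent equations of the same flat differ by an
invertible matrix. *)
Lemma degenerateE k (E : 'M[R]_(k, n)) K (p : 'M[R]_(n, k) * 'rV[R]_k) :
  Gr k K -> points K = solutions p ->
  degenerate E K <-> \det (E *m p.1)%R = 0%R.
Proof.
move=> KG KE; have rp := solutions_rank KE KG; have [rr rE] := repP KG.
have pr : solutions p = solutions (rep k K) by rewrite -KE.
have [e1 _] : (rep k K).1 = (p.1 *m (pinvmx p.1 *m (rep k K).1))%R /\ True.
  by split=> //; rewrite {1}(solutions_uniq rp pr).
have [e2 _] : p.1 = ((rep k K).1 *m (pinvmx (rep k K).1 *m p.1))%R /\ True.
  by split=> //; rewrite {1}(solutions_uniq rr (esym pr)).
rewrite /degenerate/=; split=> h; first by rewrite e2 mulmxA det_mulmx h mul0r.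
by rewrite e1 mulmxA det_mulmx h mul0r.
Qed.

(** When [G] is transversal to the span of [E], the intersection of [G] with the
parallelotope is a plate of dimension [q], and [H] meets it iff the intersection
of [G] and [H] meets the parallelotope. *)
Lemma section_plate p q (E : 'M[R]_(p + q, n)) G : Gr p G ->
  \rank (E *m (rep p G).1)%R = p ->
  exists (x : 'rV[R]_n) (e : 'I_q -> V) (C : set 'rV[R]_q), compact C /\
   forall H, tint p q (hits_transversally 0%R E (cube 0 1)) (G, H) <->
             hits_transversally x (crd_mx e) C H.
Proof.
move=> pG rN; set A := (rep p G).1 in rN; set c := (rep p G).2.
pose N := (E *m A)%R.
have [B [fB BN kerN]] : exists B : 'M[R]_(q, p + q), [/\ row_free B, B *m N = 0 &
    forall t : 'rV[R]_(p + q), t *m N = 0 -> exists s, t = s *m B]%R.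
  by apply: kernel_basis; rewrite mxrank_ker -/N rN addKn.
have pN : (pinvmx N *m N = 1%:M)%R by apply: mulVpmx; rewrite /row_full rN.
have pB : (B *m pinvmx B = 1%:M)%R by exact: mulmxVp.
pose t0 := (c *m pinvmx N)%R.
have t0N : (t0 *m N = c)%R by rewrite -mulmxA pN mulmx1.
pose C : set 'rV[R]_q := [set s | cube 0 1 (t0 + s *m B)%R].
pose e (i : 'I_q) : V := uncrd (row i (B *m E)%R).
have eE : crd_mx e = (B *m E)%R.
  by apply/matrixP => i j; rewrite mxE uncrdK [LHS]mxE.
exists (t0 *m E)%R, e, C; split.
  rewrite (_ : C = [set (t - t0) *m pinvmx B | t in
     cube 0 1 `&` [set t | t *m N = c]]%R); last first.
    apply/seteqP; split=> [s Cs|_ [t [t01 tN] <-]].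
      exists (t0 + s *m B)%R; last by rewrite addrC addKr -mulmxA pB mulmx1.
      by split=> //=; rewrite mulmxDl t0N -mulmxA BN mulmx0 addr0.
    have [|s sE] := kerN (t - t0)%R.
      by rewrite mulmxBl t0N tN subrr.
    by rewrite sE -mulmxA pB mulmx1 /C/= -sE subrKC.
  apply: continuous_compact.
    apply: continuous_subspaceT => t.
    apply: (cvg_mulmx (nbhs_filter t)); last exact: cvg_cst.
    by apply: (@cvgB _ _ _ (nbhs t)); [exact: cvg_id|exact: cvg_cst].
  apply: compact_closedI; first exact: cube_compact.
  rewrite (_ : [set _ | _] = (fun t => t *m N)%R @^-1` [set c])//.
  apply: preimage_closed => [t _|]; first exact: mulmxr_continuous.
  exact/accessible_closed_set1/hausdorff_accessible/norm_hausdorff.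
(* transversality of G and H inside the span of E *)
have detE H : (\det (E *m row_mx A (rep q H).1) == 0)%R =
              (\det (crd_mx e *m (rep q H).1) == 0)%R.
  rewrite eE mul_mx_row; apply/det0P/det0P => -[v v0].
    rewrite mul_mx_row -[0%R]row_mx0 => /eq_row_mx[vN vH].
    have [s sE] := kerN _ vN; exists s.
      by apply: contraNneq v0 => s0; rewrite sE s0 mul0mx.
    transitivity ((s *m B) *m (E *m (rep q H).1))%R; first by rewrite !mulmxA.
    by rewrite -sE.
  move=> vB; exists (v *m B)%R.
    apply: contraNneq v0 => vB0.
    by rewrite -[v]mulmx1 -pB mulmxA vB0 mul0mx.
  have -> : (v *m B *m row_mx (E *m A) (E *m (rep q H).1) =
      row_mx (v *m (B *m N)) (v *m (B *m E *m (rep q H).1)))%R.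
    by rewrite mul_mx_row !mulmxA.
  by rewrite BN mulmx0 vB row_mx0.
have pointE t : (t *m N = c)%R -> pset G (t *m E)%R.
  by move=> tN; apply/(rep_psetE _ pG); rewrite -mulmxA.
move=> H; split.
  move=> [K [[KG [_ [t t01 <-] Kt]] nd] /= [_ qH _ KE]].
  have KE' := KE; rewrite (inter_solutions pG qH) in KE'.
  have [Gt Ht] : (points G `&` points H) (uncrd (0 + t *m E)%R) by rewrite -KE.
  have tN : (t *m N = c)%R.
    by have := (rep_psetE (0 + t *m E)%R pG).1 Gt; rewrite add0r -mulmxA.
  split.
    split=> //; have [|s sE] := kerN (t - t0)%R.
      by rewrite mulmxBl t0N tN subrr.
    exists (t0 *m E + s *m crd_mx e)%R.
      by exists s => //; rewrite /C/= -sE subrKC.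
    rewrite eE mulmxA -mulmxDl -sE subrKC.
    by rewrite /pset/= -[(t *m E)%R]add0r.
  move=> [_ d]; apply: nd; split=> //; apply/(degenerateE _ KG KE') => /=.
  by apply/eqP; rewrite detE; apply/eqP.
move=> [[qH [_ [s Cs <-] Hs]] nd].
have d : (\det (E *m row_mx A (rep q H).1) != 0)%R.
  by rewrite detE; apply/eqP => d; apply: nd.
have td : tdom p q (G, H).
  split=> //=; apply/eqP; rewrite eqn_leq rank_leq_col/=.
  have u : (E *m row_mx A (rep q H).1)%R \in unitmx by rewrite unitmxE unitfE.
  by rewrite -[leqLHS](mxrank_unit u) mxrankM_maxr.
have : tint p q [set interf p q (G, H)] (G, H) by rewrite tintE.
move=> [K KE0 /= [_ _ KG KE]].
have KE' := KE; rewrite (inter_solutions pG qH) in KE'.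
exists K; last by split.
split.
  split=> //; pose t := (t0 + s *m B)%R; exists (0 + t *m E)%R; first by exists t.
  rewrite /pset/= KE; split.
    rewrite add0r; apply: pointE.
    by rewrite /t mulmxDl t0N -mulmxA BN mulmx0 addr0.
  by move: Hs; rewrite eE /pset/= /t add0r mulmxDl mulmxA.
move=> [_ /(degenerateE _ KG KE') /= d0]; move: d.
by rewrite d0 eqxx.
Qed.

(** For fixed [G] the flats [H] in question are those meeting a fixed
[q]-dimensional plate, up to a null set, so their measure is a value of the
density of [nu] times the volume of the shape of that plate. Neither the plate
nor its volume depends on [nu], which is what makes the product of densities
well defined. *)
Lemma section_value p q (E : 'M[R]_(p + q, n)) G :
  exists (c : R) (e : 'I_q -> V), (0 <= c)%R /\ forall nu, normal_measure q nu ->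
    nu [set H | tint p q (hits_transversally 0%R E (cube 0 1)) (G, H)] =
    (c * chi nu e)%:E.
Proof.
have [[pG rN]|ng] := pselect (Gr p G /\ \rank (E *m (rep p G).1)%R = p).
  have [x [e [C [cC h]]]] := section_plate pG rN.
  have lC : leb q C \is a fin_num.
    have [N [_ hN]] := compact_bounded cC.
    pose r := (`|N| + 1)%R.
    have Cr : C `<=` cube (- r) r.
      move=> s Cs i; rewrite -ler_norml; apply: le_trans (hN r _ s Cs).
        rewrite [leRHS]/Num.Def.normr/= mx_normrE; exact: (le_bigmax _ _ (ord0, i)).
      by rewrite /r; apply: (le_lt_trans (ler_norm N)); rewrite ltrDl.
    rewrite ge0_fin_numE//; apply: (@le_lt_trans _ _ (leb q (cube (- r) r))).
      apply: le_measure; rewrite ?inE//; last exact: measurable_cube.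
      by apply: closed_borel; apply: compact_closed => //; exact: norm_hausdorff.
    have r0 : (0 <= r)%R by rewrite addr_ge0.
    by rewrite leb_cube ?ltry// (@le_trans _ _ 0%R)// oppr_le0.
  exists (fine (leb q C)), e; split; first by rewrite fine_ge0.
  move=> nu nnu.
  rewrite [X in nu X](_ : _ = hits_transversally x (crd_mx e) C); last first.
    by apply/seteqP; split=> H; [exact: (h H).1|exact: (h H).2].
  by rewrite hits_transversallyE// hits_plate// EFinM (fineK lC).
exists 0%R, (fun=> 0%R); split=> // nu nnu; rewrite mul0r.
rewrite [X in nu X](_ : _ = set0) ?measure0// -subset0 => H.
move=> [K [[KG _] nd] /= [pG qH _ KE]]; apply: ng; split=> //.
rewrite (inter_solutions pG qH) in KE.
have d : (\det (E *m row_mx (rep p G).1 (rep q H).1) != 0)%R.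
  by apply/eqP => d; apply: nd; split=> //; apply/(degenerateE _ KG KE).
have u : (E *m row_mx (rep p G).1 (rep q H).1)%R \in unitmx by rewrite unitmxE unitfE.
set M := (E *m row_mx _ _)%R in u.
have M1 : (usubmx (invmx M) *m (E *m (rep p G).1) = 1%:M)%R.
  have ME : M = row_mx (E *m (rep p G).1)%R (E *m (rep q H).1)%R by rewrite /M mul_mx_row.
  have := congr1 (fun W => lsubmx (usubmx W)) (mulVmx u).
  rewrite -[X in (X *m _)%R]vsubmxK [X in (_ *m X)%R]ME mul_col_row.
  by rewrite /block_mx col_mxKu row_mxKl scalar_mx_block /block_mx col_mxKu row_mxKl.
apply/eqP; rewrite eqn_leq rank_leq_col/=.
by rewrite -[leqLHS](mxrank1 R p) -M1 mxrankM_maxr.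
Qed.

End Uniqueness.

Section UniquenessOfProducts.
Context {R : realType} {V : vectType R}.
Local Notation n := (\dim {:V}).
Implicit Types (mu nu : flat_measure V) (G H K : flat V).

(** The contribution of a fixed left factor [G] to the product. *)
Definition section_mass p q (xi : 'I_(p + q) -> V) nu (G : borel_flat V) : R :=
  fine (nu [set H : borel_flat V |
    tint p q (hits_transversally 0 (crd_mx xi) (cube 0 1)) (G, H)]).

Lemma section_massE p q (xi : 'I_(p + q) -> V) G :
  exists (c : R) (e : 'I_q -> V), 0 <= c /\ forall nu, normal_measure q nu ->
    section_mass xi nu G = c * chi nu e.
Proof.
have [c [e [c0 h]]] := @section_value R V p q (crd_mx xi) G.
by exists c, e; split=> // nu nnu; rewrite /section_mass h.
Qed.

Lemma section_mass_EFin p q (xi : 'I_(p + q) -> V) nu G : normal_measure q nu ->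
  (section_mass xi nu G)%:E = nu [set H : borel_flat V |
    tint p q (hits_transversally 0 (crd_mx xi) (cube 0 1)) (G, H)].
Proof.
have [c [e [c0 h]]] := @section_value R V p q (crd_mx xi) G.
by move=> nnu; rewrite /section_mass h.
Qed.

Lemma measurable_transversal k (xi : 'I_k -> V) :
  measurable (hits_transversally 0 (crd_mx xi) (cube 0 1) : set (borel_flat V)).
Proof. by apply: measurable_hits_transversally; exact: cube_compact. Qed.

Lemma integral_section_mass p q (xi : 'I_(p + q) -> V) mu nu :
  normal_measure p mu -> normal_measure q nu ->
  (\int[mu]_G (section_mass xi nu G)%:E)%E = mprod p q mu nu (Gr (p + q) `&` hit (parallelotope xi)).
Proof.
move=> nmu nnu.
have [nrho rhoE] := mprodP nmu nnu.
rewrite hitE crd_parallelotope -(hits_transversallyE _ _ nrho (@cube_compact _ _ 0 1)).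
rewrite rhoE; last exact: measurable_transversal.
by rewrite product_measureE; apply: eq_integral => G _; rewrite section_mass_EFin.
Qed.

Lemma chi_mprod_section p q (xi : 'I_(p + q) -> V) mu nu :
  normal_measure p mu -> normal_measure q nu ->
  chi (mprod p q mu nu) xi = \int[mu]_G section_mass xi nu G.
Proof. by move=> nmu nnu; rewrite /chi -(integral_section_mass _ nmu nnu). Qed.

Lemma section_mass_integrable p q (xi : 'I_(p + q) -> V) mu nu :
  normal_measure p mu -> normal_measure q nu ->
  mu.-integrable setT (EFin \o section_mass xi nu).
Proof.
move=> nmu nnu; apply/integrableP; split.
  rewrite (_ : _ \o _ = (fun G : borel_flat V => nu [set H : borel_flat V |
    tint p q (hits_transversally 0 (crd_mx xi) (cube 0 1)) (G, H)])).
    apply: measurable_fun_section1; first exact: normal_sigma_finite nnu.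
    by apply: measurable_tint; exact: measurable_transversal.
  by apply/funext => G /=; rewrite section_mass_EFin.
under eq_integral => G _.
  rewrite /= ger0_norm; last by rewrite /section_mass fine_ge0.
  over.
rewrite integral_section_mass// hitE; apply: normal_hits_fin (mprodP nmu nnu).1 _.
by rewrite crd_parallelotope; apply: plate_compact; exact: cube_compact.
Qed.

Lemma Rintegral_lincomb (mu : flat_measure V) (I : finType) (c : I -> R)
    (f : I -> borel_flat V -> R) :
  (forall i, mu.-integrable setT (EFin \o f i)) ->
  \sum_i c i * \int[mu]_G f i G = \int[mu]_G (\sum_i c i * f i G).
Proof.
move=> fi.
suff h (s : seq I) : mu.-integrable setT (EFin \o (fun G => \sum_(i <- s) c i * f i G)) /\
  \int[mu]_G (\sum_(i <- s) c i * f i G) = \sum_(i <- s) c i * \int[mu]_G f i G.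
  by rewrite (h _).2.
elim: s => [|i s [IH1 IH2]].
  split; last by under eq_Rintegral do rewrite big_nil; rewrite big_nil Rintegral_cst// mul0r.
  by under eq_fun do rewrite big_nil; exact: integrable0.
have cfi : mu.-integrable setT (EFin \o (fun G => c i * f i G)).
  by have := integrableZl measurableT (c i) (fi i); apply: eq_integrable.
have E : (fun G => \sum_(j <- i :: s) c j * f j G) =
         (fun G => c i * f i G + \sum_(j <- s) c j * f j G).
  by apply/funext => G; rewrite big_cons.
rewrite E; split.
  have := integrableD measurableT cfi IH1.
  by apply: eq_integrable => // G _ /=; rewrite EFinD.
by rewrite RintegralD// big_cons IH2 RintegralZl.
Qed.

(** The section masses of all the measures on the right are the same multiples
of values of their densities, at arguments depending on the left flat only. *)
Lemma mprod_uniq_right p q mu (J J' : finType) (d : J -> R) (d' : J' -> R)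
    (nu : J -> flat_measure V) (nu' : J' -> flat_measure V) :
  normal_measure p mu -> (forall j, normal_measure q (nu j)) ->
  (forall j, normal_measure q (nu' j)) ->
  (forall e : 'I_q -> V, \sum_j d j * chi (nu j) e = \sum_j d' j * chi (nu' j) e) ->
  forall xi : 'I_(p + q) -> V,
    \sum_j d j * chi (mprod p q mu (nu j)) xi = \sum_j d' j * chi (mprod p q mu (nu' j)) xi.
Proof.
move=> nmu nnu nnu' dd xi.
under eq_bigr do rewrite chi_mprod_section//.
under [RHS]eq_bigr do rewrite chi_mprod_section//.
rewrite !Rintegral_lincomb; try by move=> j; exact: section_mass_integrable.
apply: eq_Rintegral => G _; have [c [e [_ h]]] := @section_massE p q xi G.
under eq_bigr do rewrite h// mulrCA.
under [RHS]eq_bigr do rewrite h// mulrCA.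
by rewrite -!big_distrr/= dd.
Qed.

End UniquenessOfProducts.

(** * Products of normal densities *)

Arguments nprod {R V p q} m a b.

Section Represents.
Context {R : realType} {V : vectType R}.
Local Notation n := (\dim {:V}).

Lemma is_kdensityD k (a b : kdens k V) : is_kdensity a -> is_kdensity b ->
  is_kdensity (fun w => a w + b w).
Proof.
move=> [ca ha] [cb hb]; split=> [w|t w w' h]; last by rewrite (ha t w w')// (hb t w w')// mulrDr.
by apply: (@cvgD _ _ _ (nbhs w) (nbhs_filter w)); [exact: ca|exact: cb].
Qed.

Lemma is_kdensityZ k (c : R) (a : kdens k V) : is_kdensity a ->
  is_kdensity (fun w => c * a w).
Proof.
move=> [ca ha]; split=> [w|t w w' h]; last by rewrite (ha t w w')// mulrCA.
by apply: (@cvgM _ _ (nbhs w) (nbhs_filter w)); [exact: cvg_cst|exact: ca].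
Qed.

Lemma is_kdensity0 k : is_kdensity ((fun=> 0) : kdens k V).
Proof. by split=> [|t w w' _]; [exact: cst_continuous|rewrite mulr0]. Qed.

Lemma is_kdensity_sum k (I : Type) (s : seq I) (a : I -> kdens k V) :
  (forall i, is_kdensity (a i)) -> is_kdensity (fun w => \sum_(i <- s) a i w).
Proof.
move=> h; elim: s => [|i s IH].
  by under eq_fun do rewrite big_nil; exact: is_kdensity0.
by under eq_fun do rewrite big_cons; exact: is_kdensityD.
Qed.

(** By homogeneity a density is determined on the wedges. *)
Lemma kdens_ext k (a b : kdens k V) : is_kdensity a -> is_kdensity b ->
  (forall xi, a (wedge xi) = b (wedge xi)) -> a = b.
Proof.
move=> [_ ha] [_ hb] ab; apply/funext => w.
have [t [xi wE]] := set_mem (valP w).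
by rewrite (ha t (wedge xi) w)// (hb t (wedge xi) w)// ab.
Qed.

(** Representations are indexed by an arbitrary finite type, which spares
renumbering sums, products and pairs. *)
Definition represents k (I : finType) (c : I -> R) (mu : I -> flat_measure V)
    (a : kdens k V) : Prop :=
  [/\ is_kdensity a, forall i, normal_measure k (mu i) &
    forall xi, a (wedge xi) = \sum_i c i * chi (mu i) xi].

Lemma represents_enum k (I : finType) (c : I -> R) mu (a : kdens k V) :
  represents c mu a ->
  normal_comb (fun i : 'I_#|I| => c (enum_val i)) (fun i => mu (enum_val i)) a.
Proof.
move=> [ka nmu aE]; split=> // xi; rewrite aE.
rewrite (reindex (@enum_val I I)); last exact: onW_bij (enum_val_bij I).
by [].
Qed.

Lemma represents_normal k (I : finType) (c : I -> R) mu (a : kdens k V) :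
  represents c mu a -> normal_kdens a.
Proof. by move=> /represents_enum h; do 3 eexists; exact: h. Qed.

Lemma normal_represents k (a : kdens k V) : normal_kdens a ->
  exists (I : finType) (c : I -> R) (mu : I -> flat_measure V), represents c mu a.
Proof. by move=> [N [c [mu h]]]; exists 'I_N, c, mu. Qed.

Lemma represents0 k : represents (fun _ : void => 0 : R) (fun=> unit_measure) ((fun=> 0) : kdens k V).
Proof. by split=> // [|xi]; [exact: is_kdensity0|rewrite big_pred0// => -[]]. Qed.

Lemma representsD k (I J : finType) (c : I -> R) (d : J -> R) mu nu (a b : kdens k V) :
  represents c mu a -> represents d nu b ->
  represents (fun x : I + J => match x with inl i => c i | inr j => d j end)
    (fun x => match x with inl i => mu i | inr j => nu j end) (fun w => a w + b w).
Proof.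
move=> [ka na aE] [kb nb bE]; split=> [|[]//|xi]; first exact: is_kdensityD.
by rewrite aE bE big_sumType.
Qed.

Lemma representsZ k (I : finType) (c : I -> R) mu (a : kdens k V) t :
  represents c mu a -> represents (fun i => t * c i) mu (fun w => t * a w).
Proof.
move=> [ka na aE]; split=> // [|xi]; first exact: is_kdensityZ.
by rewrite aE big_distrr/=; apply: eq_bigr => i _; rewrite mulrA.
Qed.

Lemma chi_cast k l (e : l = k) mu (xi : 'I_k -> V) :
  chi mu (fun i : 'I_l => xi (cast_ord e i)) = chi mu xi.
Proof. by case: _ / e xi => xi; congr chi; apply/funext => i; rewrite cast_ord_id. Qed.

(** By commutativity this follows from [mprod_uniq_right]. *)
Lemma mprod_uniq_left p q nu (I I' : finType) (c : I -> R) (c' : I' -> R)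
    (mu : I -> flat_measure V) (mu' : I' -> flat_measure V) :
  normal_measure q nu -> (forall i, normal_measure p (mu i)) ->
  (forall i, normal_measure p (mu' i)) ->
  (forall e : 'I_p -> V, \sum_i c i * chi (mu i) e = \sum_i c' i * chi (mu' i) e) ->
  forall xi : 'I_(p + q) -> V,
    \sum_i c i * chi (mprod p q (mu i) nu) xi = \sum_i c' i * chi (mprod p q (mu' i) nu) xi.
Proof.
move=> nnu nmu nmu' cc xi.
pose xi' : 'I_(q + p) -> V := fun i => xi (cast_ord (addnC q p) i).
have E mu0 : normal_measure p mu0 ->
    chi (mprod p q mu0 nu) xi = chi (mprod q p nu mu0) xi'.
  move=> nmu0; rewrite (chi_eq xi (mprodC nmu0 nnu)).
  by rewrite chi_cast.
under eq_bigr do rewrite E//.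
under [RHS]eq_bigr do rewrite E//.
exact: mprod_uniq_right.
Qed.

(** The product is defined by choosing a product density for some
representations of the factors. Changing the representations one factor at a
time does not change the values, by [mprod_uniq_right] and [mprod_uniq_left]. *)
Lemma nprodP p q m (I J : finType) (c : I -> R) (d : J -> R) mu nu
    (a : kdens p V) (b : kdens q V) : m = (p + q)%N ->
  represents c mu a -> represents d nu b ->
  represents (fun ij : I * J => c ij.1 * d ij.2)
    (fun ij => mprod p q (mu ij.1) (nu ij.2)) (nprod m a b).
Proof.
move=> ->{m} ra rb; have [ka na aE] := ra; have [kb nb bE] := rb.
have : exists ab : kdens (p + q) V, is_product a b ab.
  pose c' i := c (@enum_val I I i); pose mu' i := mu (@enum_val I I i).
  pose d' j := d (@enum_val J J j); pose nu' j := nu (@enum_val J J j).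
  exists (fun w => \sum_i \sum_j c' i * d' j * density_of (mprod p q (mu' i) (nu' j)) w).
  exists #|I|, #|J|, c', mu', d', nu', (fun i j => mprod p q (mu' i) (nu' j)).
  split; [exact: represents_enum|exact: represents_enum| | |].
  - apply: is_kdensity_sum => i; apply: is_kdensity_sum => j; apply: is_kdensityZ.
    by apply: density_of_kdensity; exact: (mprodP (na _) (nb _)).1.
  - move=> i j; split; first exact: (mprodP (na _) (nb _)).1.
    by apply: mprod_measure_product; [exact: na|exact: nb].
  - move=> xi; apply: eq_bigr => i _; apply: eq_bigr => j _.
    by rewrite chi_density_of//; exact: (mprodP (na _) (nb _)).1.
move=> /(xgetPex ((fun=> 0) : kdens (p + q) V)).
rewrite -/(nprod (p + q) a b).
move=> [N [M [c' [mu' [d' [nu' [rho [[_ na' aE'] [_ nb' bE'] kab hrho abE]]]]]]]].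
split=> [//|[i j]|xi]; first exact: (mprodP (na _) (nb _)).1.
rewrite abE.
transitivity (\sum_i c' i * \sum_j d' j * chi (mprod p q (mu' i) (nu' j)) xi).
  apply: eq_bigr => i _; rewrite big_distrr/=; apply: eq_bigr => j _.
  rewrite (chi_measure_product (rho := rho i j) _ (na' i) (nb' j)) ?mulrA//.
  exact: (hrho i j).2.
transitivity (\sum_i c' i * \sum_j d j * chi (mprod p q (mu' i) (nu j)) xi).
  apply: eq_bigr => i _; congr (_ * _); apply: mprod_uniq_right => // e.
  by rewrite -bE -bE'.
transitivity (\sum_j d j * \sum_i c' i * chi (mprod p q (mu' i) (nu j)) xi).
  under eq_bigr do rewrite big_distrr/=; rewrite exchange_big/=; apply: eq_bigr => j _.
  by rewrite big_distrr/=; apply: eq_bigr => i _; rewrite mulrCA.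
transitivity (\sum_j d j * \sum_i c i * chi (mprod p q (mu i) (nu j)) xi).
  apply: eq_bigr => j _; congr (_ * _); apply: mprod_uniq_left => // e.
  by rewrite -aE -aE'.
rewrite -(pair_bigA _ (fun i j => c i * d j * chi (mprod p q (mu i) (nu j)) xi))/=.
rewrite [RHS]exchange_big/=; apply: eq_bigr => j _.
by rewrite big_distrr/=; apply: eq_bigr => i _; rewrite mulrA [d j * _]mulrC.
Qed.

Lemma nprod_normal p q m (a : kdens p V) (b : kdens q V) : m = (p + q)%N ->
  normal_kdens a -> normal_kdens b -> normal_kdens (nprod m a b).
Proof.
move=> mE /normal_represents[I [c [mu ra]]] /normal_represents[J [d [nu rb]]].
exact: represents_normal (nprodP mE ra rb).
Qed.

Lemma normal_is_kdensity k (a : kdens k V) : normal_kdens a -> is_kdensity a.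
Proof. by move=> [N [c [mu []]]]. Qed.

Lemma normal0 k : normal_kdens ((fun=> 0) : kdens k V).
Proof. exact: represents_normal (@represents0 k). Qed.

Lemma normalD k (a b : kdens k V) : normal_kdens a -> normal_kdens b ->
  normal_kdens (fun w => a w + b w).
Proof.
move=> /normal_represents[I [c [mu ra]]] /normal_represents[J [d [nu rb]]].
exact: represents_normal (representsD ra rb).
Qed.

Lemma normalZ k (a : kdens k V) t : normal_kdens a -> normal_kdens (fun w => t * a w).
Proof.
by move=> /normal_represents[I [c [mu ra]]]; exact: represents_normal (representsZ t ra).
Qed.

Lemma nprodC p q m (a : kdens p V) (b : kdens q V) : m = (p + q)%N ->
  normal_kdens a -> normal_kdens b -> nprod m a b = nprod m b a.
Proof.
move=> mE /normal_represents[I [c [mu ra]]] /normal_represents[J [d [nu rb]]].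
have mE' : m = (q + p)%N by rewrite mE addnC.
have [k1 _ E1] := nprodP mE ra rb; have [k2 _ E2] := nprodP mE' rb ra.
apply: kdens_ext => // xi; rewrite E1 E2.
rewrite -(pair_bigA _ (fun i j => c i * d j * chi (mprod p q (mu i) (nu j)) xi))/=.
rewrite -(pair_bigA _ (fun j i => d j * c i * chi (mprod q p (nu j) (mu i)) xi))/=.
rewrite exchange_big/=; apply: eq_bigr => j _; apply: eq_bigr => i _.
have [_ nmu _] := ra; have [_ nnu _] := rb.
by rewrite [c i * _]mulrC (chi_eq xi (mprodC (nmu i) (nnu j))).
Qed.

Lemma nprodA p q r s t m (a : kdens p V) (b : kdens q V) (c : kdens r V) :
  s = (p + q)%N -> t = (q + r)%N -> m = (s + r)%N ->
  normal_kdens a -> normal_kdens b -> normal_kdens c ->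
  nprod m a (nprod t b c) = nprod m (nprod s a b) c.
Proof.
move=> sE tE mE /normal_represents[I [ca [mu ra]]] /normal_represents[J [cb [nu rb]]].
move=> /normal_represents[K [cc [ka rc]]].
have mE' : m = (p + t)%N by rewrite mE tE sE addnA.
have [k1 _ E1] := nprodP mE' ra (nprodP tE rb rc).
have [k2 _ E2] := nprodP mE (nprodP sE ra rb) rc.
have [_ nmu _] := ra; have [_ nnu _] := rb; have [_ nka _] := rc.
apply: kdens_ext => // xi; rewrite E1 E2.
rewrite (reindex (fun x : I * J * K => (x.1.1, (x.1.2, x.2)))) /=; last first.
  by exists (fun x : I * (J * K) => ((x.1, x.2.1), x.2.2));
    [move=> -[[? ?] ?]|move=> -[? [? ?]]].
apply: eq_bigr => -[[i j] l] _ /=; rewrite mulrA; congr (_ * _).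
subst s t; apply/esym; apply: chi_eq; exact: mprodA.
Qed.

Lemma nprodDl p q m (a b : kdens p V) (c : kdens q V) : m = (p + q)%N ->
  normal_kdens a -> normal_kdens b -> normal_kdens c ->
  nprod m (fun w => a w + b w) c = (fun w => nprod m a c w + nprod m b c w).
Proof.
move=> mE /normal_represents[I [ca [mu ra]]] /normal_represents[J [cb [nu rb]]].
move=> /normal_represents[K [cc [ka rc]]].
have [k1 _ E1] := nprodP mE (representsD ra rb) rc.
have [k2 _ E2] := representsD (nprodP mE ra rc) (nprodP mE rb rc).
apply: kdens_ext => // xi; rewrite E1 E2 big_sumType/=.
rewrite -(pair_bigA _ (fun x k => match x with inl i => ca i | inr j => cb j end * cc k *
  chi (mprod p q match x with inl i => mu i | inr j => nu j end (ka k)) xi))/= big_sumType/=.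
by rewrite !pair_bigA.
Qed.

Lemma nprod0l p q m (b : kdens q V) : m = (p + q)%N -> normal_kdens b ->
  nprod m ((fun=> 0) : kdens p V) b = (fun=> 0).
Proof.
move=> mE /normal_represents[J [cb [nu rb]]].
have [k1 _ E1] := nprodP mE (@represents0 p) rb.
apply: kdens_ext => // [|xi]; first exact: is_kdensity0.
by rewrite E1 big_pred0// => -[[]].
Qed.

Lemma nprod0r p q m (a : kdens p V) : m = (p + q)%N -> normal_kdens a ->
  nprod m a ((fun=> 0) : kdens q V) = (fun=> 0).
Proof.
move=> mE na; rewrite nprodC//; last exact: normal0.
by rewrite nprod0l// mE addnC.
Qed.

(** Every parallelotope of dimension 0 is a point, which the whole space meets.
*)
Lemma represents1 : represents (fun _ : unit => 1 : R) (fun=> unit_measure) (@gdens1 R V 0).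
Proof.
have ptE (g g' : 'I_0 -> dual V) : g = g' by apply/funext => -[].
split=> [|//|xi]; last first.
- rewrite big_const card_unit /= addr0 mul1r /gdens1 eqxx /= /wedge_fun det_mx00 normr1.
  rewrite /chi (_ : unit_measure _ = 1%E :> \bar R)//.
  transitivity ((\1_(Gr 0 `&` hit (parallelotope xi)) (point : flat V) : R)%:E); first by [].
  rewrite indicE mem_set//; split; first exact: whole_Gr.
  exists 0; split=> //; exists (fun=> 0); last by rewrite big_ord0.
  by case.
- by move=> _; exact: unit_measure_normal.
- split=> [w|t w w' h]; rewrite /gdens1 eqxx; last by rewrite h normrM.
  by apply: (@cvg_norm _ _ _ (nbhs w) (nbhs_filter w)); exact: cone_eval_continuous.
Qed.

Lemma nprod1l q (b : kdens q V) : normal_kdens b -> nprod q (@gdens1 R V 0) b = b.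
Proof.
move=> /normal_represents[J [cb [nu rb]]].
have [k1 _ E1] := nprodP (esym (add0n q)) represents1 rb.
have [kb nnu bE] := rb; apply: kdens_ext => // xi; rewrite E1 bE.
rewrite -(pair_bigA _ (fun i j => 1 * cb j * chi (mprod 0 q unit_measure (nu j)) xi))/=.
rewrite big_const card_unit /= addr0; apply: eq_bigr => j _.
by rewrite mul1r (chi_eq xi (mprod1 (nnu j))).
Qed.

End Represents.

(** * Pull-back of normal densities by linear maps *)

Section PullRepresents.
Context {R : realType} {U V : vectType R} (L : 'Hom(U, V)).

(** The cone carries the topology of pointwise convergence. *)
Lemma cone_cvg (T : Type) (F : set_system T) (FF : Filter F) k
    (g : T -> cone k V) (w : cone k V) :
  (forall f, val (g t) f @[t --> F] --> val w f) -> g @ F --> w.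
Proof.
move=> h; have hv : (fun t => val (g t) : kform_fun k V) @ F --> (val w : kform_fun k V).
  apply/cvg_sup => f N [B [[W oW <-] Ww WN]].
  apply: (@filterS _ F FF _ _ (fun t Wt => WN _ Wt)).
  by apply: (h f); exact: open_nbhs_nbhs.
move=> A [B [[W oW <-] Ww WA]].
apply: (@filterS _ F FF _ _ (fun t Wt => WA _ Wt)).
by apply: hv; exact: open_nbhs_nbhs.
Qed.

Lemma cone_map_continuous k : continuous (cone_map L : cone k U -> cone k V).
Proof.
by move=> w; apply: (cone_cvg (nbhs_filter w)) => f;
  exact: (@cone_eval_continuous R U k (fun j => (f j \o L)%VF) w).
Qed.

Lemma pull_kdensity k (a : kdens k V) : is_kdensity a -> is_kdensity (pull L a).
Proof.
move=> [ca ha]; split=> [w|t w w' h].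
  by apply: (@continuous_comp _ _ _ (cone_map L) a); [exact: cone_map_continuous|exact: ca].
by rewrite /pull; apply: ha => f /=; exact: h.
Qed.

(** By [chi_mpull] it suffices to pull back the measures. *)
Lemma pull_represents k (I : finType) (c : I -> R) (mu : I -> flat_measure V) (a : kdens k V) :
  represents c mu a -> represents c (fun i => mpull L k (mu i)) (pull L a).
Proof.
move=> [ka nmu aE]; split=> [|i|xi]; first exact: pull_kdensity.
  exact: mpull_normal.
rewrite /pull cone_map_wedge aE; apply: eq_bigr => i _.
by rewrite chi_mpull.
Qed.

Lemma pull_normal k (a : kdens k V) : normal_kdens a -> normal_kdens (pull L a).
Proof.
by move=> /normal_represents[I [c [mu ra]]]; exact: represents_normal (pull_represents ra).
Qed.

(** This reduces to measures, where it is [mpull_mprod]. *)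
Lemma pull_nprod p q m (a : kdens p V) (b : kdens q V) : m = (p + q)%N ->
  normal_kdens a -> normal_kdens b ->
  pull L (nprod m a b) = nprod m (pull L a) (pull L b).
Proof.
move=> mE /normal_represents[I [c [mu ra]]] /normal_represents[J [d [nu rb]]].
have [k1 _ E1] := pull_represents (nprodP mE ra rb).
have [k2 _ E2] := nprodP mE (pull_represents ra) (pull_represents rb).
apply: kdens_ext => // xi; rewrite E1 E2; apply: eq_bigr => -[i j] _ /=.
have [_ nmu _] := ra; have [_ nnu _] := rb.
by congr (_ * _); apply: chi_eq; subst m; exact: mpull_mprod.
Qed.

End PullRepresents.

(** * The graded ring of normal densities of a vector space *)

Section GradedProduct.
Context {R : realType} {V : vectType R}.
Implicit Types a b c : gdens V.

Lemma normal_sum k (I : Type) (s : seq I) (d : I -> kdens k V) :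
  (forall i, normal_kdens (d i)) -> normal_kdens (fun w => \sum_(i <- s) d i w).
Proof.
move=> nd; elim: s => [|i s IH].
  by under eq_fun do rewrite big_nil; exact: normal0.
by under eq_fun do rewrite big_cons; exact: normalD.
Qed.

Lemma nprod_suml p q m (I : Type) (s : seq I) (d : I -> kdens p V) (b : kdens q V) :
  m = (p + q)%N -> (forall i, normal_kdens (d i)) -> normal_kdens b ->
  nprod m (fun w => \sum_(i <- s) d i w) b = (fun w => \sum_(i <- s) nprod m (d i) b w).
Proof.
move=> mE nd nb; elim: s => [|i s IH].
  under eq_fun do rewrite big_nil; under [RHS]eq_fun do rewrite big_nil.
  exact: nprod0l.
under eq_fun do rewrite big_cons; under [RHS]eq_fun do rewrite big_cons.
by rewrite nprodDl// ?IH//; exact: normal_sum.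
Qed.

Lemma nprod_sumr p q m (I : Type) (s : seq I) (a : kdens p V) (d : I -> kdens q V) :
  m = (p + q)%N -> normal_kdens a -> (forall i, normal_kdens (d i)) ->
  nprod m a (fun w => \sum_(i <- s) d i w) = (fun w => \sum_(i <- s) nprod m a (d i) w).
Proof.
move=> mE na nd; have mE' : m = (q + p)%N by rewrite addnC.
rewrite nprodC//; last exact: normal_sum.
rewrite (nprod_suml _ mE')//; apply/funext => w; apply: eq_bigr => i _.
by rewrite [in RHS]nprodC.
Qed.

(** Summing over the degree of the second factor instead of the first; this is
the form that matches in associativity. *)
Lemma gdens_mul_rev a b m w :
  gdens_mul a b w = \sum_(k < m.+1) nprod m (a (m - k)%N) (b k) w.
Proof.
rewrite /gdens_mul (reindex_inj rev_ord_inj)/=; apply: eq_bigr => k _.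
by rewrite subSS subKn// -ltnS.
Qed.

Lemma gdens_mul_normal a b : normal_gdens a -> normal_gdens b ->
  normal_gdens (gdens_mul a b).
Proof.
move=> na nb m; apply: normal_sum => p.
by apply: nprod_normal => //; rewrite subnKC// -ltnS.
Qed.

Lemma gdens_mulC a b : normal_gdens a -> normal_gdens b -> gdens_mul a b = gdens_mul b a.
Proof.
move=> na nb; apply/functional_extensionality_dep => m; apply/funext => w.
rewrite gdens_mul_rev; apply: eq_bigr => k _.
by rewrite nprodC// subnK// -ltnS.
Qed.

(** Both sides are reorganised as one sum over the degrees of the outer two
factors. *)
Lemma gdens_mulA a b c : normal_gdens a -> normal_gdens b -> normal_gdens c ->
  gdens_mul a (gdens_mul b c) = gdens_mul (gdens_mul a b) c.
Proof.
move=> na nb nc; apply/functional_extensionality_dep => m; apply/funext => w.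
pose term j k := nprod m (a j) (nprod (m - j) (b (m - j - k)%N) (c k)) w.
transitivity (\sum_(j < m.+1) \sum_(k < m.+1 | (k <= m - j)%N) term j k).
  apply: eq_bigr => j _; have jm : (j <= m)%N by rewrite -ltnS.
  rewrite (_ : gdens_mul b c (k := (m - j)%N) = fun w' =>
    \sum_(k < (m - j).+1) nprod (m - j) (b (m - j - k)%N) (c k) w'); last first.
    by apply/funext => w'; rewrite gdens_mul_rev.
  rewrite nprod_sumr ?subnKC// => [|k]; last first.
    by apply: nprod_normal => //; rewrite subnK// -ltnS.
  by rewrite (big_ord_narrow_leq (leq_subr _ _)).
rewrite (exchange_big_dep predT)//= gdens_mul_rev; apply: eq_bigr => k _.
have km : (k <= m)%N by rewrite -ltnS.
transitivity (\sum_(j < m.+1 | (j <= m - k)%N) term j k).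
  apply: eq_bigl => j; have jm : (j <= m)%N by rewrite -ltnS.
  by apply/idP/idP; lia.
rewrite (big_ord_narrow_leq (leq_subr _ _)).
rewrite (nprod_suml _ (esym (subnK km)))// => [|j]; last first.
  by apply: nprod_normal => //; rewrite subnKC// -ltnS.
apply: eq_bigr => j _; rewrite /term/=; have jk : (j <= m - k)%N by rewrite -ltnS.
by rewrite (@nprodA _ _ _ _ _ (m - k)%N) 1?subnAC//; lia.
Qed.

Lemma gdens_mul1 b : normal_gdens b -> gdens_mul (@gdens1 R V) b = b.
Proof.
move=> nb; apply/functional_extensionality_dep => m; apply/funext => w.
rewrite /gdens_mul big_ord_recl/= subn0 nprod1l// big1 ?addr0// => p _.
by rewrite (_ : @gdens1 R V (bump 0 p) = fun=> 0)// nprod0l// subnKC.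
Qed.

Lemma gdens_mulD a b c : normal_gdens a -> normal_gdens b -> normal_gdens c ->
  gdens_mul (fun k w => a k w + b k w) c =
  (fun k w => gdens_mul a c w + gdens_mul b c w).
Proof.
move=> na nb nc; apply/functional_extensionality_dep => m; apply/funext => w.
rewrite /gdens_mul -big_split/=; apply: eq_bigr => p _.
by rewrite nprodDl// subnKC// -ltnS.
Qed.

Lemma gdens1_normal : normal_gdens (@gdens1 R V).
Proof.
case=> [|k]; first exact: represents_normal represents1.
exact: normal0.
Qed.

Lemma gdens_mul_homogeneous p q m a b (w : cone m V) : normal_gdens a -> normal_gdens b ->
  m != (p + q)%N ->
  gdens_mul (fun k w => if k == p then a k w else 0)
            (fun k w => if k == q then b k w else 0) w = 0.
Proof.
move=> na nb mpq; rewrite /gdens_mul big1// => i _.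
have im : (i <= m)%N by rewrite -ltnS.
have [ip|ip] := eqVneq (i : nat) p; last first.
  by rewrite nprod0l ?subnKC//; case: eqP => // _; exact: normal0.
have /negbTE -> : (m - i)%N != q by apply: contra mpq => /eqP <-; rewrite -ip subnKC.
by rewrite nprod0r ?subnKC.
Qed.

(** Above the dimension every determinant defining a decomposable vector has
dependent rows, so the cone is reduced to 0. *)
Lemma kdensity_over k (a : kdens k V) w : (\dim {:V} < k)%N -> is_kdensity a -> a w = 0.
Proof.
move=> nk [_ ha]; rewrite (ha 0 w w) ?normr0 ?mul0r// => f; rewrite mul0r.
have [t [xi ->]] := set_mem (valP w).
apply/eqP; rewrite mulf_eq0; apply/orP; right.
apply: contraLR nk => d0; rewrite -leqNgt.
have : row_free (\matrix_(i < k, j < k) (f j (xi i) : R)) by rewrite row_free_unit unitmxE unitfE.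
rewrite -row_leq_rank => /leq_trans; apply.
rewrite (_ : \matrix_(i, j) _ = crd_mx xi *m \matrix_(l, j) (f j (basisv l) : R)).
  exact: mulmx_max_rank.
apply/matrixP => i j; rewrite !mxE dual_expand.
by apply: eq_bigr => l _; rewrite !mxE.
Qed.

End GradedProduct.

(** The equations are inherited by a subset; only stability has to be checked
there. *)
Lemma graded_laws_sub (T : Type) (o : graded_ops T) (S S' : set T) :
  S' `<=` S -> comm_graded_laws o S -> S' (g0 o) -> S' (g1 o) ->
  (forall a b, S' a -> S' b -> S' (gadd o a b)) ->
  (forall a, S' a -> S' (gopp o a)) -> (forall k a, S' a -> S' (gpart o k a)) ->
  comm_graded_laws o S'.
Proof.
move=> sub [_ _ _ _ _ addA addC add0 addN mulA mulC mul1 mulD partD partK [n sumP] part1 partM].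
move=> s0 s1 sD sN sP; split=> //.
- by move=> a b c /sub ? /sub ? /sub ?; exact: addA.
- by move=> a b /sub ? /sub ?; exact: addC.
- by move=> a /sub ?; exact: add0.
- by move=> a /sub ?; exact: addN.
- by move=> a b c /sub ? /sub ? /sub ?; exact: mulA.
- by move=> a b /sub ? /sub ?; exact: mulC.
- by move=> a /sub ?; exact: mul1.
- by move=> a b c /sub ? /sub ? /sub ?; exact: mulD.
- by move=> k a b /sub ? /sub ?; exact: partD.
- by move=> j k a /sub ?; exact: partK.
- by exists n => a /sub ?; exact: sumP.
- by move=> p q a b /sub ? /sub ?; exact: partM.
Qed.

Section SectionsRing.
Context {R : realType} (X : manifold R).
Implicit Types a b c : mdens X.

Lemma mdens_ext a b : (forall x k w, a x k w = b x k w) -> a = b.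
Proof.
move=> ab; apply/functional_extensionality_dep => x.
by apply/functional_extensionality_dep => k; apply/funext => w.
Qed.

Lemma dim_tangent (x : X) : \dim {: tangent x} = mdim X.
Proof. by rewrite dimvf. Qed.

Lemma sections_add a b : normal_sections X a -> normal_sections X b ->
  normal_sections X (gadd (mdens_ops X) a b).
Proof. by move=> na nb x k; exact: (normalD (na x k) (nb x k)). Qed.

Lemma sections_opp a : normal_sections X a -> normal_sections X (gopp (mdens_ops X) a).
Proof.
move=> na x k /=; rewrite (_ : (fun w => _) = fun w => -1 * a x k w); first exact: (normalZ _ (na x k)).
by apply/funext => w; rewrite mulN1r.
Qed.

Lemma sections_part j a : normal_sections X a -> normal_sections X (gpart (mdens_ops X) j a).
Proof. by move=> na x k /=; case: eqP => _; [exact: na|exact: normal0]. Qed.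

Lemma sections_mul a b : normal_sections X a -> normal_sections X b ->
  normal_sections X (gmul (mdens_ops X) a b).
Proof. by move=> na nb x; exact: gdens_mul_normal. Qed.

Lemma mdens_sum n (f : 'I_n -> mdens X) x k w :
  (\big[gadd (mdens_ops X)/g0 (mdens_ops X)]_(i < n) f i) x k w = \sum_(i < n) f i x k w.
Proof. by apply: (big_morph (fun a : mdens X => a x k w)). Qed.

(** All laws hold pointwise. In the decomposition into homogeneous components
the sum may stop at the dimension of the manifold, beyond which densities
vanish. *)
Lemma sections_laws : comm_graded_laws (mdens_ops X) (normal_sections X).
Proof.
have ext := functional_extensionality_dep.
split.
- by move=> x k; exact: normal0.
- by move=> x; exact: gdens1_normal.
- exact: sections_add.
- exact: sections_opp.
- exact: sections_part.
- by move=> a b c _ _ _; apply: mdens_ext => x k w /=; rewrite addrA.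
- by move=> a b _ _; apply: mdens_ext => x k w /=; rewrite addrC.
- by move=> a _; apply: mdens_ext => x k w /=; rewrite add0r.
- by move=> a _; apply: mdens_ext => x k w /=; rewrite addNr.
- by move=> a b c na nb nc; apply: ext => x; exact: gdens_mulA.
- by move=> a b na nb; apply: ext => x; exact: gdens_mulC.
- by move=> a na; apply: ext => x; exact: gdens_mul1.
- by move=> a b c na nb nc; apply: ext => x; exact: gdens_mulD.
- by move=> k a b _ _; apply: mdens_ext => x l w /=; case: eqP; rewrite ?addr0.
- move=> j k a _; case: (eqVneq j k) => [<-|jk].
    by apply: mdens_ext => x l w /=; case: eqP.
  apply: mdens_ext => x l w /=; case: (eqVneq l j) => [lj|]//.
  have lk : (l == k) = false by rewrite lj (negbTE jk).
  by rewrite lk.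
- exists (mdim X).+1 => a na; apply: mdens_ext => x k w; rewrite mdens_sum/=.
  have [kn|kn] := ltnP k (mdim X).+1.
    rewrite (bigD1 (Ordinal kn))//= eqxx big1 ?addr0// => i ik.
    by rewrite ifN//; apply: contra ik => /eqP ki; apply/eqP/val_inj.
  rewrite (kdensity_over _ _ (normal_is_kdensity (na x k))) ?dim_tangent//.
  by rewrite big1// => i _; rewrite ifN// gtn_eqF// (leq_trans (ltn_ord i)).
- by apply: mdens_ext => x k w /=; rewrite /gdens1; case: eqP.
- move=> p q a b na nb; apply: mdens_ext => x m w /=.
  by case: ifPn => // mpq; rewrite gdens_mul_homogeneous.
Qed.

Lemma pull_gdens1 (U W : vectType R) (L : 'Hom(U, W)) k :
  pull L (@gdens1 R W k) = @gdens1 R U k.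
Proof.
apply/funext => w; rewrite /pull /gdens1; case: eqP => // k0; congr `|_|.
by rewrite /=; congr (val w _); apply/funext => j; case: j => j; rewrite k0.
Qed.

Lemma densities_laws : comm_graded_laws (mdens_ops X) (normal_densities X).
Proof.
apply: (graded_laws_sub _ sections_laws) => [a []//| | |a b|a|k a].
- split; first by move=> x k; exact: normal0.
  by move=> k phi _; apply: continuous_subspaceT; exact: cst_continuous.
- split; first by move=> x; exact: gdens1_normal.
  move=> k phi _; apply: continuous_subspaceT => p.
  rewrite /= (_ : (fun p => _) = fun p : X * cone k _ => gdens1 p.2).
    rewrite /gdens1; case: eqP => _; last exact: cst_continuous.
    apply: (@cvg_norm _ _ _ (nbhs p) (nbhs_filter p)).
    apply: (@continuous_comp _ _ _ snd (fun w : cone k _ => val w _)); first exact: cvg_snd.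
    exact: cone_eval_continuous.
  by apply/funext => p'; rewrite pull_gdens1.
- move=> [na ca] [nb cb]; split; first exact: sections_add.
  move=> k phi aphi p.
  by apply: (@cvgD _ _ _ _ _ _ _ _ _ (ca k phi aphi p) (cb k phi aphi p)).
- move=> [na ca]; split; first exact: sections_opp.
  move=> k phi aphi p.
  by apply: (@cvgN _ _ _ _ _ _ _ (ca k phi aphi p)).
- move=> [na ca]; split; first exact: sections_part.
  move=> l phi aphi; rewrite /=.
  case: eqP => _; first exact: ca.
  by apply: continuous_subspaceT; exact: cst_continuous.
Qed.

Lemma scale_normal_densities (f : X -> R) a : continuous f -> normal_densities X a ->
  normal_densities X (mdens_scale f a).
Proof.
move=> cf [na ca]; split; first by move=> x k; exact: (normalZ _ (na x k)).
move=> k phi aphi.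
have cf1 : {within cdom phi `*` setT, continuous
    (fun p : X * cone k 'rV[R]_(mdim X) => f p.1)}.
  apply: continuous_subspaceT => q.
  by apply: (@continuous_comp _ _ _ fst f); [exact: cvg_fst|exact: cf].
by move=> p; exact: (cvgM (cf1 p) (ca k phi aphi p)).
Qed.

End SectionsRing.

(** * Tangent maps *)

Section ConeMaps.
Context {R : realType}.

Lemma cone_map_comp (U V W : vectType R) (L : 'Hom(U, V)) (L' : 'Hom(V, W)) k (w : cone k U) :
  cone_map (L' \o L)%VF w = cone_map L' (cone_map L w).
Proof.
apply/val_inj/funext => f /=; congr (val w _); apply/funext => j.
exact: comp_lfunA.
Qed.

Lemma cone_map_id (U : vectType R) k (w : cone k U) : cone_map \1%VF w = w.
Proof.
apply/val_inj/funext => f /=; congr (val w _); apply/funext => j.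
exact: comp_lfun1r.
Qed.

(** A linear form on row vectors is a finite combination of coordinates. *)
Lemma cvg_dual (T : Type) (F : set_system T) (FF : Filter F) n
    (f : dual 'rV[R]_n) (g : T -> 'rV[R]_n) (v : 'rV[R]_n) :
  g @ F --> v -> (f (g t) : R) @[t --> F] --> (f v : R).
Proof.
move=> gv; have fE u : f u = \sum_i u 0 i * f (delta_mx 0 i).
  rewrite {1}[u]row_sum_delta linear_sum; apply: eq_bigr => i _.
  by rewrite linearZ.
rewrite fE; under eq_fun do rewrite fE.
apply: (cvg_sumr FF) => i; apply: (@cvgM _ _ F FF); last exact: cvg_cst.
exact: mx_cvg_entry.
Qed.

(** By multilinearity it is enough that the linear maps converge at each vector,
although the cone carries only the topology of pointwise convergence. *)
Lemma cvg_cone_map (T : Type) (F : set_system T) (FF : Filter F) m n k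
    (D : T -> 'Hom('rV[R]_m, 'rV[R]_n)) (D0 : 'Hom('rV[R]_m, 'rV[R]_n))
    (g : T -> cone k 'rV[R]_m) (w : cone k 'rV[R]_m) :
  (forall v, D t v @[t --> F] --> D0 v) -> g @ F --> w ->
  cone_map (D t) (g t) @[t --> F] --> cone_map D0 w.
Proof.
move=> DD gw; apply: (cone_cvg FF) => f /=.
rewrite cone_expand; under eq_fun do rewrite cone_expand.
apply: (cvg_sumr FF) => J; apply: (@cvgM _ _ F FF).
  apply: (cvg_prodr FF) => j; rewrite comp_lfunE.
  by under eq_fun do rewrite comp_lfunE; apply: (cvg_dual FF); exact: DD.
apply: (@cvg_comp _ _ _ g (fun w' : cone k _ => val w' _) _ _ _ gw).
exact: cone_eval_continuous.
Qed.

End ConeMaps.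

Section TangentMap.
Context {R : realType}.
Implicit Types X Y Z : manifold R.

Lemma coord_mapE X (x : X) phi (v : tangent x) : coord_map x phi v = tcoord v phi.
Proof. by rewrite lfunE. Qed.

Lemma coord_map_inj X (x : X) phi : chart_at x phi -> injective (coord_map x phi).
Proof.
move=> phix u v; rewrite !coord_mapE => uv.
exact: (bij_inj (eval_chart_bij phix)).
Qed.

Lemma coord_map_surj X (x : X) phi v : chart_at x phi ->
  exists u : tangent x, coord_map x phi u = v.
Proof.
move=> /eval_chart_bij[g _ gK]; exists (g v).
by rewrite coord_mapE; exact: gK.
Qed.

Lemma coord_mapK X (x : X) phi : chart_at x phi ->
  cancel (coord_map x phi) (coord_map x phi)^-1%VF.
Proof.
by move=> phix; apply: lker0_lfunK; apply/lker0P; exact: coord_map_inj.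
Qed.

Lemma coord_mapVK X (x : X) phi : chart_at x phi ->
  cancel (coord_map x phi)^-1%VF (coord_map x phi).
Proof.
move=> phix v; have [u <-] := coord_map_surj v phix.
by rewrite coord_mapK.
Qed.

Lemma coord_map_transition X (x : X) phi psi (v : tangent x) :
  chart_at x phi -> chart_at x psi ->
  coord_map x psi v = transition x phi psi (coord_map x phi v).
Proof.
by move=> phix psix; rewrite !coord_mapE; have /asboolP[_ h] := tcoordP v; exact: h.
Qed.

Definition local_form X Y (F : X -> Y) (phi : chart R X (mdim X)) (psi : chart R Y (mdim Y)) :=
  psi \o F \o cinv phi.

Lemma near_local X Y (F : X -> Y) x phi psi : C1_map F ->
  chart_at x phi -> chart_at (F x) psi ->
  \forall y \near phi x,
    [/\ (phi @` (cdom phi `&` F @^-1` cdom psi)) y, cdom phi (cinv phi y),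
        cdom psi (F (cinv phi y)) & phi (cinv phi y) = y].
Proof.
move=> [cF _] [aphi dphi] [apsi dpsi].
have domx : nbhs x (cdom phi `&` F @^-1` cdom psi).
  apply: filterI; first by apply: open_nbhs_nbhs; split=> //; exact: cdom_open.
  by apply: cF; apply: open_nbhs_nbhs; split=> //; exact: cdom_open.
apply: filterS (near_chart dphi domx) => y [[h1 h2] h3]; split=> //.
by exists (cinv phi y).
Qed.

Lemma local_form_diff X Y (F : X -> Y) x phi psi : C1_map F ->
  chart_at x phi -> chart_at (F x) psi -> differentiable (local_form F phi psi) (phi x).
Proof.
move=> [_ dF] [aphi dphi] [apsi dpsi].
by apply: (dF _ _ aphi apsi _ _).1; exists x.
Qed.

Lemma C1_map_id X : C1_map (fun x : X => x).
Proof. by split=> [x|phi psi aphi apsi]; [exact: cvg_id|exact: matlas_C1]. Qed.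

(** The chain rule near a point, where the intermediate chart cancels. *)
Lemma local_form_comp X Y Z (F : X -> Y) (G : Y -> Z) x phi psi rho u :
  C1_map F -> C1_map G -> chart_at x phi -> chart_at (F x) psi -> chart_at (G (F x)) rho ->
  'd (local_form G psi rho) (psi (F x)) ('d (local_form F phi psi) (phi x) u) =
  'd (local_form (G \o F) phi rho) (phi x) u.
Proof.
move=> cF cG phix psix rhox; have [_ dphi] := phix.
apply: near_eq_diff_comp.
- by rewrite /local_form/= cmapK.
- exact: local_form_diff.
- exact: local_form_diff.
- apply: filterS (near_local cF phix psix) => y [_ _ h _].
  by rewrite /local_form/= cmapK.
Qed.

Lemma transitionE X (x : X) phi psi u :
  transition x phi psi u = 'd (local_form (fun x : X => x) phi psi) (phi x) u.
Proof. by []. Qed.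

(** Changing charts composes the local form with transition maps, so by the
chain rule the charts chosen in the definition of the tangent map may be
replaced by any others. *)
Lemma tangent_map_coord X Y (F : X -> Y) x phi psi (v : tangent x) : C1_map F ->
  chart_at x phi -> chart_at (F x) psi ->
  coord_map (F x) psi (tangent_map F x v) =
  'd (local_form F phi psi) (phi x) (coord_map x phi v).
Proof.
move=> cF phix psix.
have phi0x := some_chartP x; have psi0x := some_chartP (F x).
rewrite (coord_map_transition _ psi0x psix) /tangent_map.
rewrite !comp_lfunE coord_mapVK// lfunE/=.
rewrite (coord_map_transition v phix phi0x).
set u := coord_map x phi v; rewrite !transitionE.
have e1 := local_form_comp u (C1_map_id X) cF phix phi0x psi0x.
have e2 := local_form_comp u cF (C1_map_id Y) phix psi0x psix.
rewrite -[RHS]e2; congr ('d _ _ _); exact: e1.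
Qed.

Lemma tangent_map_id X (x : X) : tangent_map (fun x : X => x) x = \1%VF.
Proof.
have phix := some_chartP x; apply/lfunP => v; rewrite id_lfunE.
apply: (coord_map_inj phix); rewrite (tangent_map_coord v (C1_map_id X) phix phix).
exact: transition_id.
Qed.

Lemma tangent_map_comp X Y Z (F : X -> Y) (G : Y -> Z) (x : X) :
  C1_map F -> C1_map G -> C1_map (fun x => G (F x)) ->
  tangent_map (fun x => G (F x)) x = (tangent_map G (F x) \o tangent_map F x)%VF.
Proof.
move=> cF cG cGF; have phix := some_chartP x; have psix := some_chartP (F x).
have rhox := some_chartP (G (F x)).
apply/lfunP => v; apply: (coord_map_inj rhox); rewrite comp_lfunE.
rewrite (tangent_map_coord v cGF phix rhox) (tangent_map_coord _ cG psix rhox).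
rewrite (tangent_map_coord v cF phix psix).
exact/esym/(local_form_comp _ cF cG phix psix rhox).
Qed.

(** Differentiability only depends on the germ of the map. *)
Lemma near_eq_differentiable m p (f g : 'rV[R]_m -> 'rV[R]_p) (y : 'rV[R]_m) :
  (\forall z \near y, f z = g z) -> differentiable f y -> differentiable g y.
Proof.
move=> fg df; have dgE := near_eq_diff fg df.
apply/diff_locallyP; rewrite dgE; split; first exact: diff_continuous.
have gy : g y = f y by have /nbhs_singleton := fg.
apply/eqaddoP => e e0; have /diff_locallyP[_ /eqaddoP/(_ e e0)] := df.
have : \forall z \near (0 : 'rV[R]_m), f (shift y z) = g (shift y z).
  by move: fg; rewrite (near_shift 0) subr0; apply: filterS => z.
by apply: filterS2 => z fgz; rewrite !fctE/= gy fgz.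
Qed.

Lemma cvg_lin_rV (T : Type) (F : set_system T) (FF : Filter F) m n
    (A : T -> {linear 'rV[R]_m -> 'rV[R]_n}) (A0 : {linear 'rV[R]_m -> 'rV[R]_n}) g v :
  (forall u, A t u @[t --> F] --> A0 u) -> g @ F --> v -> A t (g t) @[t --> F] --> A0 v.
Proof.
move=> AA gv; have E (B : {linear 'rV[R]_m -> 'rV[R]_n}) u :
    B u = \sum_i u 0 i *: B (delta_mx 0 i).
  by rewrite {1}[u]row_sum_delta linear_sum; apply: eq_bigr => i _; rewrite linearZ.
apply: (mx_cvg FF) => i j; rewrite E summxE.
under eq_fun do rewrite E summxE.
apply: (cvg_sumr FF) => l; rewrite mxE; under eq_fun do rewrite mxE.
by apply: (@cvgM _ _ F FF); apply: mx_cvg_entry.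
Qed.

(** Near a given point the local form of the composition factors through a chart
of the intermediate manifold. Continuity of its differential uses that, for
linear maps, pointwise convergence implies joint convergence. *)
Lemma C1_map_comp X Y Z (F : X -> Y) (G : Y -> Z) :
  C1_map F -> C1_map G -> C1_map (fun x => G (F x)).
Proof.
move=> cF cG; have [F0 dF] := cF; have [G0 dG] := cG.
have GF0 : continuous (fun x => G (F x)) by move=> x; exact: (continuous_comp (F0 x) (G0 (F x))).
split=> // phi rho aphi arho _ [x [dphi drho] <-].
pose psi := some_chart (F x); have psix : chart_at (F x) psi := some_chartP (F x).
have [apsi dpsi] := psix.
have key (x' : X) u : cdom phi x' -> cdom psi (F x') -> cdom rho (G (F x')) ->
   differentiable (local_form (G \o F) phi rho) (phi x') /\
   'd (local_form (G \o F) phi rho) (phi x') u =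
   'd (local_form G psi rho) (psi (F x')) ('d (local_form F phi psi) (phi x') u).
  move=> h1 h2 h3; split; last first.
    by apply/esym/local_form_comp.
  have phix' : chart_at x' phi by [].
  have psix' : chart_at (F x') psi by [].
  have rhox' : chart_at (G (F x')) rho by [].
  apply: (@near_eq_differentiable _ _ (local_form G psi rho \o local_form F phi psi)).
    apply: filterS (near_local cF phix' psix') => y [_ _ h _].
    by rewrite /local_form/= cmapK.
  apply: differentiable_comp; first exact: local_form_diff.
  rewrite (_ : local_form F phi psi (phi x') = psi (F x')); first exact: local_form_diff.
  by rewrite /local_form/= cmapK.
suff : differentiable (local_form (G \o F) phi rho) (phi x) /\ forall v,
  {for phi x, continuous (fun z => 'd (local_form (G \o F) phi rho) z v)} by [].
split; first exact: (key x 0 dphi dpsi drho).1.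
move=> v.
have phix : chart_at x phi by [].
have rhox : chart_at (G (F x)) rho by [].
have cphi : F (cinv phi z) @[z --> phi x] --> F x.
  rewrite -{2}(cmapK dphi).
  apply: (@continuous_comp _ _ _ (cinv phi) F); last exact: F0.
  exact: cinv_cont.
have nearE : \forall z \near phi x,
    'd (local_form G psi rho) (local_form F phi psi z) ('d (local_form F phi psi) z v) =
    'd (local_form (G \o F) phi rho) z v.
  have nearG : \forall z \near phi x, cdom rho (G (F (cinv phi z))).
    apply: (cphi [set y | cdom rho (G y)]); apply: G0; apply: open_nbhs_nbhs.
    by split=> //; exact: cdom_open.
  apply: filterS2 nearG (near_local cF phix psix) => z h1 [_ h2 h3 h4].
  by rewrite -[in RHS]h4 (key _ v h2 h3 h1).2 h4.
have E := (key x v dphi dpsi drho).2.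
suff lim0 : 'd (local_form G psi rho) (local_form F phi psi z) ('d (local_form F phi psi) z v)
    @[z --> phi x] --> 'd (local_form (G \o F) phi rho) (phi x) v.
  exact: cvg_trans (near_eq_cvg nearE) lim0.
rewrite E; apply: (cvg_lin_rV (nbhs_filter (phi x))); last first.
  by apply: (dF _ _ aphi apsi _ _).2; exists x.
move=> u; apply: (@cvg_comp _ _ _ (local_form F phi psi)
  (fun z => 'd (local_form G psi rho) z u) _ (nbhs (psi (F x)))).
  have -> : psi (F x) = local_form F phi psi (phi x) by rewrite /local_form/= cmapK.
  exact: differentiable_continuous (local_form_diff cF phix psix).
by apply: (dG _ _ apsi arho _ _).2; exists (F x).
Qed.

End TangentMap.

(** * Pull-back along maps of manifolds *)

Section Pullback.
Context {R : realType} (X Y : manifold R) (F : X -> Y).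
Hypothesis cF : C1_map F.

Lemma pullback_sections delta :
  normal_sections Y delta -> normal_sections X (pullback F delta).
Proof. by move=> nd x k; apply: pull_normal; exact: nd. Qed.

Lemma pullback_local k phi psi x (delta : mdens Y) w :
  chart_at x phi -> chart_at (F x) psi ->
  pull (coord_map x phi)^-1%VF (@pullback _ _ _ F delta x k) w =
  pull (coord_map (F x) psi)^-1%VF (@delta (F x) k)
    (cone_map (linfun ('d (local_form F phi psi) (phi x))) w).
Proof.
move=> phix psix; rewrite /pull /pullback /pull -!cone_map_comp.
congr (delta (F x) k (cone_map _ w)); apply/lfunP => v.
apply: (coord_map_inj psix); rewrite comp_lfunE (tangent_map_coord _ cF phix psix) coord_mapVK//.
by rewrite comp_lfunE coord_mapVK// lfunE.
Qed.

(** In charts the pull-back of a density is its composition with the map induced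
on cones by the differential, which depends continuously on the point. *)
Lemma pullback_continuous delta : continuous_mdens delta -> continuous_mdens (pullback F delta).
Proof.
move=> cd k phi aphi; have [F0 dF] := cF.
apply: continuous_in_subspaceT => -[x w] /set_mem[/= dphi _].
have phix : chart_at x phi by [].
have psix := some_chartP (F x); set psi := some_chart (F x) in psix.
have [apsi dpsi] := psix.
have [D DE] : exists D, forall x', D x' = linfun ('d (local_form F phi psi) (phi x')).
  by exists (fun x' => linfun ('d (local_form F phi psi) (phi x'))).
have Dc v : D p.1 v @[p --> (x, w)] --> D x v.
  rewrite DE lfunE; under eq_fun do rewrite DE lfunE.
  apply: (@cvg_comp _ _ _ (fun p : X * cone k 'rV[R]_(mdim X) => phi p.1)
    (fun z => 'd (local_form F phi psi) z v) _ (nbhs (phi x))).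
    apply: (@cvg_comp _ _ _ (fun p : X * cone k 'rV[R]_(mdim X) => p.1) phi
      _ (nbhs x)); [exact: cvg_fst|exact: cmap_cont].
  by apply: (dF _ _ aphi apsi _ _).2; exists x.
pose h (p : Y * cone k 'rV[R]_(mdim Y)) := pull (coord_map p.1 psi)^-1%VF (@delta p.1 k) p.2.
pose g (p : X * cone k 'rV[R]_(mdim X)) := (F p.1, cone_map (D p.1) p.2).
have nearE : \forall p \near (x, w),
    h (g p) = pull (coord_map p.1 phi)^-1%VF (@pullback _ _ _ F delta p.1 k) p.2.
  have : \forall x' \near x, cdom phi x' /\ cdom psi (F x').
    apply: filterI; first by apply: open_nbhs_nbhs; split=> //; exact: cdom_open.
    by apply: F0; apply: open_nbhs_nbhs; split=> //; exact: cdom_open.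
  move=> near1; 
  have nN : nbhs (x, w) [set p | cdom phi p.1 /\ cdom psi (F p.1)].
    exact: (@cvg_fst _ _ (nbhs x) (nbhs w) _ _ near1).
  apply: (@filterS _ _ (nbhs_filter (x, w)) _ _ _ nN) => -[x' w'] /= [h1 h2].
  by rewrite (@pullback_local k phi psi)// -DE.
have gc : {for (x, w), continuous g}.
  apply: (cvg_pair (F := nbhs (x, w)) (G := nbhs (F x)) (H := nbhs (cone_map (D x) w))).
    apply: (@cvg_comp _ _ _ (fun p : X * cone k 'rV[R]_(mdim X) => p.1) F
      _ (nbhs x)); [exact: cvg_fst|exact: F0].
  apply: (cvg_cone_map (nbhs_filter (x, w))); last exact: cvg_snd.
  exact: Dc.
have hc : {for g (x, w), continuous h}.
  have op : open (cdom psi `*` [set: cone k 'rV[R]_(mdim Y)]).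
    rewrite openE => -[y u] [/= dy _].
    exists (cdom psi, setT) => //; split; last exact: filterT.
    by apply: open_nbhs_nbhs; split=> //; exact: cdom_open.
  have := cd k psi apsi; rewrite continuous_open_subspace//; apply.
  by apply/mem_set; split.
have := continuous_comp gc hc.
move=> /(cvg_trans (near_eq_cvg nearE)).
by rewrite /continuous_at /= (nbhs_singleton nearE).
Qed.

Lemma pullback_gdens_mul (U V : vectType R) (L : 'Hom(U, V)) (a b : gdens V) m w :
  normal_gdens a -> normal_gdens b ->
  pull L (gdens_mul a b (k := m)) w =
  gdens_mul (fun k => pull L (a k)) (fun k => pull L (b k)) w.
Proof.
move=> na nb; rewrite /pull/= /gdens_mul; apply: eq_bigr => p _.
by rewrite -pull_nprod// subnKC// -ltnS.
Qed.

(** The product is pointwise, so this is the statement for linear maps at each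
tangent map. *)
Lemma pullback_ring_hom (S : set (mdens Y)) (S' : set (mdens X)) :
  S `<=` normal_sections Y -> (forall a, S a -> S' (pullback F a)) ->
  graded_ring_hom (mdens_ops Y) S (mdens_ops X) S' (pullback F).
Proof.
move=> sub SS; split=> //.
- by apply: mdens_ext => x k w; exact: (congr1 (fun d => d w) (pull_gdens1 _ k)).
- move=> a b /sub na /sub nb; apply: mdens_ext => x k w.
  exact: (pullback_gdens_mul (tangent_map F x) w (na (F x)) (nb (F x))).
Qed.

End Pullback.

Theorem theorem6 (R : realType) :
  (* pull-back is a homomorphism between the rings of normal densities *)
  (forall (X Y : manifold R) (F : X -> Y), C1_map F ->
     graded_ring_hom (mdens_ops Y) (normal_densities Y)
                     (mdens_ops X) (normal_densities X) (pullback F) /\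
     graded_ring_hom (mdens_ops Y) (normal_sections Y)
                     (mdens_ops X) (normal_sections X) (pullback F)) /\
  (* contravariant functor to commutative graded rings: objects, identities,
     compositions *)
  (forall X : manifold R,
     comm_graded_laws (mdens_ops X) (normal_densities X) /\
     comm_graded_ring (mdens_ops X) (normal_sections X)) /\
  (forall X : manifold R, C1_map (fun x : X => x) /\
     forall delta, normal_sections X delta ->
       pullback (fun x : X => x) delta = delta) /\
  (forall (X Y Z : manifold R) (F : X -> Y) (G : Y -> Z),
     C1_map F -> C1_map G ->
     C1_map (fun x => G (F x)) /\
     forall delta, normal_sections Z delta ->
       pullback (fun x => G (F x)) delta = pullback F (pullback G delta)) /\
  (* compatibility with multiplication by continuous functions *)
  (forall (X Y : manifold R) (F : X -> Y), C1_map F ->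
     forall (delta : mdens Y) (f : Y -> R),
       normal_densities Y delta -> continuous f ->
       normal_densities Y (mdens_scale f delta) /\
       pullback F (mdens_scale f delta) =
         mdens_scale (fun x => f (F x)) (pullback F delta)).
Proof.
split; [|split; [|split; [|split]]].
- move=> X Y F cF; split.
    apply: pullback_ring_hom => [a []//|a [na ca]].
    by split; [exact: pullback_sections|exact: pullback_continuous].
  by apply: pullback_ring_hom => // a; exact: pullback_sections.
- move=> X; split; first exact: densities_laws.
  by split; [exact: sections_laws|exact: sections_mul].
- move=> X; split; first exact: C1_map_id.
  move=> delta _; apply: mdens_ext => x k w.
  by rewrite /pullback /pull tangent_map_id cone_map_id.
- move=> X Y Z F G cF cG; have cGF := C1_map_comp cF cG; split=> // delta _.
  apply: mdens_ext => x k w.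
  by rewrite /pullback /pull tangent_map_comp// cone_map_comp.
- move=> X Y F cF delta f nd cf; split=> //.
  exact: scale_normal_densities.
Qed.
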